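(* Let $H\in(1/2,1)$ and $\alpha\in(1-H,1)$. Assume that $V'(\cdot)$ is Lipschitz continuous on $\mathbb{R}$. Then, for a given fractional Brownian motion $B_H$ with Hurst parameter $H$ and a given initial random variable $x_0$ on the same probability space (possibly coupled to $B_H$), there exists a unique strong solution on $[0,\infty)$ to the fractional stochastic differential equation $$D_c^{\alpha}x=-V'(x)+C_H\dot B_H$$ with initial condition $x_0$ (uniqueness meaning that any two strong solutions coincide almost surely).
   Context: $B_H$ is a fractional Brownian motion with Hurst parameter $H$ on a probability space $(\Omega,\mathcal F,P)$: a centered continuous Gaussian process with $\mathbb{E}(B_H(t)B_H(s))=\frac12(s^{2H}+t^{2H}-|t-s|^{2H})$, $s,t\ge0$. The constant is $C_H=\big(H(2H-1)\Gamma(1-\alpha)\big)^{-1/2}$. Stochastic integral: for deterministic $\varphi\in L^{1/H}[0,T]$, $\int_0^T\varphi\,dB_H$ is the $L^2(\Omega)$-limit of the integrals of step functions, where $\int_0^T\sum_j a_j1_{(t_{j-1},t_j]}\,dB_H=\sum_j a_j(B_H(t_j)-B_H(t_{j-1}))$. The process $t\mapsto\int_0^t(t-s)^{\alpha-1}dB_H(s)$ is (Hölder) continuous almost surely. The equation $D_c^{\alpha}x=-V'(x)+C_H\dot B_H$ (with $D_c^\alpha$ the Caputo derivative of order $\alpha$ and $\dot B_H$ the distributional derivative of $B_H$) is by definition understood in the integral form $$x(t)=x(0)-\frac{1}{\Gamma(\alpha)}\int_0^t(t-s)^{\alpha-1}V'(x(s))\,ds+\frac{C_H}{\Gamma(\alpha)}\int_0^t(t-s)^{\alpha-1}\,dB_H(s).\qquad(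 * )$$ A strong solution with initial condition $x_0$ on the interval $[0,T)$ ($T>0$, with $T=\infty$ allowed) is a process $x(t)$ that is continuous and adapted to the filtration $(\mathcal G_t)_{t\in[0,T)}$, where $\mathcal G_t=\bigcap_{s>t}\mathcal A_s$ and $\mathcal A_s$ is the $\sigma$-algebra generated by $\sigma(B_H(\tau),0\le\tau\le s)\cup\sigma(x_0)$, such that (1) $P(x(0)=x_0)=1$, and (2) with probability one, $( * )$ holds for all $t\in[0,T)$. *)

(* Defs.v *)
From HB Require Import structures.
From mathcomp Require Export all_boot all_order all_algebra.
From mathcomp Require Export all_classical all_reals all_analysis.
Export numFieldNormedType.Exports.

Set Implicit Arguments.
Unset Strict Implicit.
Unset Printing Implicit Defensive.

Import Order.TTheory GRing.Theory Num.Theory.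

Local Open Scope classical_set_scope.
Local Open Scope ring_scope.

(* Processes are plain functions X : R -> Omega -> R; only the values at the
   times of interest (nonnegative, or in [0, T)) are ever constrained. *)

Definition Gamma {R : realType} (z : R) : R :=
  \int[lebesgue_measure]_(u in `]0, +oo[) (u `^ (z - 1) * expR (- u)).

Section processes.
Context {R : realType} {d : measure_display} {Omega : measurableType d}.
Context (P : probability Omega R).
Implicit Types (B X Z : R -> Omega -> R) (Y : Omega -> R).
Implicit Types (H alpha s t : R) (T : \bar R) (V : R -> R).

(* sigma = 0 is the degenerate case; the library's normal_prob m 0 is not the
   Dirac mass at m. *)
Definition gaussian Y : Prop :=
  exists m sigma : R, 0 <= sigma /\
    forall A, measurable A ->
      P (Y @^-1` A) = if sigma == 0 then \d_m A else normal_prob m sigma A.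

Definition gaussian_process X : Prop :=
  forall (n : nat) (c t : 'I_n -> R), (forall i, 0 <= t i) ->
    gaussian (fun w => \sum_(i < n) c i * X (t i) w).

Definition time_domain T : set R := [set t | 0 <= t /\ (t%:E < T)%E].

Definition ae_continuous T X : Prop :=
  {ae P, forall w, {within time_domain T, continuous (fun t => X t w)}}.

Record fractional_brownian_motion H B : Prop := {
  fbm_measurable : forall t, 0 <= t -> measurable_fun setT (B t) ;
  fbm_continuous : ae_continuous +oo%E B ;
  fbm_gaussian : gaussian_process B ;
  fbm_centered : forall t, 0 <= t -> ('E_P[B t] = 0)%E ;
  fbm_covariance : forall s t, 0 <= s -> 0 <= t ->
    'E_P[fun w => (B t w * B s w)%R]%E =
    ((s `^ (2 * H) + t `^ (2 * H) - `|t - s| `^ (2 * H)) / 2)%:E }.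

(* A step function on [0, t] is given by a seq p = [:: t_1; ...; t_n] with
   itv_partition 0 t p, i.e. 0 = t_0 < t_1 < ... < t_n = t, and coefficients
   a 0, ..., a n.-1; the j-th interval is ]nth 0 (0 :: p) j, nth 0 p j]. *)
Definition step_fun (p : seq R) (a : nat -> R) (s : R) : R :=
  \sum_(j < size p) a j * \1_(`]nth 0 (0 :: p) j, nth 0 p j]) s.

Definition step_integral B (p : seq R) (a : nat -> R) (w : Omega) : R :=
  \sum_(j < size p) a j * (B (nth 0 p j) w - B (nth 0 (0 :: p) j) w).

(* Y is a version of the integral of phi over [0, t] against B: phi is in
   L^{1/H}[0, t], and Y is the L^2(P)-limit of the integrals of some sequence
   of step functions that converges to phi in L^{1/H}[0, t].  For a fractional
   Brownian motion with H > 1/2 this determines Y up to a P-null set. *)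
Definition is_integral H B t (phi : R -> R) Y : Prop :=
  [/\ measurable_fun `[0, t] phi,
      (\int[lebesgue_measure]_(s in `[0%R, t]) (`|phi s| `^ H^-1)%:E < +oo)%E,
      measurable_fun setT Y &
      exists (p : nat -> seq R) (a : nat -> nat -> R),
      [/\ forall n, itv_partition 0 t (p n),
          (fun n => \int[lebesgue_measure]_(s in `[0%R, t])
             (`|step_fun (p n) (a n) s - phi s| `^ H^-1)%:E)%E @ \oo --> 0%E &
          (fun n => 'E_P[fun w => ((step_integral B (p n) (a n) w - Y w) ^+ 2)%R]%E)
             @ \oo --> 0%E]].

(* A continuous version of the process t |-> \int_0^t (t-s)^{alpha-1} dB(s). *)
Definition fractional_noise H alpha B T Z : Prop :=
  ae_continuous T Z /\
  forall t, time_domain T t ->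
    is_integral H B t (fun s => (t - s) `^ (alpha - 1)) (Z t).

Definition history B (x0 : Omega -> R) (s : R) : set_system Omega :=
  <<s <<s \bigcup_(tau in `[0, s]) g_sigma_algebra_preimage (B tau) >>
      `|` g_sigma_algebra_preimage x0 >>.

Definition filtration B (x0 : Omega -> R) t : set_system Omega :=
  \bigcap_(s in `]t, +oo[) history B x0 s.

Definition adapted T (F : R -> set_system Omega) X : Prop :=
  forall t, time_domain T t -> forall A, measurable A -> F t (X t @^-1` A).

Definition C_ H alpha : R :=
  (H * (2 * H - 1) * Gamma (1 - alpha)) `^ (- 2^-1).

(* The process Z gives the stochastic integrals of the equation a meaning
   simultaneously for all times; it is unique up to indistinguishability. *)
Definition strong_solution H alpha V B (x0 : Omega -> R) T X : Prop :=
  [/\ ae_continuous T X,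
      adapted T (filtration B x0) X,
      P [set w | X 0 w = x0 w] = 1%E &
      exists2 Z, fractional_noise H alpha B T Z &
      {ae P, forall w, forall t, time_domain T t ->
        X t w = X 0 w
          - (Gamma alpha)^-1 *
            \int[lebesgue_measure]_(s in `[0, t])
              ((t - s) `^ (alpha - 1) * derive1 V (X s w))
          + C_ H alpha / Gamma alpha * Z t w}].

Definition indistinguishable T X X' : Prop :=
  {ae P, forall w, forall t, time_domain T t -> X t w = X' t w}.

End processes.

(* Main.v *)
Require Import Defs.
From HB Require Import structures.
From mathcomp Require Import measurable_realfun ring lra.

Set Implicit Arguments.
Unset Strict Implicit.
Unset Printing Implicit Defensive.

Import Order.TTheory GRing.Theory Num.Theory.
Local Open Scope classical_set_scope.
Local Open Scope ring_scope.

(** The covariance of the increments of [B] is the integral of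
    [H (2H - 1) |u - v|^(2H - 2)] over a rectangle, so the one-dimensional
    Hardy-Littlewood-Sobolev inequality bounds the second moment of a step
    integral by the L^(1/H) norm of the step function; hence the stochastic
    integral does not depend on the approximating sequence.  Gaussian moment
    bounds and dyadic chaining make almost every path of [B] locally
    [g]-Hoelder for every [g < H].  Choosing [1 - alpha < g], the left-point
    dyadic Riemann sums of the noise [\int_0^t (t - s)^(alpha - 1) dB(s)]
    telescope into a geometric series, converge uniformly in [t] on compact
    sets, and their limit is a continuous version of the integral.

    Given the noise, the equation is solved pathwise.  In the norm
    [sup_t e^(- lam t) |f t|] with [lam] large, the Volterra operator with
    kernel [(t - s)^(alpha - 1)] composed with the Lipschitz function [V'] is a
    contraction, which gives uniqueness and the convergence of the Picard
    iterates.  Each iterate at time [t] is obtained from [x0] and countably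
    many [B s], [s <= t], through finite sums and upper limits, so that the
    solution is adapted even though the filtration is not completed. *)

(** * Integrals of powers of the absolute value *)

(** Since H > 1/2, the kernel |u - v|^(2H - 2) is locally integrable, and 1/H is the exponent for
    which the Hardy-Littlewood-Sobolev inequality is scale invariant. Only smallness is used: the
    second moment of a step integral must tend to 0 with N, a bound on the 1/H-th power of the norm.
    Hence the non-homogeneous bound 2cN + HN^2 suffices, and it follows from a pointwise inequality
    and Tonelli.

    Two features of the definitions shape the rest. A strong solution carries its own noise process,
    so uniqueness has to compare two arbitrary versions: they agree almost surely at each dyadic
    time, and continuity extends this to all times off a single null set. And nothing may be
    redefined on a null set, so noise and solution are total formulas that make sense at every w,
    while existence of the limits is claimed only almost surely.

    The hypothesis 1 - alpha < H serves twice: it leaves room for a Hoelder exponent g with g +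
    alpha > 1, and it puts (t - s)^(alpha - 1) in L^(1/H). *)

Section improper_ftc.
Context {R : realType}.
Notation mu := (@lebesgue_measure R).
Implicit Types (f F : R -> R) (a b : R).

Lemma measurable_fun_oo_continuous f a b :
  {in `]a, b[, forall x, {for x, continuous f}} -> measurable_fun `]a, b[ f.
Proof.
move=> cf; apply: open_continuous_measurable_fun => //.
by apply/in_continuous_mksetP => x; exact: cf.
Qed.

(** [f] may blow up at both ends: the usual theorem is applied on the compact intervals
    [a + e n, b - e n], and monotone convergence on the left meets continuity of [F] on the
    right. *)
Lemma ge0_integral_oo_FTC0 f F a b : (a < b)%R -> continuous F ->
  {in `]a, b[, forall x, 0 <= f x} ->
  {in `]a, b[, forall x, {for x, continuous f}} ->
  {in `]a, b[, forall x, is_derive x (1 : R) F (f x)} ->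
  (\int[mu]_(x in `]a, b[) (f x)%:E = (F b - F a)%:E)%E.
Proof.
move=> ab cF f0 cf dF.
(* With n + 3, two margins fit strictly inside the interval already at n = 0. *)
pose e n : R := (b - a) / n.+3%:R.
have e0 n : 0 < e n by rewrite divr_gt0// subr_gt0.
have e2 n : e n + e n < b - a.
  rewrite /e -mulrDl ltr_pdivrMr// -mulr2n -[ltLHS]mulr_natr ltr_pM2l ?subr_gt0//.
  by rewrite ltr_nat.
have ecvg : e n @[n --> \oo] --> (0 : R).
  rewrite -(mulr0 (b - a)); apply: cvgMr.
  have := @cvg_harmonic R; rewrite -(cvg_shiftn 2)/=.
  by apply: cvg_trans; apply: near_eq_cvg; near=> n; rewrite /harmonic/= addn2.
pose A n : set R := [set` `[a + e n, b - e n]].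
have An n x : x \in `[a + e n, b - e n] -> x \in `]a, b[.
  rewrite !in_itv/= => /andP[h1 h2]; have := e0 n; lra.
have UA : \bigcup_n A n = [set` `]a, b[].
  apply/seteqP; split=> [x [n _ /An]//|x /=]; rewrite in_itv/= => /andP[ax xb].
  have m0 : 0 < Num.min (x - a) (b - x) by rewrite lt_min !subr_gt0 ax.
  have /cvgrPdist_lt/(_ _ m0)[N _ /(_ N (leqnn N))] := ecvg.
  rewrite sub0r normrN gtr0_norm// lt_min => /andP[h1 h2].
  by exists N => //; rewrite /A/= in_itv/=; lra.
have ndA : nondecreasing_seq A.
  move=> m n mn; apply/subsetPset => x; rewrite /A/= !in_itv/=.
  have : e n <= e m.
    by rewrite /e ler_pM2l ?subr_gt0// lef_pV2 ?posrE// ler_nat !ltnS.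
  lra.
have mf : measurable_fun (`]a, b[ : set R) (EFin \o f).
  by apply/measurable_EFinP; exact: measurable_fun_oo_continuous.
have H1 : (\int[mu]_(x in A n) (f x)%:E)%E @[n --> \oo] -->
    (\int[mu]_(x in `]a, b[) (f x)%:E)%E.
  rewrite -UA; apply: ge0_nondecreasing_set_cvg_integral => //.
  - by move=> n; exact: measurable_itv.
  - move=> n; apply: measurable_funS mf => //.
    by move=> x; exact: An.
  - by move=> n x /An/f0; rewrite lee_fin.
have H2 n : (\int[mu]_(x in A n) (f x)%:E = (F (b - e n) - F (a + e n))%:E)%E.
  rewrite (@continuous_FTC2 _ f F) ?EFinB//.
  - have := e2 n; lra.
  - by apply: continuous_in_subspaceT => x /set_mem/An/cf.
  - split.
    + move=> x xab; have /An/dF[]// : x \in `[a + e n, b - e n].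
      by apply: subset_itv_oo_cc xab.
    + by apply: cvg_at_right_filter; exact: cF.
    + by apply: cvg_at_left_filter; exact: cF.
  - move=> x xab; have /An/dF[_] : x \in `[a + e n, b - e n].
      by apply: subset_itv_oo_cc xab.
    by rewrite derive1E.
have H3 : (\int[mu]_(x in A n) (f x)%:E)%E @[n --> \oo] --> (F b - F a)%:E.
  under eq_fun do rewrite H2.
  apply: cvg_EFin; first exact: nearW.
  have hb : b - e n @[n --> \oo] --> b.
    by rewrite -[X in _ --> X]subr0; apply: cvgB => //; exact: cvg_cst.
  have ha : a + e n @[n --> \oo] --> a.
    by rewrite -[X in _ --> X]addr0; apply: cvgD => //; exact: cvg_cst.
  apply: cvgB; [exact: (cvg_comp _ _ hb (cF b))|exact: (cvg_comp _ _ ha (cF a))].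
exact: (cvg_unique _ H1 H3).
Unshelve. all: by end_near. Qed.

(** The list [s] holds the interior singularities. The interval is cut at them one by one, and
    continuity of [F] makes the boundary terms cancel. *)
Lemma ge0_integral_oo_FTC f F a b (s : seq R) : (a <= b)%R -> continuous F ->
  measurable_fun `]a, b[ f ->
  {in `]a, b[, forall x, 0 <= f x} ->
  {in `]a, b[, forall x, x \notin s -> {for x, continuous f}} ->
  {in `]a, b[, forall x, x \notin s -> is_derive x (1 : R) F (f x)} ->
  (\int[mu]_(x in `]a, b[) (f x)%:E = (F b - F a)%:E)%E.
Proof.
move=> + cF; elim: s a b => [|c s IH] a b.
  rewrite le_eqVlt => /predU1P[<- _ _ _ _|ab mf f0 cf dF].
    by rewrite set_itvoo0 integral_set0 subrr.
  apply: ge0_integral_oo_FTC0 => //; first by move=> x xab; exact: cf.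
  by move=> x xab; exact: dF.
move=> ab mf f0 cf dF.
have [cab|cab] := boolP (c \in `]a, b[); last first.
  apply: IH => // x xab xs.
    by apply: cf => //; rewrite in_cons negb_or xs andbT; apply: contraNneq cab => <-.
  by apply: dF => //; rewrite in_cons negb_or xs andbT; apply: contraNneq cab => <-.
move: (cab); rewrite in_itv/= => /andP[ac cb].
have ->: [set` `]a, b[] = [set` `]a, c]] `|` [set` `]c, b[].
  rewrite -itv_bndbnd_setU//= ?bnd_simp//; exact: ltW.
have S1 : [set` `]a, c[] `<=` [set` `]a, b[].
  by move=> x /=; rewrite !in_itv/=; lra.
have S2 : [set` `]c, b[] `<=` [set` `]a, b[].
  by move=> x /=; rewrite !in_itv/=; lra.
have S3 : [set` `]a, c]] `<=` [set` `]a, b[].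
  by move=> x /=; rewrite !in_itv/=; lra.
rewrite ge0_integral_setU//=; last 3 first.
- apply/measurable_EFinP/measurable_funU => //; split.
    by apply: measurable_funS S3 mf.
  by apply: measurable_funS S2 mf.
- move=> x [] h; rewrite lee_fin f0//; [exact: S3|exact: S2].
- apply/disj_setPS => x /= []; rewrite !in_itv/=; lra.
rewrite -(integral_itv_bndo_bndc); last first.
  by apply/measurable_EFinP; apply: measurable_funS S1 mf.
rewrite (IH a c) ?(IH c b) -?EFinD.
- by congr EFin; lra.
- exact: ltW.
- by apply: measurable_funS S2 mf.
- by move=> x /S2 /f0.
- move=> x xcb xs; apply: cf; first exact: S2.
  by rewrite in_cons negb_or xs andbT; move: xcb; rewrite in_itv/=; lra.
- move=> x xcb xs; apply: dF; first exact: S2.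
  by rewrite in_cons negb_or xs andbT; move: xcb; rewrite in_itv/=; lra.
- exact: ltW.
- by apply: measurable_funS S1 mf.
- by move=> x /S1 /f0.
- move=> x xcb xs; apply: cf; first exact: S1.
  by rewrite in_cons negb_or xs andbT; move: xcb; rewrite in_itv/=; lra.
- move=> x xcb xs; apply: dF; first exact: S1.
  by rewrite in_cons negb_or xs andbT; move: xcb; rewrite in_itv/=; lra.
Qed.
End improper_ftc.

Section abs_powers.
Context {R : realType}.
Notation mu := (@lebesgue_measure R).
Implicit Types (b x y z : R).

Lemma is_derive_norm_powR b z : z != 0 ->
  is_derive z (1 : R) (fun x => `|x| `^ b) (b * (Num.sg z * `|z| `^ (b - 1))).
Proof.
move=> z0; case: (ltgtP z 0) z0 => // zs _.
- apply: (@near_eq_is_derive _ _ _ (fun x => (- x) `^ b)).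
    near=> x; rewrite ltr0_norm//; near: x; exact: lt_nbhsl.
  have N0 : 0 < - z by rewrite oppr_gt0.
  have D := is_derive1_powR b N0.
  have E : is_derive z (1 : R) ((fun y : R => y `^ b) \o (fun y : R => - y)) (b * (- z) `^ (b - 1) * -1).
    by apply: is_derive1_comp; exact: is_deriveNid.
  apply: (is_derive_eq E).
  by rewrite ltr0_norm// ltr0_sg//; ring.
- apply: (@near_eq_is_derive _ _ _ (fun x => x `^ b)).
    near=> x; rewrite gtr0_norm//; near: x; exact: lt_nbhsr.
  have D := is_derive1_powR b zs.
  by rewrite gtr0_norm// gtr0_sg// mul1r.
Unshelve. all: by end_near. Qed.

Lemma continuous_norm_powR b : 0 < b -> continuous (fun x => `|x| `^ b).
Proof.
move=> b0 z; have [->|z0] := eqVneq z 0; last first.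
  have [D _] := is_derive_norm_powR b z0.
  by apply/differentiable_continuous/derivable1_diffP.
apply/cvgrPdist_lt => e e0; rewrite normr0 powR0 ?gt_eqF//.
exists (e `^ b^-1) => /=; first exact: powR_gt0.
move=> x; rewrite /= sub0r normrN => hx; rewrite sub0r normrN ger0_norm ?powR_ge0//.
rewrite -[ltRHS](powRr1 (ltW e0)) -(@mulVf _ b) ?gt_eqF// powRrM.
by rewrite gt0_ltr_powR// ?nnegrE ?normr_ge0 ?powR_ge0.
Qed.

(* signed power, an antiderivative of [`|z| `^ (b - 1)] up to the factor [b] *)
Definition spowR b z : R := Num.sg z * `|z| `^ b.

Lemma spowR_ge0 b z : 0 < b -> 0 <= z -> spowR b z = z `^ b.
Proof.
move=> b0; rewrite le_eqVlt => /predU1P[<-|z0].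
  by rewrite /spowR sgr0 mul0r powR0 ?gt_eqF.
by rewrite /spowR gtr0_sg// mul1r gtr0_norm.
Qed.

Lemma spowRN b z : spowR b (- z) = - spowR b z.
Proof. by rewrite /spowR sgrN normrN mulNr. Qed.

Lemma continuous_spowR b : 0 < b -> continuous (spowR b).
Proof.
move=> b0 z; have [->|z0] := eqVneq z 0; last first.
  have cn := @continuous_norm_powR _ b0 z.
  apply: cvgM => //.
  apply: (@near_cst_continuous _ _ (Num.sg z)).
  case: (ltgtP z 0) z0 => // zs _; near=> x.
    by rewrite !ltr0_sg//; near: x; exact: lt_nbhsl.
  by rewrite !gtr0_sg//; near: x; exact: lt_nbhsr.
rewrite /continuous_at /spowR sgr0 mul0r.
apply/norm_cvg0P; have := @continuous_norm_powR _ b0 0.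
rewrite /continuous_at normr0 powR0 ?gt_eqF//; apply: cvg_trans.
apply: near_eq_cvg; near=> x; rewrite normrM (ger0_norm (powR_ge0 _ _)).
have [->|x0] := eqVneq x 0; first by rewrite normr0 powR0 ?gt_eqF// mulr0.
by rewrite normr_sg x0 mul1r.
Unshelve. all: by end_near. Qed.

Lemma is_derive_spowR b z : z != 0 ->
  is_derive z (1 : R) (spowR b) (b * `|z| `^ (b - 1)).
Proof.
move=> z0; apply: (@near_eq_is_derive _ _ _ (fun x => Num.sg z * `|x| `^ b)).
  rewrite /spowR; case: (ltgtP z 0) z0 => // zs _; near=> x.
    by rewrite !ltr0_sg//; near: x; exact: lt_nbhsl.
  by rewrite !gtr0_sg//; near: x; exact: lt_nbhsr.
have D := is_derive_norm_powR b z0.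
apply: (is_derive_eq (is_deriveZ _ _)).
have s1 : Num.sg z * Num.sg z = 1 by rewrite -expr2 sqr_sg z0.
by rewrite /GRing.scale/= mulrCA !mulrA -(mulrA b) s1 mulr1.
Unshelve. all: by end_near. Qed.

Lemma le_spowR b x y : 0 < b -> x <= y -> spowR b x <= spowR b y.
Proof.
move=> b0 xy.
have pos u v : 0 <= u -> u <= v -> spowR b u <= spowR b v.
  move=> u0 uv; rewrite !spowR_ge0//; last exact: le_trans uv.
  by rewrite ge0_ler_powR ?nnegrE// ?(ltW b0)// (le_trans u0).
have [x0|x0] := leP 0 x; first exact: pos.
have [y0|y0] := leP 0 y.
  apply: (@le_trans _ _ 0); last by rewrite spowR_ge0// powR_ge0.
  by rewrite -(opprK x) spowRN oppr_le0 spowR_ge0 ?powR_ge0// oppr_ge0 ltW.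
by rewrite -(opprK x) -(opprK y) !(spowRN _ (- _)) lerN2 pos//; lra.
Qed.

Lemma integral_norm_powR b u x y : 0 < b -> x <= y ->
  (\int[mu]_(v in `]x, y[) (`|v - u| `^ (b - 1))%:E =
   ((spowR b (y - u) - spowR b (x - u)) / b)%:E)%E.
Proof.
move=> b0 xy.
have cB : continuous (fun v => v - u) by move=> v; apply: cvgB => //; exact: cvg_cst.
rewrite (@ge0_integral_oo_FTC _ _ (fun v => spowR b (v - u) / b) _ _ [:: u])//.
- by congr EFin; rewrite mulrBl.
- move=> v; apply: cvgM; last exact: cvg_cst.
  by apply: (@continuous_comp _ _ _ (fun v => v - u) (spowR b)); [exact: cB|exact: continuous_spowR].
- apply: (measurableT_comp (measurable_powR (b - 1))).
  by apply: measurableT_comp => //; exact: measurable_funB.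
- move=> v _; rewrite mem_seq1 => vu; have vu0 : v - u != 0 by rewrite subr_eq0.
  have [D _] := is_derive_norm_powR (b - 1) vu0.
  apply: (@continuous_comp _ _ _ (fun v => v - u) (fun z => `|z| `^ (b - 1))).
    exact: cB.
  by apply/differentiable_continuous/derivable1_diffP.
- move=> v _; rewrite mem_seq1 => vu; have vu0 : v - u != 0 by rewrite subr_eq0.
  have D := is_derive_spowR b vu0.
  have E : is_derive v (1 : R) (spowR b \o (fun v => v - u))
      (b * `|v - u| `^ (b - 1) * (1 - 0)).
    by apply: is_derive1_comp; apply: is_deriveB.
  have -> : (fun v => spowR b (v - u) / b) =
      (fun v => b^-1 *: (spowR b \o (fun v => v - u)) v).
    by apply/funext => w; rewrite /GRing.scale/= mulrC.
  apply: (is_derive_eq (is_deriveZ b^-1 E)).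
  by rewrite /GRing.scale/= subr0 mulr1 mulKf ?gt_eqF.
Qed.
End abs_powers.

(** * Hardy-Littlewood-Sobolev inequality *)

Lemma ge0_integralZl_fin d (T : measurableType d) (R : realType)
    (m : {measure set T -> \bar R}) (D : set T) (k : R) (f : T -> R) :
  measurable D -> measurable_fun D f -> (forall x, D x -> 0 <= f x) -> 0 <= k ->
  (\int[m]_(x in D) (k * f x)%:E = k%:E * \int[m]_(x in D) (f x)%:E)%E.
Proof.
move=> mD mf f0 k0; under eq_integral do rewrite EFinM.
by apply: ge0_integralZl_EFin => //; exact/measurable_EFinP.
Qed.

Section hls.
Context {R : realType}.
Notation mu := (@lebesgue_measure R).
Implicit Types (H a b u v z r L : R).

Lemma is_derive_shift_norm_powR b u v : v != u ->
  is_derive v (1 : R) (fun w => `|w - u| `^ b)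
    (b * (Num.sg (v - u) * `|v - u| `^ (b - 1))).
Proof.
move=> vu; have vu0 : v - u != 0 by rewrite subr_eq0.
have D := is_derive_norm_powR b vu0.
have E : is_derive v (1 : R) ((fun w => `|w| `^ b) \o (fun w => w - u))
    (b * (Num.sg (v - u) * `|v - u| `^ (b - 1)) * (1 - 0)).
  by apply: is_derive1_comp; apply: is_deriveB.
by apply: (is_derive_eq E); rewrite subr0 mulr1.
Qed.

Lemma measurable_norm_shift_powR b u D :
  measurable_fun D (fun v : R => `|v - u| `^ b).
Proof.
apply: measurable_funTS; apply: (measurableT_comp (measurable_powR b)).
by apply: measurableT_comp => //; exact: measurable_funB.
Qed.

Lemma integral_far u r L : 0 < r ->
  (\int[mu]_(v in `](u - L)%R, (u + L)%R[)
    (\1_(~` `](u - r)%R, (u + r)%R[%classic) v * `|v - u| `^ (- 2))%:E <= (2 / r)%:E)%E.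
Proof.
move=> r0; have [L0|L0] := leP L 0.
  rewrite set_itv_ge ?integral_set0 ?lee_fin ?divr_ge0 ?(ltW r0)//.
  by rewrite bnd_simp -leNgt; lra.
pose f v : R := \1_(~` `]u - r, u + r[%classic) v * `|v - u| `^ (- 2).
rewrite -/f.
pose m1 (v : R) := Num.max (u - v) r.
pose m2 (v : R) := Num.max (v - u) r.
have m1r v : r <= m1 v by rewrite le_max lexx orbT.
have m2r v : r <= m2 v by rewrite le_max lexx orbT.
have cm1 : continuous m1.
  move=> v; apply: (@continuous_max _ _ (fun v : R => u - v) (cst r) v).
    by apply: cvgB => //; exact: cvg_cst.
  exact: cvg_cst.
have cm2 : continuous m2.
  move=> v; apply: (@continuous_max _ _ (fun v : R => v - u) (cst r) v).
    by apply: cvgB => //; exact: cvg_cst.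
  exact: cvg_cst.
(* An antiderivative of [f] in one formula: |v - u|^-1 - r^-1 to the left of u - r, zero in the
   middle, r^-1 - |v - u|^-1 to the right of u + r. Its values lie between -1/r and 1/r, whence the
   bound 2/r. *)
pose F v := (m1 v)^-1 - (m2 v)^-1.
have out v : (v < u - r) || (u + r < v) -> \near v, f v = `|v - u| `^ (- 2).
  move=> /orP[h|h]; near=> w; rewrite /f indicE mem_set ?mul1r//= in_itv/=;
    move=> /andP[].
    have wh : w < u - r by near: w; exact: lt_nbhsl.
    by rewrite ltNge (ltW wh).
  have wh : u + r < w by near: w; exact: lt_nbhsr.
  by move=> _; rewrite ltNge (ltW wh).
have inn v : u - r < v < u + r -> \near v, f v = 0.
  move=> /andP[h1 h2]; near=> w; rewrite /f indicE memNset ?mul0r//=.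
  apply; rewrite in_itv/=; apply/andP; split; near: w;
    [exact: lt_nbhsr|exact: lt_nbhsl].
have tri v : v \notin [:: u - r; u + r] ->
    (v < u - r) || (u + r < v) \/ u - r < v < u + r.
  rewrite !inE negb_or => /andP[h1 h2].
  by case: (ltgtP v (u - r)) h1 => //= h1 _; [left|case: (ltgtP v (u + r)) h2 => //=; [right|left]].
rewrite (@ge0_integral_oo_FTC _ f F _ _ [:: u - r; u + r]).
- rewrite lee_fin /F.
  have h1 : (m1 (u + L))^-1 <= r^-1 by rewrite lef_pV2 ?posrE// (lt_le_trans r0).
  have h2 : (m2 (u + L))^-1 >= 0 by rewrite invr_ge0 (le_trans (ltW r0)).
  have h3 : (m1 (u - L))^-1 >= 0 by rewrite invr_ge0 (le_trans (ltW r0)).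
  have h4 : (m2 (u - L))^-1 <= r^-1 by rewrite lef_pV2 ?posrE// (lt_le_trans r0).
  lra.
- lra.
- move=> v; apply: cvgB; apply: cvgV.
  + by rewrite gt_eqF// (lt_le_trans r0).
  + exact: cm1.
  + by rewrite gt_eqF// (lt_le_trans r0).
  + exact: cm2.
- apply: measurable_funM; last exact: measurable_norm_shift_powR.
  by apply: measurable_indic; exact: measurableC.
- by move=> v _; rewrite mulr_ge0 ?powR_ge0// indicE.
- move=> v _ /tri[vo|vi].
    have vu : v != u by move: vo; case: eqVneq => // -> ; lra.
    have [D _] := is_derive_shift_norm_powR (- 2) vu.
    have cv : {for v, continuous (fun w => `|w - u| `^ (- 2))}.
      by apply/differentiable_continuous/derivable1_diffP.
    rewrite /prop_for /continuous_at (nbhs_singleton (out _ vo)).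
    apply: cvg_trans cv; apply: near_eq_cvg; near do apply/esym.
    exact: out.
  apply: (@near_cst_continuous _ _ 0); exact: inn.
- move=> v _ /tri[/orP[h|h]|vi].
  + have vu : v != u by rewrite lt_eqF//; lra.
    have D := is_derive_shift_norm_powR (- 1) vu.
    apply: (@near_eq_is_derive _ _ _ (fun w => `|w - u| `^ (- 1) - cst r^-1 w)).
      near=> w; have wh : w < u - r by near: w; exact: lt_nbhsl.
      rewrite powR_inv1// ltr0_norm; last by lra.
      rewrite /F /m1 /m2; congr (_^-1 - _^-1).
        by rewrite max_l; lra.
      by rewrite max_r//; lra.
    apply: (is_derive_eq (is_deriveB D (is_derive_cst _ _ _))).
    rewrite (nbhs_singleton (out _ _)) ?h// ltr0_sg; last by lra.
    by rewrite subr0 mulN1r mulN1r opprK; congr (_ `^ _); lra.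
  + have vu : v != u by rewrite gt_eqF//; lra.
    have D := is_derive_shift_norm_powR (- 1) vu.
    apply: (@near_eq_is_derive _ _ _ (fun w => cst r^-1 w - `|w - u| `^ (- 1))).
      near=> w; have wh : u + r < w by near: w; exact: lt_nbhsr.
      rewrite powR_inv1// gtr0_norm; last by lra.
      rewrite /F /m1 /m2; congr (_^-1 - _^-1).
        by rewrite max_r//; lra.
      by rewrite max_l; lra.
    apply: (is_derive_eq (is_deriveB (is_derive_cst _ _ _) D)).
    rewrite (nbhs_singleton (out _ _)) ?h ?orbT// gtr0_sg; last by lra.
    by rewrite sub0r mulN1r mul1r opprK; congr (_ `^ _); lra.
  + rewrite (nbhs_singleton (inn _ vi)).
    apply: (@near_eq_is_derive _ _ _ (cst (0 : R))).
    near=> w; have w1 : u - r < w by near: w; move/andP: vi => [vi _]; exact: lt_nbhsr.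
    have w2 : w < u + r by near: w; move/andP: vi => [_ vi]; exact: lt_nbhsl.
    by rewrite /F /m1 /m2 !max_r ?subrr//; lra.
Unshelve. all: by end_near. Qed.

(* Majorant in [z] of [a * b * `|z| `^ (2 * H - 2)] for [b <= a] : the trivial
   bound near 0, the [`|z|] part of Young's inequality far from 0; the threshold
   is chosen so that the integral scales like [a `^ H^-1]. *)
Definition hls_kernel H a z : R :=
  if `|z| * a `^ H^-1 < 1 then a ^+ 2 * `|z| `^ (2 * H - 2)
  else (1 - H) * `|z| `^ (- 2).

Lemma hls_kernel_ge0 H a z : H < 1 -> 0 <= hls_kernel H a z.
Proof.
move=> H1; rewrite /hls_kernel; case: ifP => _; rewrite mulr_ge0 ?powR_ge0 ?sqr_ge0//.
by lra.
Qed.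

(** By symmetry b <= a, and then only the kernel of [a] is needed. In its near branch ab <= a^2. In
    its far branch, Young's inequality for ab and |z|^(2H - 2) with exponents 1/H and 1/(1 - H)
    produces |z|^(-2), which is integrable at infinity. *)
Lemma hls_pointwise H a b z : 0 < H < 1 -> 0 <= a -> 0 <= b ->
  a * b * `|z| `^ (2 * H - 2) <=
  hls_kernel H a z + hls_kernel H b z + H * (a `^ H^-1 * b `^ H^-1).
Proof.
move=> /andP[H0 H1]; wlog ba : a b / b <= a => [hw|] a0 b0.
  have [ba|/ltW ab] := leP b a; first exact: hw.
  by have := hw _ _ ab b0 a0; rewrite (mulrC b a) (mulrC (b `^ _)); lra.
have hb := hls_kernel_ge0 b z H1.
have hp : 0 <= H * (a `^ H^-1 * b `^ H^-1).
  by rewrite mulr_ge0 ?(ltW H0)// mulr_ge0// powR_ge0.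
rewrite {1}/hls_kernel; case: ifPn => [_|far].
  suff : a * b * `|z| `^ (2 * H - 2) <= a ^+ 2 * `|z| `^ (2 * H - 2) by lra.
  by rewrite ler_wpM2r ?powR_ge0// expr2 ler_wpM2l.
have H1' : 0 < 1 - H by lra.
have Y := @conjugate_powR _ (a * b) (`|z| `^ (2 * H - 2)) H^-1 (1 - H)^-1
  (mulr_ge0 a0 b0) (powR_ge0 _ _).
have {}Y := Y _ _ _; move: Y; rewrite !invr_gt0 !invrK => /(_ H0 H1').
have -> : H + (1 - H) = 1 by lra.
move=> /(_ erefl); rewrite powRM// -powRrM.
have -> : (2 * H - 2) / (1 - H) = - 2 by field; rewrite gt_eqF.
by lra.
Qed.

(** The contributions of the near and of the far branch of [hls_kernel]. *)
Definition hls_const H : R := 2 / (2 * H - 1) + 2 * (1 - H).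

(** The branches meet at distance r = a^(-1/H). The near one gives 2 a^2 r^(2H - 1) / (2H - 1), the
    far one at most 2(1 - H) / r, and both are multiples of a^(1/H). The bound is uniform in the
    window [L]. *)
Lemma integral_hls_kernel H a u L : 2^-1 < H < 1 -> 0 <= a ->
  (\int[mu]_(v in `](u - L)%R, (u + L)%R[) (hls_kernel H a (v - u))%:E <=
   (hls_const H * a `^ H^-1)%:E)%E.
Proof.
move=> /andP[H12 H1]; have H0 : 0 < H by lra.
rewrite le_eqVlt => /predU1P[<-|a0].
  rewrite integral0_eq; last first.
    by move=> v _; rewrite /hls_kernel powR0 ?invr_eq0 ?gt_eqF// mulr0 ltr01 expr0n mul0r.
  by rewrite powR0 ?invr_eq0 ?gt_eqF// mulr0.
set r := (a `^ H^-1)^-1.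
have ap : 0 < a `^ H^-1 by exact: powR_gt0.
have r0 : 0 < r by rewrite invr_gt0.
pose I : set R := `]u - r, u + r[%classic.
have E v : hls_kernel H a (v - u) =
    \1_I v * (a ^+ 2 * `|v - u| `^ (2 * H - 2)) + (1 - H) * (\1_(~` I) v * `|v - u| `^ (- 2)).
  have vI : (v \in I) = (`|v - u| * a `^ H^-1 < 1).
    rewrite -ltr_pdivlMr// div1r -/r ltr_distl.
    by apply/idP/idP => [/set_mem|h]; [|apply/mem_set]; rewrite /I/= in_itv.
  rewrite /hls_kernel !indicE in_setC vI; case: ifP => _ /=.
    by rewrite mul1r mul0r mulr0 addr0.
  by rewrite mul0r mul1r add0r.
have -> : (\int[mu]_(v in `](u - L)%R, (u + L)%R[) (hls_kernel H a (v - u))%:E =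
    \int[mu]_(v in `](u - L)%R, (u + L)%R[)
      ((\1_I v * (a ^+ 2 * `|v - u| `^ (2 * H - 2)))%:E +
       ((1 - H) * (\1_(~` I) v * `|v - u| `^ (- 2)))%:E))%E.
  by apply: eq_integral => v _; rewrite E EFinD.
have mI : measurable I by exact: measurable_itv.
rewrite ge0_integralD//=; last 4 first.
- by move=> v _; rewrite lee_fin mulr_ge0 ?indicE// mulr_ge0 ?sqr_ge0 ?powR_ge0.
- apply/measurable_EFinP; apply: measurable_funM; first exact: measurable_indic.
  apply: measurable_funM => //; exact: measurable_norm_shift_powR.
- by move=> v _; rewrite lee_fin mulr_ge0 ?indicE ?mulr_ge0 ?powR_ge0//; lra.
- apply/measurable_EFinP; apply: measurable_funM => //.
  apply: measurable_funM; last exact: measurable_norm_shift_powR.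
  by apply: measurable_indic; exact: measurableC.
have -> : (hls_const H * a `^ H^-1)%:E =
    ((2 / (2 * H - 1) * a `^ H^-1)%:E + (2 * (1 - H) * a `^ H^-1)%:E)%E.
  by rewrite -EFinD /hls_const; congr EFin; ring.
apply: leeD.
  have -> : (\int[mu]_(v in `](u - L)%R, (u + L)%R[) (\1_I v * (a ^+ 2 * `|v - u| `^ (2 * H - 2)))%:E =
     \int[mu]_(v in `](u - L)%R, (u + L)%R[ `&` I) (a ^+ 2 * `|v - u| `^ (2 * H - 2))%:E)%E.
    rewrite integral_mkcondr; apply: eq_integral => v _.
    by rewrite patchE indicE; case: ifP => _; rewrite ?mul1r ?mul0r.
  have mf : measurable_fun I (fun v => (a ^+ 2 * `|v - u| `^ (2 * H - 2))%:E).
    by apply/measurable_EFinP; apply: measurable_funM => //; exact: measurable_norm_shift_powR.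
  apply: (@le_trans _ _ (\int[mu]_(v in I) (a ^+ 2 * `|v - u| `^ (2 * H - 2))%:E)%E).
    apply: ge0_subset_integral => //; first exact: measurableI.
    by move=> v _; rewrite lee_fin mulr_ge0 ?sqr_ge0 ?powR_ge0.
  rewrite ge0_integralZl_fin ?sqr_ge0//; last exact: measurable_norm_shift_powR.
  have q0 : 0 < 2 * H - 1 by lra.
  have -> : 2 * H - 2 = (2 * H - 1) - 1 by lra.
  rewrite integral_norm_powR//; last by lra.
  have -> : u + r - u = r by lra.
  have -> : u - r - u = - r by lra.
  rewrite spowRN spowR_ge0 ?(ltW r0)// -EFinM lee_fin.
  rewrite le_eqVlt; apply/orP; left; apply/eqP.
  have -> : r `^ (2 * H - 1) = a `^ H^-1 / a ^+ 2.
    rewrite /r -powR_inv1 ?powR_ge0// -!powRrM -(powR_mulrn 2 (ltW a0)).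
    rewrite -powRB; last by rewrite (gt_eqF a0) implybT.
    by congr (_ `^ _); field; rewrite gt_eqF.
  by field; rewrite !gt_eqF.
have H1' : 0 <= 1 - H by lra.
rewrite ge0_integralZl_fin //; last first.
  apply: measurable_funM; last exact: measurable_norm_shift_powR.
  by apply: measurable_indic; exact: measurableC.
apply: (le_trans (lee_wpmul2l _ (integral_far u L r0))); first by rewrite lee_fin; lra.
by rewrite -EFinM lee_fin /r invrK; lra.
Qed.

End hls.

Lemma ge0_le_integral_fin d (T : measurableType d) (R : realType)
    (m : {measure set T -> \bar R}) (D : set T) (f g : T -> R) :
  measurable D -> measurable_fun D f -> measurable_fun D g ->
  (forall x, D x -> 0 <= f x) -> (forall x, D x -> f x <= g x) ->
  (\int[m]_(x in D) (f x)%:E <= \int[m]_(x in D) (g x)%:E)%E.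
Proof.
move=> mD mf mg f0 fg; apply: ge0_le_integral => //; exact/measurable_EFinP.
Qed.

Lemma ge0_integralD_fin d (T : measurableType d) (R : realType)
    (m : {measure set T -> \bar R}) (D : set T) (f g : T -> R) :
  measurable D -> measurable_fun D f -> measurable_fun D g ->
  (forall x, D x -> 0 <= f x) -> (forall x, D x -> 0 <= g x) ->
  (\int[m]_(x in D) (f x + g x)%:E =
   \int[m]_(x in D) (f x)%:E + \int[m]_(x in D) (g x)%:E)%E.
Proof.
move=> mD mf mg f0 g0; under eq_integral do rewrite EFinD.
by apply: ge0_integralD => //; exact/measurable_EFinP.
Qed.

Section hls_plane.
Context {R : realType}.
Notation mu := (@lebesgue_measure R).
Implicit Types (H a b u v r L M N : R).

Lemma measurable_hls_kernel d (T : measurableType d) H (f g : T -> R) :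
  measurable_fun setT f -> measurable_fun setT g ->
  measurable_fun setT (fun x => hls_kernel H (f x) (g x)).
Proof.
move=> mf mg.
have mng : measurable_fun setT (fun x => `|g x|) by exact: measurableT_comp.
have mp (p : R) (h : T -> R) : measurable_fun setT h ->
    measurable_fun setT (fun x => h x `^ p).
  by move=> mh; exact: (measurableT_comp (measurable_powR p)).
apply: measurable_fun_ifT.
- by apply: measurable_fun_ltr => //; apply: measurable_funM => //; exact: mp.
- by apply: measurable_funM; [exact: measurable_funX|exact: mp].
- by apply: measurable_funM => //; exact: mp.
Qed.

Lemma tonelli1 (g : R * R -> R) : measurable_fun setT g -> (forall z : R * R, 0 <= g z) ->
  (\int[mu \x mu]_z (g z)%:E = \int[mu]_u \int[mu]_v (g (u, v))%:E)%E.
Proof.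
move=> mg g0; apply: (@fubini_tonelli1 _ _ _ _ _ mu mu (EFin \o g)).
  exact/measurable_EFinP.
by move=> z; rewrite /= lee_fin.
Qed.

Lemma tonelli2 (g : R * R -> R) : measurable_fun setT g -> (forall z : R * R, 0 <= g z) ->
  (\int[mu \x mu]_z (g z)%:E = \int[mu]_v \int[mu]_u (g (u, v))%:E)%E.
Proof.
move=> mg g0; apply: (@fubini_tonelli2 _ _ _ _ _ mu mu (EFin \o g)).
  exact/measurable_EFinP.
by move=> z; rewrite /= lee_fin.
Qed.

(** Integrate [hls_pointwise] over the plane. Each kernel term contributes [hls_const H * N], and
    the product term factors into H N^2. *)
Lemma hls_diagonal H (f : R -> R) M N : 2^-1 < H < 1 ->
  measurable_fun setT f -> (forall u, 0 <= f u) ->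
  (forall u, f u != 0 -> 0 <= u <= M) -> 0 <= N ->
  (\int[mu]_u (f u `^ H^-1)%:E <= N%:E)%E ->
  (\int[mu \x mu]_z (f z.1 * f z.2 * `|z.2 - z.1| `^ (2 * H - 2))%:E <=
    (2 * hls_const H * N + H * N ^+ 2)%:E)%E.
Proof.
move=> H12 mf f0 fM N0 fN; have /andP[H1 H2] := H12.
have H0 : 0 < H by lra.
(* Two points of the support are at distance at most [M], hence strictly less than [L]. *)
pose L := M + 1.
have mf1 : measurable_fun setT (fun z : R * R => f z.1) by exact: measurableT_comp.
have mf2 : measurable_fun setT (fun z : R * R => f z.2) by exact: measurableT_comp.
have mB : measurable_fun setT (fun z : R * R => z.2 - z.1) by exact: measurable_funB.
have mN : measurable_fun setT (fun z : R * R => `|z.2 - z.1|) by exact: measurableT_comp.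
(* Truncation to the window of [integral_hls_kernel]; it loses nothing on the support of f u * f
   v. *)
pose h a z := if `|z| < L then hls_kernel H a z else 0.
have h0 a z : 0 <= h a z by rewrite /h; case: ifP => // _; exact: hls_kernel_ge0.
have mh (g : R * R -> R) : measurable_fun setT g ->
    measurable_fun setT (fun z : R * R => h (g z) (z.2 - z.1)).
  move=> mg; apply: measurable_fun_ifT => //; first exact: measurable_fun_ltr.
  exact: measurable_hls_kernel.
have mp (g : R * R -> R) p : measurable_fun setT g ->
    measurable_fun setT (fun x => g x `^ p).
  by move=> mg; exact: (measurableT_comp (measurable_powR p)).
have mfp : measurable_fun setT (fun u => f u `^ H^-1).
  exact: (measurableT_comp (measurable_powR _)).
have hint a u : 0 <= a -> (\int[mu]_v (h a (v - u)%R)%:E <= (hls_const H * a `^ H^-1)%:E)%E.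
  move=> a0; rewrite (le_trans _ (integral_hls_kernel u L H12 a0))//.
  rewrite [leRHS]integral_mkcond le_eqVlt; apply/orP; left; apply/eqP.
  apply: eq_integral => v _; rewrite patchE /h.
  have -> : (v \in [set` `]u - L, u + L[]) = (`|v - u| < L).
    by rewrite ltr_distl; apply/idP/idP => [/set_mem|k]; [|apply/mem_set]; rewrite /= in_itv.
  by case: ifP.
have CN : (\int[mu]_u (hls_const H * f u `^ H^-1)%:E <= (hls_const H * N)%:E)%E.
  have c0 : 0 <= hls_const H.
    by rewrite /hls_const addr_ge0 ?divr_ge0 ?mulr_ge0//; lra.
  rewrite ge0_integralZl_fin//; last by move=> u _; exact: powR_ge0.
  by rewrite EFinM lee_wpmul2l// lee_fin.
pose g1 (z : R * R) := h (f z.1) (z.2 - z.1).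
pose g2 (z : R * R) := h (f z.2) (z.2 - z.1).
pose g3 (z : R * R) := H * (f z.1 `^ H^-1 * f z.2 `^ H^-1).
have mg1 : measurable_fun setT g1 by exact: mh.
have mg2 : measurable_fun setT g2 by exact: mh.
have mg3 : measurable_fun setT g3.
  by apply: measurable_funM => //; apply: measurable_funM; exact: mp.
have g30 (z : R * R) : 0 <= g3 z by rewrite !mulr_ge0 ?powR_ge0// ltW.
have I1 : (\int[mu \x mu]_z (g1 z)%:E <= (hls_const H * N)%:E)%E.
  rewrite tonelli1//; last by move=> z; exact: h0.
  apply: le_trans CN; apply: ge0_le_integral => //.
  - by move=> u _; apply: integral_ge0 => v _; rewrite lee_fin h0.
  - apply: (@measurable_fun_fubini_tonelli_F _ _ _ _ _ mu (EFin \o g1)).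
      exact/measurable_EFinP.
    by move=> z; rewrite /= lee_fin h0.
  - by apply/measurable_EFinP; exact: measurable_funM.
  - by move=> u _; exact: (hint (f u) u (f0 u)).
(* Here the height of the kernel depends on [z.2], so [z.1] is integrated first. *)
have I2 : (\int[mu \x mu]_z (g2 z)%:E <= (hls_const H * N)%:E)%E.
  rewrite tonelli2//; last by move=> z; exact: h0.
  apply: le_trans CN; apply: ge0_le_integral => //.
  - by move=> u _; apply: integral_ge0 => v _; rewrite lee_fin h0.
  - apply: (@measurable_fun_fubini_tonelli_G _ _ _ _ _ mu (EFin \o g2)).
      exact/measurable_EFinP.
    by move=> z; rewrite /= lee_fin h0.
  - by apply/measurable_EFinP; exact: measurable_funM.
  - move=> v _; apply: le_trans (hint _ v (f0 v)).
    rewrite le_eqVlt; apply/orP; left; apply/eqP/eq_integral => u _.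
    by rewrite /g2/= /h /hls_kernel distrC.
have I3 : (\int[mu \x mu]_z (g3 z)%:E <= (H * N ^+ 2)%:E)%E.
  rewrite tonelli1//.
  have E u : (\int[mu]_v (g3 (u, v))%:E <= (H * N * f u `^ H^-1)%:E)%E.
    rewrite /g3/=.
    rewrite (_ : (fun v => _) = (fun v => (H * f u `^ H^-1 * f v `^ H^-1)%:E)); last first.
      by apply/funext => v; rewrite mulrA.
    rewrite ge0_integralZl_fin//; last 2 first.
    - by move=> v _; exact: powR_ge0.
    - by rewrite mulr_ge0 ?powR_ge0 ?ltW.
    rewrite (_ : H * N * _ = H * f u `^ H^-1 * N); last by ring.
    by rewrite [leRHS]EFinM lee_wpmul2l// lee_fin mulr_ge0 ?powR_ge0 ?ltW.
  apply: (@le_trans _ _ (\int[mu]_u (H * N * f u `^ H^-1)%:E)%E).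
    apply: ge0_le_integral => //.
    - by move=> u _; apply: integral_ge0 => v _; rewrite lee_fin.
    - apply: (@measurable_fun_fubini_tonelli_F _ _ _ _ _ mu (EFin \o g3)).
        exact/measurable_EFinP.
      by move=> z; rewrite /= lee_fin.
    - by apply/measurable_EFinP; exact: measurable_funM.
  have HN0 : 0 <= H * N by rewrite mulr_ge0 // ltW.
  rewrite ge0_integralZl_fin//; last by move=> u _; exact: powR_ge0.
  by rewrite expr2 mulrA [leRHS]EFinM lee_wpmul2l// lee_fin.
have -> : (2 * hls_const H * N + H * N ^+ 2)%:E =
    ((hls_const H * N)%:E + (hls_const H * N)%:E + (H * N ^+ 2)%:E)%E.
  by rewrite -!EFinD; congr EFin; ring.
apply: le_trans (leeD (leeD I1 I2) I3).
rewrite -ge0_integralD_fin//; [|by move=> z _; exact: h0..].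
rewrite -ge0_integralD_fin//; last 2 first.
- exact: measurable_funD.
- by move=> z _; rewrite addr_ge0 ?h0.
apply: ge0_le_integral_fin => //.
- by apply: measurable_funM; [exact: measurable_funM|exact: mp].
- by apply: measurable_funD => //; exact: measurable_funD.
- by move=> z _; rewrite !mulr_ge0 ?powR_ge0.
move=> [u v] _ /=; have [fu|fu] := eqVneq (f u) 0.
  by rewrite fu !mul0r !addr_ge0 ?h0.
have [fv|fv] := eqVneq (f v) 0.
  by rewrite fv mulr0 !mul0r !addr_ge0 ?h0.
have LL : `|v - u| < L.
  by have := fM _ fu; have := fM _ fv; rewrite /L ltr_norml; lra.
by rewrite /g1 /g2 /g3 /= /h LL; apply: hls_pointwise => //; rewrite H0.
Qed.

End hls_plane.

(** Used both for Lebesgue measure on the plane and for [P]: the two sides of the isometry then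
    reduce to the same finite double sum. *)
Lemma integral_double_sum d (T : measurableType d) (R : realType)
    (m : {measure set T -> \bar R}) n (c r : 'I_n -> 'I_n -> R)
    (g : 'I_n -> 'I_n -> T -> R) :
  (forall i j, m.-integrable setT (fun x => (g i j x)%:E)) ->
  (forall i j, \int[m]_x (g i j x)%:E = (r i j)%:E)%E ->
  (\int[m]_x (\sum_(i < n) \sum_(j < n) c i j * g i j x)%:E =
   (\sum_(i < n) \sum_(j < n) c i j * r i j)%:E)%E.
Proof.
move=> ig rg; rewrite -sumEFin.
under eq_integral do rewrite -sumEFin.
have icg i j : m.-integrable setT (fun x => (c i j * g i j x)%:E).
  by under eq_fun do rewrite EFinM; exact: integrableZl.
have iscg i : m.-integrable setT (fun x => (\sum_(j < n) c i j * g i j x)%:E).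
  by under eq_fun do rewrite -sumEFin; exact: integrable_sum.
rewrite integral_sum//; apply: eq_bigr => i _.
rewrite -sumEFin; under eq_integral do rewrite -sumEFin.
rewrite integral_sum//; apply: eq_bigr => j _.
under eq_integral do rewrite EFinM.
by rewrite integralZl// rg.
Qed.

(** * The quadratic form of a step function *)

Section quadratic_form.
Context {R : realType}.
Notation mu := (@lebesgue_measure R).

(** The integral of |v - u|^(b - 1) over v in ]x, y] and u in ]x', y'], in closed form: a mixed
    second difference of |.|^(b + 1). *)
Definition rect_integral (b x y x' y' : R) : R :=
  (`|x - y'| `^ (b + 1) - `|y - y'| `^ (b + 1)
   - `|x - x'| `^ (b + 1) + `|y - x'| `^ (b + 1)) / (b * (b + 1)).

Lemma integral_spowRB (b x y x' y' : R) : 0 < b -> x <= y -> x' <= y' ->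
  (\int[mu]_(u in `]x', y'[) ((spowR b (y - u)%R - spowR b (x - u)%R)%R / b)%:E =
   (rect_integral b x y x' y')%:E)%E.
Proof.
move=> b0 xy xy'; have b1 : 0 < b + 1 by rewrite addr_gt0.
pose F u := (b * (b + 1))^-1 * (`|u - x| `^ (b + 1) - `|u - y| `^ (b + 1)).
have cB w : continuous (fun u : R => u - w) by move=> v; apply: cvgB => //; exact: cvg_cst.
have cB' w : continuous (fun u : R => w - u) by move=> v; apply: cvgB => //; exact: cvg_cst.
have cS w : continuous (fun u => spowR b (w - u)).
  by move=> u; apply: (@continuous_comp _ _ _ (fun u => w - u) (spowR b));
    [exact: cB'|exact: continuous_spowR].
have cN w : continuous (fun u : R => `|u - w| `^ (b + 1)).
  by move=> u; apply: (@continuous_comp _ _ _ (fun u => u - w) (fun z => `|z| `^ (b + 1)));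
    [exact: cB|exact: continuous_norm_powR].
have cSB : continuous (fun u => (spowR b (y - u) - spowR b (x - u)) / b).
  by move=> u; apply: cvgM; [apply: cvgB; exact: cS|exact: cvg_cst].
rewrite (@ge0_integral_oo_FTC _ _ F _ _ [:: x; y])//.
- by rewrite /F /rect_integral !(distrC y') !(distrC x'); congr EFin; ring.
- by move=> u; apply: cvgM; [exact: cvg_cst|apply: cvgB; exact: cN].
- by apply: measurable_funTS; exact: continuous_measurable_fun.
- move=> u _; rewrite divr_ge0 ?(ltW b0)// subr_ge0 le_spowR// lerD2r//.
- by move=> u _ _; exact: cSB.
- move=> u _; rewrite !inE negb_or => /andP[ux uy].
  have Dx := is_derive_shift_norm_powR (b + 1) ux.
  have Dy := is_derive_shift_norm_powR (b + 1) uy.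
  have -> : F = (fun u => (b * (b + 1))^-1 *: (`|u - x| `^ (b + 1) - `|u - y| `^ (b + 1))).
    by [].
  apply: (is_derive_eq (is_deriveZ _ (is_deriveB Dx Dy))).
  rewrite addrK /GRing.scale/= -!/(spowR b _) -(opprB u x) -(opprB u y) !spowRN.
  by field; rewrite !gt_eqF.
Qed.

Lemma integral_rectangle (b x y x' y' : R) : 0 < b -> x <= y -> x' <= y' ->
  (\int[mu \x mu]_z (\1_`]x', y'] z.1 * \1_`]x, y] z.2 * `|z.2 - z.1| `^ (b - 1))%:E =
   (rect_integral b x y x' y')%:E)%E.
Proof.
move=> b0 xy xy'.
have mk : measurable_fun setT (fun z : R * R => `|z.2 - z.1| `^ (b - 1)).
  apply: (measurableT_comp (measurable_powR _)).
  by apply: measurableT_comp => //; exact: measurable_funB.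
have m1 (A : set R) : measurable A -> measurable_fun setT (fun z : R * R => \1_A z.1 : R).
  by move=> mA; apply: measurableT_comp => //; exact: measurable_indic.
have m2 (A : set R) : measurable A -> measurable_fun setT (fun z : R * R => \1_A z.2 : R).
  by move=> mA; apply: measurableT_comp => //; exact: measurable_indic.
rewrite (tonelli1 (g := fun z => \1_`]x', y'] z.1 * \1_`]x, y] z.2 * `|z.2 - z.1| `^ (b - 1))).
- have E u : (\int[mu]_v (\1_`]x', y'] u * \1_`]x, y] v * `|v - u| `^ (b - 1))%:E =
      (\1_`]x', y'] u * ((spowR b (y - u) - spowR b (x - u)) / b))%:E)%E.
    have mg : measurable_fun setT (fun v : R => \1_`]x, y] v * `|v - u| `^ (b - 1)).
      by apply: measurable_funM; [exact: measurable_indic|exact: measurable_norm_shift_powR].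
    have g0 v : 0 <= (\1_`]x, y] v : R) * `|v - u| `^ (b - 1).
      by rewrite mulr_ge0 ?powR_ge0 ?indicE.
    have i0 : 0 <= (\1_`]x', y'] u : R) by rewrite indicE.
    under eq_integral do rewrite -mulrA.
    have := ge0_integralZl_fin mu measurableT mg (fun v _ => g0 v) i0.
    move=> /= ->; rewrite EFinM; congr (_ * _)%E.
    rewrite -(integral_norm_powR u b0 xy) integral_itv_bndo_bndc; last first.
      by apply/measurable_EFinP; exact: measurable_norm_shift_powR.
    rewrite [RHS]integral_mkcond; apply: eq_integral => v _.
    by rewrite patchE indicE; case: ifP; rewrite ?mul1r ?mul0r.
  under eq_integral do rewrite /= E.
  rewrite -(integral_spowRB b0 xy xy') integral_itv_bndo_bndc; last first.
    apply/measurable_EFinP/measurable_funTS; apply: continuous_measurable_fun => u.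
    apply: cvgM; last exact: cvg_cst.
    by apply: cvgB; apply: (@continuous_comp _ _ _ (fun u => _ - u) (spowR b));
      [apply: cvgB => //; exact: cvg_cst|exact: continuous_spowR|
       apply: cvgB => //; exact: cvg_cst|exact: continuous_spowR].
  rewrite [RHS]integral_mkcond; apply: eq_integral => v _.
  by rewrite patchE indicE; case: ifP; rewrite ?mul1r ?mul0r.
- apply: measurable_funM => //; apply: measurable_funM; [exact: m1|exact: m2].
- by move=> z; rewrite !mulr_ge0 ?powR_ge0 ?indicE.
Qed.

(** The double sum is the integral of psi(u) psi(v) |v - u|^(2H - 2) for the step function [psi]. It
    is bounded by the same integral with |psi|, to which [hls_diagonal] applies. The intervals may
    overlap. *)
Lemma quadratic_form_le (H : R) n (a x y : 'I_n -> R) (N : R) : 2^-1 < H < 1 ->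
  (forall i, 0 <= x i <= y i) -> 0 <= N ->
  (\int[mu]_u (`|\sum_(i < n) a i * \1_`]x i, y i] u| `^ H^-1)%:E <= N%:E)%E ->
  \sum_(i < n) \sum_(j < n) a i * a j * rect_integral (2 * H - 1) (x j) (y j) (x i) (y i)
    <= 2 * hls_const H * N + H * N ^+ 2.
Proof.
move=> H12 xy N0 psiN; have /andP[H1 H2] := H12.
pose psi u := \sum_(i < n) a i * \1_`]x i, y i] u.
have b0 : 0 < 2 * H - 1 by lra.
have xyi i : x i <= y i by have /andP[] := xy i.
have mk : measurable_fun setT (fun z : R * R => `|z.2 - z.1| `^ (2 * H - 2)).
  apply: (measurableT_comp (measurable_powR _)).
  by apply: measurableT_comp => //; exact: measurable_funB.
have mpsi : measurable_fun setT psi.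
  by apply: measurable_sum => i; apply: measurable_funM => //; exact: measurable_indic.
have mpsi1 : measurable_fun setT (fun z : R * R => psi z.1) by exact: measurableT_comp.
have mpsi2 : measurable_fun setT (fun z : R * R => psi z.2) by exact: measurableT_comp.
pose g i j (z : R * R) := \1_`]x i, y i] z.1 * \1_`]x j, y j] z.2 * `|z.2 - z.1| `^ (2 * H - 2).
have g0 i j z : 0 <= g i j z by rewrite !mulr_ge0 ?powR_ge0 ?indicE.
have Ig i j : (\int[mu \x mu]_z (g i j z)%:E =
    (rect_integral (2 * H - 1) (x j) (y j) (x i) (y i))%:E)%E.
  have := integral_rectangle b0 (xyi j) (xyi i).
  by rewrite (_ : 2 * H - 1 - 1 = 2 * H - 2); last by lra.
have mg i j : measurable_fun setT (g i j).
  apply: measurable_funM => //; apply: measurable_funM.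
    by apply: measurableT_comp => //; exact: measurable_indic.
  by apply: measurableT_comp => //; exact: measurable_indic.
have ig i j : (mu \x mu)%E.-integrable setT (fun z => (g i j z)%:E).
  apply/integrableP; split; first by apply/measurable_EFinP; exact: mg.
  under eq_integral do rewrite /= ger0_norm//.
  by rewrite Ig ltry.
rewrite -lee_fin -(integral_double_sum (fun i j => a i * a j) ig Ig).
have E z : \sum_(i < n) \sum_(j < n) a i * a j * g i j z =
    psi z.1 * psi z.2 * `|z.2 - z.1| `^ (2 * H - 2).
  rewrite /psi big_distrlr/= mulr_suml; apply: eq_bigr => i _.
  by rewrite mulr_suml; apply: eq_bigr => j _; rewrite /g; ring.
under eq_integral do rewrite E.
apply: le_trans (lee_abs _) _.
apply: (le_trans (le_abse_integral _ _ _)) => //.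
  by apply/measurable_EFinP; apply: measurable_funM => //; exact: measurable_funM.
under eq_integral do rewrite /= !normrM (ger0_norm (powR_ge0 _ _)).
(* The sum dominates every right endpoint because all of them are nonnegative. *)
pose M := \sum_(i < n) y i.
apply: (@hls_diagonal _ H (fun u => `|psi u|) M) => //.
- exact: measurableT_comp.
- move=> u; rewrite normr_eq0 => psiu.
  have [i ui] : exists i, u \in `]x i, y i].
    apply/existsP; apply: contraNT psiu => /existsPn h.
    rewrite /psi big1// => i _; rewrite indicE memNset ?mulr0//.
    by move=> ui; have := h i; rewrite ui.
  move: ui; rewrite in_itv/= => /andP[u1 u2]; have /andP[x0 _] := xy i.
  rewrite (le_trans x0 (ltW u1))/= (le_trans u2)// /M (bigD1 i)//= lerDl.
  by apply: sumr_ge0 => j _; have /andP[h1 h2] := xy j; exact: le_trans h2.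
Qed.

End quadratic_form.

(** * Second moments of step integrals *)

Lemma ler_normM_sqr (R : realFieldType) (a b : R) : `|a * b| <= a * a + b * b.
Proof.
have h1 : 0 <= (a - b) * (a - b) by rewrite -expr2 sqr_ge0.
have h2 : 0 <= (a + b) * (a + b) by rewrite -expr2 sqr_ge0.
have h3 : 0 <= a * a by rewrite -expr2 sqr_ge0.
have h4 : 0 <= b * b by rewrite -expr2 sqr_ge0.
rewrite ler_norml; apply/andP; split; nra.
Qed.

Section second_moments.
Context {R : realType} {d : measure_display} {Omega : measurableType d}.
Context (P : probability Omega R) (H : R) (B : R -> Omega -> R).
Hypothesis H12 : 2^-1 < H < 1.
Hypothesis hB : fractional_brownian_motion P H B.
Notation mu := (@lebesgue_measure R).

Definition fbm_cov (s t : R) : R :=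
  (s `^ (2 * H) + t `^ (2 * H) - `|t - s| `^ (2 * H)) / 2.

Lemma integral_fbmM s t : 0 <= s -> 0 <= t ->
  (\int[P]_w (B t w * B s w)%:E = (fbm_cov s t)%:E)%E.
Proof. by move=> s0 t0; have := fbm_covariance hB s0 t0; rewrite unlock. Qed.

Lemma integrable_fbmM s t : 0 <= s -> 0 <= t ->
  P.-integrable setT (fun w => (B t w * B s w)%:E).
Proof.
move=> s0 t0; have ms := fbm_measurable hB s0; have mt := fbm_measurable hB t0.
apply/integrableP; split; first by apply/measurable_EFinP; exact: measurable_funM.
apply: (@le_lt_trans _ _ (\int[P]_w (B t w * B t w + B s w * B s w)%:E)%E).
  apply: ge0_le_integral_fin => //.
  - by apply: measurableT_comp => //; exact: measurable_funM.
  - by apply: measurable_funD; exact: measurable_funM.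
  - by move=> w _; exact: ler_normM_sqr.
rewrite ge0_integralD_fin//.
- by rewrite !integral_fbmM// -EFinD ltry.
- exact: measurable_funM.
- exact: measurable_funM.
- by move=> w _; rewrite -expr2 sqr_ge0.
- by move=> w _; rewrite -expr2 sqr_ge0.
Qed.

(** In the four covariances the terms in one time cancel, leaving half a mixed second difference of
    |.|^(2H); H(2H - 1) compensates the denominator (2H - 1) 2H of [rect_integral]. *)
Lemma integral_fbmBM x y x' y' : 0 <= x -> 0 <= y -> 0 <= x' -> 0 <= y' ->
  P.-integrable setT (fun w => ((B y' w - B x' w) * (B y w - B x w))%:E) /\
  (\int[P]_w ((B y' w - B x' w) * (B y w - B x w))%:E =
   (H * (2 * H - 1) * rect_integral (2 * H - 1) x y x' y')%:E)%E.
Proof.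
move=> x0 y0 x0' y0'; have /andP[H1 H2] := H12.
pose t (i : 'I_2) := if i == ord0 then y' else x'.
pose s (i : 'I_2) := if i == ord0 then y else x.
pose c (i j : 'I_2) : R := if i == j then 1 else -1.
have t0 i : 0 <= t i by rewrite /t; case: ifP.
have s0 i : 0 <= s i by rewrite /s; case: ifP.
have E w : (B y' w - B x' w) * (B y w - B x w) =
    \sum_(i < 2) \sum_(j < 2) c i j * (B (t i) w * B (s j) w).
  by rewrite !big_ord_recl !big_ord0 /c /t /s /=; ring.
have ig i j : P.-integrable setT (fun w => (B (t i) w * B (s j) w)%:E).
  exact: integrable_fbmM.
split.
  under eq_fun do rewrite E -sumEFin.
  apply: integrable_sum => // i _; under eq_fun do rewrite -sumEFin.
  by apply: integrable_sum => // j _; under eq_fun do rewrite EFinM; exact: integrableZl.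
under eq_integral do rewrite E.
rewrite (integral_double_sum c ig (fun i j => integral_fbmM (s0 j) (t0 i))).
congr EFin; rewrite !big_ord_recl !big_ord0 /c /t /s /= /rect_integral /fbm_cov.
have -> : 2 * H - 1 + 1 = 2 * H by ring.
rewrite (distrC y' y) (distrC y' x) (distrC x' y) (distrC x' x).
by field; rewrite !gt_eqF//; lra.
Qed.

Lemma integral_step_sqr n (a x y : 'I_n -> R) : (forall i, 0 <= x i <= y i) ->
  (\int[P]_w ((\sum_(i < n) a i * (B (y i) w - B (x i) w)) ^+ 2)%:E =
   (H * (2 * H - 1) * \sum_(i < n) \sum_(j < n)
      a i * a j * rect_integral (2 * H - 1) (x j) (y j) (x i) (y i))%:E)%E.
Proof.
move=> xy; have x0 i : 0 <= x i by have /andP[] := xy i.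
have y0 i : 0 <= y i by have /andP[h1 h2] := xy i; exact: le_trans h2.
have E w : (\sum_(i < n) a i * (B (y i) w - B (x i) w)) ^+ 2 =
  \sum_(i < n) \sum_(j < n) a i * a j * ((B (y i) w - B (x i) w) * (B (y j) w - B (x j) w)).
  rewrite expr2 big_distrlr; apply: eq_bigr => i _; apply: eq_bigr => j _ /=; ring.
under eq_integral do rewrite E.
rewrite (integral_double_sum _ (fun i j => (integral_fbmBM (x0 j) (y0 j) (x0 i) (y0 i)).1)
  (fun i j => (integral_fbmBM (x0 j) (y0 j) (x0 i) (y0 i)).2)).
congr EFin; rewrite mulr_sumr; apply: eq_bigr => i _; rewrite mulr_sumr.
by apply: eq_bigr => j _; ring.
Qed.

(** Not the sharp power N^(2H), but it tends to 0 with [N]. *)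
Definition ito_bound (N : R) : R :=
  H * (2 * H - 1) * (2 * hls_const H * N + H * N ^+ 2).

Lemma integral_step_sqr_le n (a x y : 'I_n -> R) (N : R) :
  (forall i, 0 <= x i <= y i) -> 0 <= N ->
  (\int[mu]_u (`|\sum_(i < n) a i * \1_`]x i, y i] u| `^ H^-1)%:E <= N%:E)%E ->
  (\int[P]_w ((\sum_(i < n) a i * (B (y i) w - B (x i) w)) ^+ 2)%:E <=
   (ito_bound N)%:E)%E.
Proof.
move=> xy N0 hN; have /andP[H1 H2] := H12.
rewrite integral_step_sqr// lee_fin /ito_bound ler_wpM2l//.
  by rewrite mulr_ge0; lra.
exact: quadratic_form_le.
Qed.

Lemma integral_fbmB_sqr s t : 0 <= s -> 0 <= t ->
  (\int[P]_w ((B t w - B s w) ^+ 2)%:E = (`|t - s| `^ (2 * H))%:E)%E.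
Proof.
move=> s0 t0; have /andP[H1 H2] := H12.
under eq_integral do rewrite expr2.
rewrite (integral_fbmBM s0 t0 s0 t0).2 /rect_integral.
rewrite !subrr normr0 powR0; last by rewrite gt_eqF//; lra.
have -> : 2 * H - 1 + 1 = 2 * H by ring.
by rewrite (distrC s t); congr EFin; field; rewrite !gt_eqF//; lra.
Qed.

End second_moments.

(** * Gaussian moments and Hoelder continuity *)

Section gaussian_moments.
Context {R : realType}.
Notation mu := (@lebesgue_measure R).
Implicit Types (m s x : R).

(** The Radon-Nikodym derivative of the normal law equals [normal_pdf] almost everywhere, since both
    have the same integral over every measurable set. *)
Lemma ge0_integral_normal_prob m s (f : R -> R) : measurable_fun setT f ->
  (forall x, 0 <= f x) ->
  (\int[normal_prob m s]_x (f x)%:E = \int[mu]_x (f x * normal_pdf m s x)%:E)%E.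
Proof.
move=> mf f0; pose nu : {finite_measure set _ -> \bar R} := normal_prob m s.
have dom : nu `<< mu by exact: normal_prob_dominates.
have mfE : measurable_fun setT (EFin \o f) by exact/measurable_EFinP.
have f0E x : (0 <= (EFin \o f) x)%E by rewrite /= lee_fin.
under [RHS]eq_integral do rewrite EFinM.
rewrite -(Radon_Nikodym_SigmaFinite.change_of_variables dom f0E measurableT mfE)/=.
apply: ge0_ae_eq_integral => //.
- apply: emeasurable_funM => //; apply: (measurable_int mu).
  exact: Radon_Nikodym_SigmaFinite.f_integrable.
- by apply: emeasurable_funM => //; apply/measurable_EFinP; exact: measurable_normal_pdf.
- move=> x _; apply: mule_ge0; [exact: f0E|exact: Radon_Nikodym_SigmaFinite.f_ge0].
- by move=> x _; rewrite -EFinM lee_fin mulr_ge0 ?normal_pdf_ge0.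
apply: ae_eqe_mul2l => /=.
apply: integral_ae_eq => //=.
- exact: Radon_Nikodym_SigmaFinite.f_integrable.
- by apply/measurable_EFinP; exact: measurable_normal_pdf.
- by move=> E _ mE; rewrite -Radon_Nikodym_SigmaFinite.f_integral.
Qed.

Lemma exprn_le_expR n x : 0 <= x -> x ^+ n <= n`!%:R * expR x.
Proof.
move=> x0; case: n => [|n]; first by rewrite expr0 fact0 mul1r -expR0 ler_expR.
have h := expR_ge1Dxn n x0.
have f0 : (0 : R) < n.+1`!%:R by rewrite ltr0n fact_gt0.
rewrite [leRHS]mulrC -ler_pdivrMr//; lra.
Qed.

(** With u = (x - m)^2 / (4 s^2), the Gaussian factor is exp(-2u), and u^n exp(-2u) <= n! exp(-u).
    The remaining exp(-u) belongs to the normal density of standard deviation sqrt 2 * s, which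
    integrates to 1. *)
Lemma normal_prob_central_moment m s n : s != 0 ->
  (\int[normal_prob m s]_x (((x - m) ^+ 2) ^+ n)%:E <=
   (2 * n`!%:R * (4 * s ^+ 2) ^+ n)%:E)%E.
Proof.
move=> s0; pose s' := Num.sqrt 2 * s.
have s'0 : s' != 0 by rewrite mulf_neq0// sqrtr_eq0 -ltNge.
have s'2 : s' ^+ 2 = 2 * s ^+ 2 by rewrite exprMn sqr_sqrtr.
have s2 : 0 < s ^+ 2 by rewrite exprn_even_gt0.
have mE : measurable_fun setT (fun x => ((x - m) ^+ 2) ^+ n).
  by apply: measurable_funX; apply: measurable_funX; exact: measurable_funB.
rewrite ge0_integral_normal_prob//; last by move=> x; rewrite exprn_ge0// sqr_ge0.
set K := 2 * _ * _.
have K0 : 0 <= K by rewrite !mulr_ge0// exprn_ge0// mulr_ge0// ltW.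
apply: (@le_trans _ _ (\int[mu]_x (K * normal_pdf m s' x)%:E)%E).
  apply: ge0_le_integral_fin => //.
  - by apply: measurable_funM => //; exact: measurable_normal_pdf.
  - by apply: measurable_funM => //; exact: measurable_normal_pdf.
  - by move=> x _; rewrite mulr_ge0 ?normal_pdf_ge0// exprn_ge0// sqr_ge0.
  move=> x _; rewrite !normal_pdfE// mulrCA [leRHS]mulrCA.
  have pk : normal_peak s <= 2 * normal_peak s'.
    rewrite /normal_peak s'2.
    have -> : 2 * s ^+ 2 * pi *+ 2 = 2 * (s ^+ 2 * pi *+ 2) by ring.
    rewrite sqrtrM// invfM mulrA -[leLHS]mul1r ler_wpM2r ?invr_ge0 ?sqrtr_ge0//.
    rewrite ler_pdivlMr ?sqrtr_gt0// mul1r -[leRHS]ger0_norm// -sqrtr_sqr ler_wsqrtr//.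
    by rewrite expr2; lra.
  apply: (@le_trans _ _ (2 * normal_peak s' *
     (n`!%:R * (4 * s ^+ 2) ^+ n * normal_fun m s' x))); last first.
    by rewrite /K le_eqVlt; apply/orP; left; apply/eqP; ring.
  apply: ler_pM => //.
  - by rewrite normal_peak_ge0.
  - by rewrite mulr_ge0 ?normal_fun_ge0// exprn_ge0// sqr_ge0.
  rewrite /normal_fun.
  pose u := (x - m) ^+ 2 / (4 * s ^+ 2).
  have u0 : 0 <= u by rewrite divr_ge0 ?sqr_ge0// mulr_ge0// ltW.
  have -> : - (x - m) ^+ 2 / (s ^+ 2 *+ 2) = - u + - u.
    by rewrite /u; field.
  have -> : - (x - m) ^+ 2 / (s' ^+ 2 *+ 2) = - u.
    by rewrite /u s'2; field.
  rewrite expRD mulrA ler_wpM2r ?expR_ge0//.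
  have -> : (x - m) ^+ 2 = u * (4 * s ^+ 2) by rewrite /u; field.
  rewrite exprMn mulrAC ler_wpM2r//; first by rewrite exprn_ge0// mulr_ge0// ltW.
  by rewrite expRN ler_pdivrMr ?expR_gt0// exprn_le_expR.
rewrite ge0_integralZl_fin//; last 2 first.
- exact: measurable_normal_pdf.
- by move=> x _; exact: normal_pdf_ge0.
by rewrite integral_normal_pdf mule1.
Qed.

(** A density bounded by its peak k gives [-a, a] with a = 1/(4k) mass at most 1/2, so the second
    moment is at least a^2 / 2 = pi s^2 / 16, and pi >= 2. The mean does not enter. *)
Lemma normal_prob_variance_le m s (v : R) : s != 0 ->
  (\int[normal_prob m s]_x (x ^+ 2)%:E <= v%:E)%E -> s ^+ 2 <= 8 * v.
Proof.
move=> s0; rewrite ge0_integral_normal_prob//; last by move=> x; exact: sqr_ge0.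
move=> hv; pose k := normal_peak s; have k0 : 0 < k by exact: normal_peak_gt0.
have s2 : 0 < s ^+ 2 by rewrite exprn_even_gt0.
pose a := (4 * k)^-1; have a0 : 0 < a by rewrite invr_gt0 mulr_gt0.
have mp : measurable_fun setT (normal_pdf m s) by exact: measurable_normal_pdf.
have p0 := @normal_pdf_ge0 R m s.
have : (\int[mu]_x (a ^+ 2 * normal_pdf m s x)%:E <=
    \int[mu]_x (x ^+ 2 * normal_pdf m s x + a ^+ 2 * k * \1_`[- a, a] x)%:E)%E.
  apply: ge0_le_integral_fin => //.
  - exact: measurable_funM.
  - apply: measurable_funD; apply: measurable_funM => //.
  - by move=> x _; rewrite mulr_ge0// sqr_ge0.
  move=> x _; rewrite indicE; have [|] := boolP (x \in _).
    move=> _; rewrite mulr1 -[leLHS]add0r; apply: lerD.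
      by apply: mulr_ge0; [exact: sqr_ge0|exact: p0].
    by rewrite ler_wpM2l ?sqr_ge0// normal_pdf_ub.
  rewrite mulr0 addr0 => /negP h; rewrite ler_wpM2r// -[leRHS]real_normK ?num_real//.
  rewrite ler_pXn2r ?nnegrE ?(ltW a0)// leNgt; apply/negP => xa; apply: h.
  by rewrite inE/= in_itv/= -ler_norml ltW.
rewrite ge0_integralZl_fin ?sqr_ge0//.
rewrite integral_normal_pdf mule1 ge0_integralD_fin//; last 4 first.
- exact: measurable_funM.
- exact: measurable_funM.
- by move=> x _; rewrite mulr_ge0// sqr_ge0.
- by move=> x _; rewrite indicE mulr_ge0// mulr_ge0 ?sqr_ge0// ltW.
rewrite ge0_integralZl_fin//; last by rewrite mulr_ge0 ?sqr_ge0// ltW.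
rewrite integral_indic//= setIT lebesgue_measure_itv/= lte_fin gtrN// -EFinD -EFinM opprK.
move=> h; have {h hv}: ((a ^+ 2)%:E <= v%:E + (a ^+ 2 * k * (a + a))%:E)%E.
  by apply: le_trans h _; rewrite leeD2r.
rewrite -EFinD lee_fin.
have -> : a ^+ 2 * k * (a + a) = a ^+ 2 / 2 by rewrite /a; field; rewrite gt_eqF.
have -> : a ^+ 2 = s ^+ 2 * pi / 8.
  have kk : k ^- 2 = s ^+ 2 * pi *+ 2.
    rewrite /k /normal_peak exprVn invrK sqr_sqrtr// mulrn_wge0// mulr_ge0 ?pi_ge0//.
    exact: ltW.
  by rewrite /a exprVn exprMn invfM kk -mulr_natr; field.
have : s ^+ 2 * 2 <= s ^+ 2 * pi by rewrite ler_wpM2l ?pi_ge2// ltW.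
by lra.
Qed.

Lemma exprD_le2 n (a b : R) : 0 <= a -> 0 <= b ->
  (a + b) ^+ n <= 2 ^+ n * (a ^+ n + b ^+ n).
Proof.
move=> a0 b0; wlog ab : a b a0 b0 / a <= b.
  by move=> hw; have [/hw->//|/ltW/hw] := leP a b; rewrite addrC [a ^+ _ + _]addrC => ->.
apply: (@le_trans _ _ ((2 * b) ^+ n)).
  by rewrite lerXn2r ?nnegrE ?addr_ge0 ?mulr_ge0//; lra.
by rewrite exprMn ler_wpM2l ?exprn_ge0// lerDr exprn_ge0.
Qed.

Lemma sqrB_le x m : (x - m) ^+ 2 <= 2 * x ^+ 2 + 2 * m ^+ 2.
Proof. by have := sqr_ge0 (x + m); rewrite !expr2; nra. Qed.

(** If v is the second moment, s^2 <= 8v gives 4 s^2 <= 32 v for the central moment and m^2 <= 2v +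
    16 s^2 <= 130 v for the mean. The powers of 2 come from (x - m + m)^(2n), and the final 1 covers
    Dirac laws. *)
Definition gaussian_moment_const n : R :=
  2 ^+ n * (2 ^+ n * (130 ^+ n) + 2 ^+ n * (2 * n`!%:R * 32 ^+ n)) + 1.

Lemma gaussian_moment_le d (Omega : measurableType d) (P : probability Omega R)
    (Y : Omega -> R) (v : R) n :
  measurable_fun setT Y -> gaussian P Y ->
  (\int[P]_w (Y w ^+ 2)%:E = v%:E)%E ->
  (\int[P]_w ((Y w ^+ 2) ^+ n)%:E <= (gaussian_moment_const n * v ^+ n)%:E)%E.
Proof.
move=> mY [m [s [s0 lawY]]] Yv.
have v0 : 0 <= v by rewrite -lee_fin -Yv integral_ge0// => w _; rewrite lee_fin sqr_ge0.
have mY1 : @measurable_fun _ _ Omega (measurableTypeR R) setT Y by exact: mY.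
pose Y' : {mfun Omega >-> measurableTypeR R} :=
  HB.pack Y (isMeasurableFun.Build _ _ _ _ _ mY1).
have IY (f : R -> R) : measurable_fun setT f -> (forall x, 0 <= f x) ->
    (\int[P]_w (f (Y w))%:E = \int[distribution P Y']_x (f x)%:E)%E.
  move=> mf f0; rewrite ge0_integral_distribution//; first exact/measurable_EFinP.
have mX k : measurable_fun setT (fun x : R => (x ^+ 2) ^+ k).
  by apply: measurable_funX; exact: measurable_funX.
have X0 k x : 0 <= (x ^+ 2) ^+ k by rewrite exprn_ge0// sqr_ge0.
have c1 : 1 <= gaussian_moment_const n.
  by rewrite /gaussian_moment_const lerDr !(mulr_ge0, addr_ge0, exprn_ge0).
have p2 : 0 <= (2 ^+ n : R) by exact: exprn_ge0.
rewrite (IY (fun x => (x ^+ 2) ^+ n))//.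
move: Yv; rewrite (IY (fun x => x ^+ 2)) => [Yv||x]; [|exact: measurable_funX|exact: sqr_ge0].
(* If the law is a Dirac mass at [m], then v = m^2 and the claim is v^n <= c v^n with c >= 1. *)
have [sE|sN] := eqVneq s 0.
  have E (f : R -> \bar R) : measurable_fun setT f ->
      (\int[distribution P Y']_x f x = f m)%E.
    move=> mf; transitivity (\int[@dirac _ (measurableTypeR R) m R]_x f x)%E.
      apply: eq_measure_integral => A mA _.
      by have := lawY A mA; rewrite sE eqxx.
    by rewrite integral_dirac// diracT mul1e.
  move: Yv; rewrite !E//.
  - by move=> [->]; rewrite lee_fin ler_peMl// exprn_ge0.
  - by apply/measurable_EFinP; exact: measurable_funX.
  - exact/measurable_EFinP.
have E (f : R -> \bar R) :
    (\int[distribution P Y']_x f x = \int[normal_prob m s]_x f x)%E.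
  apply: eq_measure_integral => A mA _.
  by have := lawY A mA; rewrite (negbTE sN).
rewrite E; move: Yv; rewrite E => Yv.
have s8 : s ^+ 2 <= 8 * v by apply: (@normal_prob_variance_le m s v) => //; move/eqP: Yv; rewrite eq_le => /andP[].
have mB : measurable_fun setT (fun x => (x - m) ^+ 2 : R).
  by apply: measurable_funX; exact: measurable_funB.
have mBn k : measurable_fun setT (fun x => ((x - m) ^+ 2) ^+ k : R) by exact: measurable_funX.
have Icst (c : R) : (\int[normal_prob m s]_x c%:E = c%:E)%E.
  by rewrite integral_cst// -[RHS]mule1; congr (_ * _)%E; exact: (@probability_setT _ _ _ (normal_prob m s)).
have m130 : m ^+ 2 <= 130 * v.
  rewrite -lee_fin -Icst.
  apply: (@le_trans _ _ (\int[normal_prob m s]_x (2 * x ^+ 2 + 2 * (x - m) ^+ 2)%:E)%E).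
    apply: ge0_le_integral_fin => //.
    - apply: measurable_funD; apply: measurable_funM => //; exact: measurable_funX.
    - by move=> x _; exact: sqr_ge0.
    - by move=> x _; have := sqrB_le x (x - m); rewrite subKr.
  rewrite ge0_integralD_fin//; last 4 first.
  - by apply: measurable_funM => //; exact: measurable_funX.
  - exact: measurable_funM.
  - by move=> x _; rewrite mulr_ge0// sqr_ge0.
  - by move=> x _; rewrite mulr_ge0// sqr_ge0.
  rewrite !ge0_integralZl_fin//; [|by move=> x _; exact: sqr_ge0..].
  rewrite Yv; have := normal_prob_central_moment m 1 sN.
  rewrite !expr1 => h.
  apply: (@le_trans _ _ ((2 * v)%:E + 2%:E * (2 * 1`!%:R * (4 * s ^+ 2))%:E)%E).
    by rewrite EFinM leeD2l// lee_wpmul2l.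
  by rewrite -EFinM -EFinD lee_fin (_ : 1`! = 1%N)//; lra.
apply: (@le_trans _ _ (\int[normal_prob m s]_x
    (2 ^+ n * (2 ^+ n * (m ^+ 2) ^+ n) + 2 ^+ n * 2 ^+ n * ((x - m) ^+ 2) ^+ n)%:E)%E).
  apply: ge0_le_integral_fin => //.
  - exact: mX.
  - by apply: measurable_funD => //; apply: measurable_funM => //; exact: mBn.
  move=> x _; apply: (@le_trans _ _ ((2 * (x - m) ^+ 2 + 2 * m ^+ 2) ^+ n)).
    apply: lerXn2r; rewrite ?nnegrE ?sqr_ge0//.
      by apply: addr_ge0; apply: mulr_ge0 => //; exact: sqr_ge0.
    by have := sqrB_le (x - m) (- m); rewrite opprK subrK sqrrN.
  rewrite -mulrDr exprMn -!mulrA -mulrDr ler_wpM2l ?exprn_ge0// addrC -mulrDr.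
  by rewrite exprD_le2 ?sqr_ge0.
rewrite ge0_integralD_fin//; last 3 first.
- by apply: measurable_funM => //; exact: mBn.
- by move=> x _; exact: (mulr_ge0 p2 (mulr_ge0 p2 (X0 n m))).
- by move=> x _; exact: (mulr_ge0 (mulr_ge0 p2 p2) (X0 n (x - m))).
rewrite Icst; have := ge0_integralZl_fin (normal_prob m s) measurableT (mBn n)
  (fun x _ => X0 n (x - m)) (mulr_ge0 p2 p2).
move=> ->.
have h := normal_prob_central_moment m n sN.
apply: (@le_trans _ _ ((2 ^+ n * (2 ^+ n * (m ^+ 2) ^+ n))%:E +
   (2 ^+ n * 2 ^+ n)%:E * (2 * n`!%:R * (4 * s ^+ 2) ^+ n)%:E)%E).
  by rewrite leeD2l// lee_wpmul2l// lee_fin mulr_ge0 ?exprn_ge0.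
rewrite -EFinM -EFinD lee_fin.
have h1 : (m ^+ 2) ^+ n <= 130 ^+ n * v ^+ n.
  by rewrite -exprMn lerXn2r ?nnegrE ?sqr_ge0// mulr_ge0.
have h2 : (4 * s ^+ 2) ^+ n <= 32 ^+ n * v ^+ n.
  by rewrite -exprMn lerXn2r ?nnegrE ?(mulr_ge0 _ (sqr_ge0 _)) ?mulr_ge0//; lra.
apply: (@le_trans _ _ (2 ^+ n * (2 ^+ n * (130 ^+ n * v ^+ n)) +
    2 ^+ n * 2 ^+ n * (2 * n`!%:R * (32 ^+ n * v ^+ n)))).
  by apply: lerD; rewrite !ler_wpM2l// ?mulr_ge0 ?exprn_ge0.
have vn : 0 <= v ^+ n by rewrite exprn_ge0.
by rewrite /gaussian_moment_const; set A := 2 ^+ n in vn *; nra.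
Qed.

End gaussian_moments.

Section geometric_increments.
Context {R : realType}.
Implicit Types (u : nat -> R) (C r l : R).

Lemma geometric_increments_le u C r n m : 0 <= r < 1 -> 0 <= C ->
  (forall k, `|u k.+1 - u k| <= C * r ^+ k) ->
  `|u (n + m)%N - u n| <= C * r ^+ n / (1 - r).
Proof.
move=> /andP[r0 r1] C0 hu.
have r1' : 0 < 1 - r by rewrite subr_gt0.
(* The exact finite geometric sum, which unlike the stated bound is stable under induction on
   [m]. *)
suff : `|u (n + m)%N - u n| <= C * r ^+ n * (1 - r ^+ m) / (1 - r).
  move=> /le_trans; apply; rewrite ler_pM2r ?invr_gt0// ler_piMr//.
    by rewrite mulr_ge0// exprn_ge0.
  by rewrite gerBl exprn_ge0.
elim: m => [|m IH].
  by rewrite addn0 subrr normr0 expr0 subrr mulr0 mul0r.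
rewrite addnS (le_trans (ler_distD (u (n + m)%N) _ _))//.
apply: (le_trans (lerD (hu _) IH)); rewrite le_eqVlt; apply/orP; left; apply/eqP.
by rewrite exprD exprS; field; rewrite gt_eqF.
Qed.

Lemma geometric_increments_cvg u C r : 0 <= r < 1 -> 0 <= C ->
  (forall k, `|u k.+1 - u k| <= C * r ^+ k) -> cvgn u.
Proof.
move=> r01 C0 hu; have /andP[r0 r1] := r01.
have r1' : 0 < 1 - r by rewrite subr_gt0.
apply/cauchy_cvgP; apply: cauchy_exP => e e0.
have : (C / (1 - r)) * r ^+ n @[n --> \oo] --> (0 : R).
  by apply: cvg_geometric; rewrite ger0_norm.
move=> /cvgrPdist_lt /(_ _ e0)[N _ /(_ N (leqnn N))].
rewrite sub0r normrN ger0_norm; last by rewrite mulr_ge0 ?exprn_ge0// divr_ge0// ltW.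
move=> hN; exists (u N); exists N => // k /= Nk.
rewrite /ball/= distrC; apply: le_lt_trans hN.
by have := geometric_increments_le N (k - N) r01 C0 hu; rewrite subnKC// mulrAC.
Qed.

Lemma geometric_increments_lim_le u C r l n : 0 <= r < 1 -> 0 <= C ->
  (forall k, `|u k.+1 - u k| <= C * r ^+ k) -> u k @[k --> \oo] --> l ->
  `|l - u n| <= C * r ^+ n / (1 - r).
Proof.
move=> r01 C0 hu ul.
have h : (fun k => `|u (n + k)%N - u n|) @ \oo --> `|l - u n|.
  apply: cvg_norm; apply: cvgB; last exact: cvg_cst.
  exact: (cvg_comp (addn n) u (cvg_addnl n) ul).
by apply: (cvgr_to_le h); apply: nearW => m; exact: geometric_increments_le.
Qed.

End geometric_increments.

(** * Dyadic approximation and chaining *)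

Section dyadic.
Context {R : realType}.
Implicit Types (f : R -> R) (g K s t : R).

Definition dyadic_floor n t : nat := Num.truncn (t * 2 ^+ n).
Definition dyadic_approx n t : R := (dyadic_floor n t)%:R / 2 ^+ n.

Lemma dyadic_floor_itv n t : 0 <= t ->
  (dyadic_floor n t)%:R <= t * 2 ^+ n < (dyadic_floor n t)%:R + 1.
Proof.
by move=> t0; rewrite natr1; apply: truncn_itv; rewrite mulr_ge0// exprn_ge0.
Qed.

Lemma dyadic_floor_le n t : 0 <= t <= 1 -> (dyadic_floor n t <= 2 ^ n)%N.
Proof.
move=> /andP[t0 t1]; rewrite -(ler_nat R).
have /andP[h _] := dyadic_floor_itv n t0; rewrite (le_trans h)// natrX.
by rewrite ler_piMl// exprn_ge0.
Qed.

Lemma dyadic_floorS n t : 0 <= t ->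
  dyadic_floor n.+1 t = (dyadic_floor n t).*2 \/
  dyadic_floor n.+1 t = (dyadic_floor n t).*2.+1.
Proof.
move=> t0; have /andP[h1 h2] := dyadic_floor_itv n t0.
have /andP[h3 h4] := dyadic_floor_itv n.+1 t0.
move: h3 h4; rewrite exprS mulrCA; set a := dyadic_floor n t in h1 h2 *.
set b := dyadic_floor n.+1 t; set x := t * 2 ^+ n in h1 h2 * => h3 h4.
have h5 : (b < a.*2.+2)%N.
  by rewrite -(ltr_nat R) -addn2 -muln2 natrD natrM; lra.
have h6 : (a.*2 < b.+1)%N.
  by rewrite -(ltr_nat R) -addn1 -muln2 natrD natrM; lra.
by move: h5 h6; rewrite !ltnS leq_eqVlt ltnS => /orP[/eqP|] h5 h6;
  [right|left; apply/eqP; rewrite eqn_leq h5].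
Qed.

Lemma cvg_dyadic_approx t : 0 <= t -> dyadic_approx n t @[n --> \oo] --> t.
Proof.
move=> t0; apply: (@squeeze_cvgr _ _ _ _ (fun n => t - (1 / 2) ^+ n) (cst t)).
- near=> n; have /andP[h1 h2] := dyadic_floor_itv n t0.
  have p2 : 0 < (2 ^+ n : R) by rewrite exprn_gt0.
  rewrite /dyadic_approx ler_pdivrMr// h1 andbT.
  rewrite ler_pdivlMr// mulrBl expr_div_n expr1n mul1r mulVf ?gt_eqF//; lra.
- rewrite -[X in _ --> X]subr0; apply: cvgB; first exact: cvg_cst.
  have := @cvg_geometric R 1 (1 / 2); rewrite ger0_norm; last by lra.
  have -> : 1 / 2 < 1 :> R by lra.
  move=> /(_ isT); apply: cvg_trans; apply: near_eq_cvg; near=> n.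
  by rewrite /geometric /= [LHS]mul1r.
- exact: cvg_cst.
Unshelve. all: by end_near. Qed.

(** With r = 2^-g, the values at the dyadic approximations of a point converge geometrically to the
    value there. At the level n where 2^-n is comparable to |t - s|, the approximations of s and t
    coincide or are neighbours. *)
Lemma dyadic_chaining f g K : 0 < g -> 0 <= K -> continuous f ->
  (forall n k, (k < 2 ^ n)%N ->
    `|f (k.+1%:R / 2 ^+ n) - f (k%:R / 2 ^+ n)| <= K * (2^-1 `^ g) ^+ n) ->
  exists2 C, 0 <= C & forall s t, 0 <= s <= 1 -> 0 <= t <= 1 ->
    `|f t - f s| <= C * `|t - s| `^ g.
Proof.
move=> g0 K0 cf hf; set r := 2^-1 `^ g in hf *.
have r0 : 0 < r by apply: powR_gt0; lra.
have r1 : r < 1.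
  rewrite -[ltRHS](powRr0 2^-1) /r /powR gt_eqF ?invr_gt0// ltr_expR.
  by rewrite ltr_nM2r ?ln_lt0//; lra.
have r01 : 0 <= r < 1 by rewrite (ltW r0).
have r1' : 0 < 1 - r by rewrite subr_gt0.
have step n t : 0 <= t <= 1 ->
    `|f (dyadic_approx n.+1 t) - f (dyadic_approx n t)| <= K * r * r ^+ n.
  move=> /andP[t0 t1]; rewrite -mulrA -exprS.
  have dbl : (dyadic_floor n t).*2%:R / 2 ^+ n.+1 = dyadic_approx n t.
    rewrite /dyadic_approx -muln2 natrM exprS; field.
    by rewrite gt_eqF// exprn_gt0.
  case: (dyadic_floorS n t0) => E; rewrite {1}/dyadic_approx E -dbl.
    by rewrite subrr normr0 mulr_ge0// exprn_ge0// ltW.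
  by apply: hf; have := @dyadic_floor_le n.+1 t; rewrite E t0 t1; exact.
have lim n t : 0 <= t <= 1 ->
    `|f t - f (dyadic_approx n t)| <= K * r * r ^+ n / (1 - r).
  move=> t01; have /andP[t0 t1] := t01.
  apply: (@geometric_increments_lim_le _ (fun n => f (dyadic_approx n t))) => //.
  - by rewrite mulr_ge0// ltW.
  - by move=> k; exact: step.
  - apply: (cvg_comp _ _ (cvg_dyadic_approx t0)); exact: cf.
(* Two tails and one increment at level n; the division by r turns r^n into r^(n + 1), which is what
   |t - s|^g dominates. *)
pose C := (K * r / (1 - r) * 2 + K) / r.
have C0 : 0 <= C.
  apply: divr_ge0; last exact: ltW.
  by rewrite addr_ge0// mulr_ge0// divr_ge0 ?mulr_ge0 ?(ltW r0)// ltW.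
exists C => // s t s01 t01.
wlog st : s t s01 t01 / s < t.
  move=> hw; case: (ltgtP s t) => st; first exact: hw.
    by rewrite distrC (distrC t); exact: hw.
  by rewrite st !subrr normr0 mulr_ge0// powR_ge0.
have /andP[s0 s1] := s01; have /andP[t0 t1] := t01.
have d0 : 0 < t - s by rewrite subr_gt0.
(* The least n satisfying the first inequality; minimality gives the second, and at n = 0 it is t -
   s <= 1. *)
have [n hn1 hn2] : exists2 n, 2^-1 ^+ n.+1 < t - s & t - s <= 2^-1 ^+ n.
  have ex : exists n, 2^-1 ^+ n.+1 < t - s.
    have := @cvg_geometric R 1 2^-1; rewrite ger0_norm; last by lra.
    have -> : 2^-1 < 1 :> R by lra.
    move=> /(_ isT)/cvgrPdist_lt/(_ _ d0)[N _ /(_ N.+1 (leqnSn N))].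
    rewrite /geometric/= mul1r sub0r normrN ger0_norm ?exprn_ge0//.
    by exists N.
  case: (ex_minnP ex) => n hn min; exists n => //.
  case: n hn min => [|n] hn min; first by rewrite expr0; lra.
  by rewrite leNgt; apply/negP => /min; rewrite ltnn.
have p2 : 0 < (2 ^+ n : R) by rewrite exprn_gt0.
have close : `|f (dyadic_approx n t) - f (dyadic_approx n s)| <= K * r ^+ n.
  have /andP[a1 a2] := dyadic_floor_itv n s0.
  have /andP[b1 b2] := dyadic_floor_itv n t0.
  have ts1 : t * 2 ^+ n - s * 2 ^+ n <= 1.
    by rewrite -mulrBl -ler_pdivlMr// div1r -exprVn.
  have ts0 : s * 2 ^+ n <= t * 2 ^+ n by rewrite ler_pM2r// ltW.
  have : (dyadic_floor n t < (dyadic_floor n s).+2)%N.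
    by rewrite -(ltr_nat R) -addn2 natrD; lra.
  have : (dyadic_floor n s < (dyadic_floor n t).+1)%N.
    by rewrite -(ltr_nat R) -natr1; lra.
  rewrite !ltnS => h1; rewrite leq_eqVlt ltnS => /orP[/eqP E|h2].
    rewrite /dyadic_approx E; apply: hf.
    by have := @dyadic_floor_le n t; rewrite E t01; exact.
  have E : dyadic_floor n s = dyadic_floor n t by apply/eqP; rewrite eqn_leq h1.
  by rewrite /dyadic_approx E subrr normr0 mulr_ge0// exprn_ge0// ltW.
have L1 := lim n _ s01; have L2 := lim n _ t01.
have tot : `|f t - f s| <= C * r ^+ n.+1.
  have -> : C * r ^+ n.+1 =
      K * r * r ^+ n / (1 - r) + K * r ^+ n + K * r * r ^+ n / (1 - r).
    by rewrite /C exprS; field; rewrite !gt_eqF.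
  apply: (le_trans (ler_distD (f (dyadic_approx n s)) _ _)); apply: lerD; last by rewrite distrC.
  apply: (le_trans (ler_distD (f (dyadic_approx n t)) _ _)); exact: lerD.
apply: (le_trans tot); rewrite ler_wpM2l//.
rewrite /r -powR_mulrn ?powR_ge0// powRAC powR_mulrn//.
by rewrite gtr0_norm// ge0_ler_powR ?nnegrE ?exprn_ge0 ?(ltW g0) ?(ltW d0)// ltW.
Qed.

End dyadic.

(** Freezing a path at its value at 0 for negative times replaces continuity within the ray by plain
    continuity, the form used for all path properties below. *)
Lemma continuous_max0 (R : realType) (f : R -> R) :
  {within time_domain +oo%E, continuous f} -> continuous (fun t : R => f (Num.max 0 t)).
Proof.
move=> /subspace_continuousP cf t.
have m0 : time_domain +oo%E (Num.max 0 t) by split; [rewrite le_max lexx|rewrite ltry].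
have cm : (fun t : R => Num.max 0 t) @ t --> Num.max 0 t.
  exact: (@continuous_max _ _ (cst (0 : R)) (fun t : R => t) t (cvg_cst _) cvg_id).
have cmw : (fun t : R => Num.max 0 t) @ t -->
    within (time_domain +oo%E) (nbhs (Num.max 0 t)).
  move=> A nA.
  have : \forall x \near t, time_domain +oo%E (Num.max 0 x) -> A (Num.max 0 x) by exact: (cm _ nA).
  change ((\forall x \near t, time_domain +oo%E (Num.max 0 x) -> A (Num.max 0 x)) ->
    \forall x \near t, A (Num.max 0 x)).
  apply: filterS => x; apply.
  by split; [rewrite le_max lexx|rewrite ltry].
exact: (cvg_comp _ _ cmw (cf _ m0)).
Qed.

(** * Hoelder continuity of the paths *)

Section kolmogorov.
Context {R : realType} {d : measure_display} {Omega : measurableType d}.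
Context (P : probability Omega R) (H : R) (B : R -> Omega -> R).
Hypothesis H12 : 2^-1 < H < 1.
Hypothesis hB : fractional_brownian_motion P H B.

Lemma measurable_fbmB s t : 0 <= s -> 0 <= t ->
  measurable_fun setT (fun w => B t w - B s w).
Proof.
by move=> s0 t0; apply: measurable_funB; [exact: (fbm_measurable hB t0)|exact: (fbm_measurable hB s0)].
Qed.

Lemma fbm_increment_moment s t n : 0 <= s -> 0 <= t ->
  (\int[P]_w (((B t w - B s w) ^+ 2) ^+ n)%:E <=
   (gaussian_moment_const n * (`|t - s| `^ (2 * H)) ^+ n)%:E)%E.
Proof.
move=> s0 t0; apply: gaussian_moment_le.
- exact: measurable_fbmB.
- pose tt (i : 'I_2) := if i == ord0 then t else s.
  pose c (i : 'I_2) : R := if i == ord0 then 1 else -1.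
  have tt0 i : 0 <= tt i by rewrite /tt; case: ifP.
  have := fbm_gaussian hB c tt0.
  congr gaussian; apply/funext => w.
  by rewrite !big_ord_recl big_ord0 /c /tt /=; ring.
- exact: integral_fbmB_sqr.
Qed.

(** The 2p-th moment of a level-n increment divided by r^n is at most C 2^(-2pn(H - g)). For p
    large, the sum over all 2^n increments and all n has finite expectation, so it is almost surely
    finite, and it bounds each term. *)
Lemma ae_dyadic_increments (T g : R) : 0 < T -> 0 < g < H ->
  {ae P, forall w, exists2 K, 0 <= K & forall n k, (k < 2 ^ n)%N ->
    `|B (T * (k.+1%:R / 2 ^+ n)) w - B (T * (k%:R / 2 ^+ n)) w|
      <= K * (2^-1 `^ g) ^+ n}.
Proof.
move=> T0 /andP[g0 gH]; set r := 2^-1 `^ g.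
have r0 : 0 < r by apply: powR_gt0; rewrite invr_gt0.
(* Large enough that p(H - g) >= 1: the moments then decay like 4^-n, which beats the 2^n
   increments. *)
pose p := (Num.truncn (H - g)^-1).+1.
have pH : 1 <= p%:R * (H - g).
  have gH' : 0 < H - g by rewrite subr_gt0.
  have gV : 0 <= (H - g)^-1 by rewrite invr_ge0 ltW.
  have /andP[_ h] := truncn_itv gV.
  by rewrite -[leLHS](@mulVf _ (H - g)) ?gt_eqF// ler_wpM2r ?(ltW gH')// ltW.
pose D n k w := B (T * (k.+1%:R / 2 ^+ n)) w - B (T * (k%:R / 2 ^+ n)) w.
have T0' n k : 0 <= T * (k%:R / 2 ^+ n) by rewrite mulr_ge0 ?(ltW T0)// divr_ge0// exprn_ge0.
have mD n k : measurable_fun setT (D n k) by exact: measurable_fbmB.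
pose G n k w := ((D n k w / r ^+ n) ^+ 2) ^+ p.
have G0 n k w : 0 <= G n k w by rewrite exprn_ge0// sqr_ge0.
have mG n k : measurable_fun setT (G n k).
  by do 2!apply: measurable_funX; apply: measurable_funM.
pose C := gaussian_moment_const p * (T `^ (2 * H)) ^+ p : R.
have C0 : 0 <= C.
  rewrite mulr_ge0 ?exprn_ge0 ?powR_ge0//.
  by rewrite /gaussian_moment_const !(mulr_ge0, addr_ge0, exprn_ge0).
pose tau : R := 2^-1 `^ (2 * H).
have tau0 : 0 < tau by apply: powR_gt0; rewrite invr_gt0.
have IG n k : (\int[P]_w (G n k w)%:E <= (C * (tau ^+ p / r ^+ 2 ^+ p) ^+ n)%:E)%E.
  have E w : G n k w = (((r ^+ n) ^+ 2) ^+ p)^-1 * (D n k w ^+ 2) ^+ p.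
    by rewrite /G !expr_div_n mulrC.
  under eq_integral do rewrite E.
  rewrite ge0_integralZl_fin//; last 3 first.
  - by do 2!apply: measurable_funX.
  - by move=> w _; rewrite exprn_ge0// sqr_ge0.
  - by rewrite invr_ge0 exprn_ge0// exprn_ge0// exprn_ge0// ltW.
  apply: (@le_trans _ _ ((((r ^+ n) ^+ 2) ^+ p)^-1%:E *
     (gaussian_moment_const p * (`|T * (k.+1%:R / 2 ^+ n) - T * (k%:R / 2 ^+ n)| `^ (2 * H)) ^+ p)%:E)%E).
    apply: lee_wpmul2l; last exact: fbm_increment_moment.
    by rewrite lee_fin invr_ge0 exprn_ge0// exprn_ge0// exprn_ge0// ltW.
  rewrite -EFinM lee_fin.
  have -> : T * (k.+1%:R / 2 ^+ n) - T * (k%:R / 2 ^+ n) = T * 2^-1 ^+ n.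
    by rewrite -natr1 exprVn; ring.
  rewrite ger0_norm; last by rewrite mulr_ge0 ?exprn_ge0// ltW.
  have h2 : 0 <= (2^-1 : R) by rewrite invr_ge0.
  rewrite powRM ?exprn_ge0 ?(ltW T0)// -(powR_mulrn n h2).
  rewrite powRAC powR_mulrn ?powR_ge0// -/tau /C.
  rewrite le_eqVlt; apply/orP; left; apply/eqP.
  have -> : ((r ^+ n) ^+ 2) ^+ p = ((r ^+ 2) ^+ p) ^+ n.
    by rewrite -!exprM mulnCA (mulnC n p).
  have -> : (T `^ (2 * H) * tau ^+ n) ^+ p = (T `^ (2 * H)) ^+ p * (tau ^+ p) ^+ n.
    by rewrite exprMn -!exprM (mulnC n).
  by rewrite expr_div_n; ring.
have half : 2 * (tau ^+ p / r ^+ 2 ^+ p) <= 2^-1.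
  have h2 : (0 : R) < 2^-1 by rewrite invr_gt0.
  have -> : tau ^+ p / r ^+ 2 ^+ p = 2^-1 `^ (2 * (p%:R * (H - g))).
    rewrite -exprM /tau /r -!powR_mulrn ?powR_ge0// -!powRrM -powRB; last first.
      by apply/implyP => _; rewrite gt_eqF.
    by congr (_ `^ _); rewrite natrM; ring.
  have : 2^-1 `^ (2 * (p%:R * (H - g))) <= (2^-1 `^ 2 : R).
    by apply: ger_powR; [rewrite h2/=; lra|lra].
  by rewrite (powR_mulrn 2 (ltW h2)) expr2; lra.
pose F n w := \sum_(k < 2 ^ n) G n k w.
have F0 n w : 0 <= F n w by apply: sumr_ge0.
have mF n : measurable_fun setT (F n) by apply: measurable_sum.
(* The bound C 2^-n, written in the form summed by [epsilon_trick0]. *)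
have IF n : (\int[P]_w (F n w)%:E <= (2 * C / (2 ^ n.+1)%:R)%:E)%E.
  rewrite /F; under eq_integral do rewrite -sumEFin.
  rewrite ge0_integral_sum//; last 2 first.
  - by move=> k; apply/measurable_EFinP; exact: mG.
  - by move=> k w _; rewrite lee_fin; exact: G0.
  apply: (@le_trans _ _ (\sum_(k < 2 ^ n) (C * (tau ^+ p / r ^+ 2 ^+ p) ^+ n)%:E)%E).
    by apply: lee_sum => k _.
  rewrite sumEFin sumr_const card_ord lee_fin.
  set x := tau ^+ p / _ in half *.
  have -> : C * x ^+ n *+ 2 ^ n = C * (2 * x) ^+ n.
    by rewrite -mulr_natr natrX [in RHS]exprMn mulrAC -mulrA.
  rewrite (_ : 2 * C / (2 ^ n.+1)%:R = C * 2^-1 ^+ n); last first.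
    by rewrite natrX exprS exprVn; field; rewrite gt_eqF// exprn_gt0.
  rewrite ler_wpM2l// lerXn2r ?nnegrE ?invr_ge0//.
  rewrite mulr_ge0// /x divr_ge0// exprn_ge0 ?ltW//.
  exact: exprn_gt0.
pose S w := (\sum_(0 <= n <oo) (F n w)%:E)%E.
have S0 w : (0 <= S w)%E by apply: nneseries_ge0 => n _ _; rewrite lee_fin.
have IS : P.-integrable setT S.
  apply/integrableP; split.
    apply: ge0_emeasurable_sum => [n w _ _|n _]; first by rewrite lee_fin.
    by apply/measurable_EFinP; exact: mF.
  under eq_integral do rewrite gee0_abs//.
  rewrite integral_nneseries//; last 2 first.
  - by move=> n; exact/measurable_EFinP.
  - by move=> n w _; rewrite lee_fin.
  apply: (@le_lt_trans _ _ (2 * C)%:E); last by rewrite ltry.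
  apply: le_trans (epsilon_trick0 xpredT _); last by rewrite mulr_ge0.
  apply: lee_nneseries => [n _ _|n _]; last exact: IF.
  by apply: integral_ge0 => w _; rewrite lee_fin.
have := integrable_ae measurableT IS; apply: filterS => w /(_ I) fS.
(* The maximum with 1 avoids taking a root: x <= x^(2p) as soon as x > 1. *)
exists (Num.max 1 (fine (S w))); first by rewrite le_max ler01.
move=> n k kn.
have GS : G n k w <= fine (S w).
  rewrite -lee_fin fineK//; apply: le_trans (nneseries_lim_ge n.+1 _); last first.
    by move=> m _ _; rewrite lee_fin.
  rewrite big_nat_recr//= -[leLHS]add0e; apply: leeD.
    by apply: sume_ge0 => m _; rewrite lee_fin.
  rewrite lee_fin /F (bigD1 (Ordinal kn))//= lerDl; exact: sumr_ge0.
rewrite -ler_pdivrMr ?exprn_gt0// -/(D n k w).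
have -> : `|D n k w| / r ^+ n = `|D n k w / r ^+ n|.
  by rewrite normrM normfV (@ger0_norm _ (r ^+ n)) ?exprn_ge0// ltW.
set x := `|_|.
rewrite le_max; have [//|x1] := leP x 1; rewrite orFb.
apply: le_trans GS; rewrite /G -[_ ^+ 2]real_normK ?num_real// -/x -exprM.
rewrite -[leLHS]expr1; apply: ler_weXn2l; first exact: ltW.
by rewrite muln_gt0.
Qed.

(** The horizons N + 1 are countably many, so one null set serves every [T]. Each horizon is
    rescaled to the unit interval for chaining. *)
Lemma fbm_holder (g : R) : 0 < g < H ->
  {ae P, forall w, forall T, 0 < T -> exists2 C, 0 <= C &
    forall s t, 0 <= s <= T -> 0 <= t <= T -> `|B t w - B s w| <= C * `|t - s| `^ g}.
Proof.
move=> gH; have /andP[g0 _] := gH.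
have h1 := @ae_foralln _ _ _ P _ (fun N => ae_dyadic_increments (ltr0Sn R N) gH).
apply: filterS2 h1 (fbm_continuous hB) => w h1 cw T T0.
pose N := Num.truncn T; have /andP[_ TN] := truncn_itv (ltW T0).
have [K K0 hK] := h1 N.
pose f u := B (Num.max 0 (N.+1%:R * u)) w.
have cf : continuous f.
  move=> u; apply: (@continuous_comp _ _ _ (fun u : R => N.+1%:R * u) (fun t : R => B (Num.max 0 t) w)).
    by apply: cvgM; [exact: cvg_cst|exact: cvg_id].
  exact: (continuous_max0 cw).
have fE u : 0 <= u -> f u = B (N.+1%:R * u) w.
  by move=> u0; rewrite /f max_r// mulr_ge0.
have [|C C0 hC] := dyadic_chaining g0 K0 cf _.
  move=> n k kn; rewrite !fE ?divr_ge0 ?exprn_ge0//; exact: hK.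
exists (C / N.+1%:R `^ g); first by rewrite divr_ge0// powR_ge0.
move=> s t /andP[s0 sT] /andP[t0 tT].
have Np : (0 : R) < N.+1%:R by rewrite ltr0n.
have dv u : 0 <= u <= T -> 0 <= u / N.+1%:R <= 1.
  move=> /andP[u0 uT]; rewrite divr_ge0//= ler_pdivrMr// mul1r.
  by rewrite (le_trans uT)// ltW.
have := hC (s / N.+1%:R) (t / N.+1%:R) (dv _ _) (dv _ _).
rewrite !fE ?divr_ge0// !(mulrC N.+1%:R) !divfK ?gt_eqF// -mulrBl.
rewrite normrM (ger0_norm (_ : 0 <= N.+1%:R^-1)) ?invr_ge0//.
have NV : (N.+1%:R^-1 : R) `^ g = (N.+1%:R `^ g)^-1.
  by rewrite -(powR_inv1 (ltW Np)) -powRrM mulN1r powRN.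
rewrite powRM ?invr_ge0// NV (mulrC (`|_| `^ g)) mulrA.
by apply; rewrite ?s0 ?t0.
Qed.

End kolmogorov.

(** * Pathwise construction of the noise *)

Lemma uniform_limit_continuous_at (R : realType) (f : R -> R) (F : nat -> R -> R) (x : R) :
  (forall e, 0 < e -> exists n, \forall t \near x, `|f t - F n t| <= e) ->
  (forall n, {for x, continuous (F n)}) -> {for x, continuous f}.
Proof.
move=> fF cF; apply/cvgrPdist_lt => e e0.
have e3 : 0 < e / 3 by rewrite divr_gt0.
have e4 : 0 < e / 4 by rewrite divr_gt0.
have [N fN] := fF _ e4; have fx := nbhs_singleton fN.
have /cvgrPdist_lt/(_ _ e3) cN := cF N.
near=> t.
have h1 : `|f t - F N t| <= e / 4 by near: t.
have h2 : `|F N x - F N t| < e / 3 by near: t.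
rewrite (_ : f x - f t = (f x - F N x) + (F N x - F N t) - (f t - F N t)); last by ring.
apply: (le_lt_trans (ler_normB _ _)).
have := ler_normD (f x - F N x) (F N x - F N t); lra.
Unshelve. all: by end_near. Qed.

Section pathwise_noise.
Context {R : realType}.
Implicit Types (al g T t C : R) (b : R -> R).

(** Left endpoints keep the kernel off its singularity at s = t, and the partition scales with [t]
    so that [t] is always a node. *)
Definition noise_sum al b n t : R :=
  \sum_(j < 2 ^ n) (t - t * (j%:R / 2 ^+ n)) `^ (al - 1) *
    (b (t * (j.+1%:R / 2 ^+ n)) - b (t * (j%:R / 2 ^+ n))).

(* A total replacement of the limit that preserves measurability with respect to
   an arbitrary sigma-algebra; junk unless the sequence converges. *)
Definition fine_limsup (u : nat -> R) : R := fine (limn_esup (EFin \o u)).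

Lemma fine_limsupE (u : nat -> R) (l : R) : u @ \oo --> l -> fine_limsup u = l.
Proof.
move=> ul; have ul' : (EFin \o u) @ \oo --> l%:E by apply: cvg_EFin => //; exact: nearW.
by rewrite /fine_limsup is_cvg_limn_esupE; [rewrite (cvg_lim _ ul')|apply/cvg_ex; exists l%:E].
Qed.

Definition noise al b t : R := fine_limsup (noise_sum al b ^~ t).

Lemma big_ord_double (V : nmodType) m (F : nat -> V) :
  \sum_(i < m.*2) F i = \sum_(i < m) (F i.*2 + F i.*2.+1).
Proof.
elim: m => [|m IH]; first by rewrite !big_ord0.
by rewrite doubleS !big_ord_recr/= IH addrA.
Qed.

(** Filling in the missing increments, which are nonnegative, makes the sum telescope. Monotonicity
    stops at index 2m + 1: at the next node the kernel is evaluated at 0, where [powR] gives 0. *)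
Lemma sum_alternating_le (psi : nat -> R) m : 0 <= psi 0%N ->
  (forall i, (i.+1 < m.+1.*2)%N -> psi i <= psi i.+1) ->
  \sum_(j < m.+1) (psi j.*2.+1 - psi j.*2) <= psi m.*2.+1.
Proof.
move=> p0; elim: m => [|m IH] mono.
  by rewrite big_ord_recr big_ord0/= add0r; lra.
have h : psi m.*2.+1 <= psi m.+1.*2.
  by rewrite doubleS; apply: mono; rewrite !doubleS !ltnS.
have {}IH : \sum_(j < m.+1) (psi j.*2.+1 - psi j.*2) <= psi m.*2.+1.
  by apply: IH => i im; apply: mono; rewrite (ltn_trans im)// ltn_double.
by rewrite big_ord_recr/=; lra.
Qed.

(** On the left half of each old interval the coefficient is unchanged; only the right halves see a
    new value of the kernel. *)
Lemma noise_sumS al b n t : noise_sum al b n.+1 t - noise_sum al b n t =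
  \sum_(j < 2 ^ n) ((t - t * (j.*2.+1%:R / 2 ^+ n.+1)) `^ (al - 1)
                    - (t - t * (j.*2%:R / 2 ^+ n.+1)) `^ (al - 1)) *
    (b (t * (j.*2.+2%:R / 2 ^+ n.+1)) - b (t * (j.*2.+1%:R / 2 ^+ n.+1))).
Proof.
rewrite /noise_sum.
rewrite (_ : (2 ^ n.+1 = (2 ^ n).*2)%N); last by rewrite expnS mul2n.
rewrite (big_ord_double _ (fun i => (t - t * (i%:R / 2 ^+ n.+1)) `^ (al - 1) *
   (b (t * (i.+1%:R / 2 ^+ n.+1)) - b (t * (i%:R / 2 ^+ n.+1))))).
rewrite -sumrB; apply: eq_bigr => j _.
have half k : k%:R / 2 ^+ n = k.*2%:R / 2 ^+ n.+1 :> R.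
  by rewrite -muln2 natrM exprS; field; rewrite gt_eqF// exprn_gt0.
by rewrite (half j) (half j.+1) doubleS; ring.
Qed.

(** With mesh h = t 2^-(n + 1), the increments of [b] are at most C h^g, and the kernel differences
    are nonnegative with sum at most the last kernel value h^(al - 1). The product h^(g + al - 1)
    decays geometrically because g > 1 - al. *)
Lemma noise_increment_le al g b T C n t : 0 < al < 1 -> 0 < g -> 0 <= C ->
  (forall s t, 0 <= s <= T -> 0 <= t <= T -> `|b t - b s| <= C * `|t - s| `^ g) ->
  0 <= t <= T -> 0 < g + al - 1 ->
  `|noise_sum al b n.+1 t - noise_sum al b n t| <=
    C * t `^ (g + al - 1) * (2^-1 `^ (g + al - 1)) * (2^-1 `^ (g + al - 1)) ^+ n.
Proof.
move=> /andP[al0 al1] g0 C0 hb /andP[t0 tT] del0.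
set h := t * 2^-1 ^+ n.+1.
have p2 k : 0 < (2 ^+ k : R) by rewrite exprn_gt0.
have i2 : 0 <= (2^-1 : R) by rewrite invr_ge0.
have -> : C * t `^ (g + al - 1) * (2^-1 `^ (g + al - 1)) * (2^-1 `^ (g + al - 1)) ^+ n =
    C * h `^ (g + al - 1).
  rewrite /h powRM ?exprn_ge0// -(powR_mulrn n.+1 i2) (powRAC 2^-1 n.+1%:R).
  by rewrite powR_mulrn ?powR_ge0// exprS !mulrA.
rewrite noise_sumS; move: t0; rewrite le_eqVlt => /predU1P[t0|t0].
  rewrite big1; last by move=> j _; rewrite -t0 !mul0r !subrr mulr0.
  by rewrite normr0 mulr_ge0// powR_ge0.
have h0 : 0 < h by rewrite mulr_gt0// exprn_gt0.
pose psi i : R := (t - t * (i%:R / 2 ^+ n.+1)) `^ (al - 1).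
have arg i : t - t * (i%:R / 2 ^+ n.+1) = h * (2 ^+ n.+1 - i%:R).
  by rewrite /h exprVn; field; rewrite gt_eqF.
have mono i : (i.+1 < (2 ^ n).*2)%N -> psi i <= psi i.+1.
  rewrite -mul2n -expnS => hi; have hi' : i.+2%:R <= 2 ^+ n.+1 :> R by rewrite -natrX ler_nat.
  rewrite /psi !arg /powR.
  have a1 : 0 < h * (2 ^+ n.+1 - i%:R).
    by rewrite mulr_gt0// subr_gt0 (lt_le_trans _ hi')// ltr_nat.
  have a2 : 0 < h * (2 ^+ n.+1 - i.+1%:R).
    by rewrite mulr_gt0// subr_gt0 (lt_le_trans _ hi')// ltr_nat.
  rewrite !gt_eqF// ler_expR ler_nM2l; last by lra.
  by rewrite ler_ln ?posrE// ler_pM2l// lerD2l lerN2 ler_nat.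
have [m Em] : exists m, (2 ^ n = m.+1)%N by exists (2 ^ n).-1; rewrite prednK ?expn_gt0.
have tot : \sum_(j < 2 ^ n) (psi j.*2.+1 - psi j.*2) <= psi m.*2.+1.
  by rewrite Em; apply: sum_alternating_le; [exact: powR_ge0|rewrite -Em].
have last : psi m.*2.+1 = h `^ (al - 1).
  rewrite /psi arg; congr (_ `^ _).
  have -> : 2 ^+ n.+1 = m.*2.+1%:R + 1 :> R.
    by rewrite natr1 -doubleS -Em -mul2n -expnS natrX.
  by ring.
apply: (le_trans (ler_norm_sum _ _ _)).
apply: (@le_trans _ _ (\sum_(j < 2 ^ n) (psi j.*2.+1 - psi j.*2) * (C * h `^ g))).
  apply: ler_sum => j _; rewrite normrM.
  have jn : (j.*2.+1 < (2 ^ n).*2)%N by rewrite -doubleS leq_double.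
  rewrite ger0_norm; last by rewrite subr_ge0; exact: mono.
  rewrite ler_wpM2l//; first by rewrite subr_ge0; exact: mono.
  have rng k : (k <= (2 ^ n).*2)%N -> 0 <= t * (k%:R / 2 ^+ n.+1) <= T.
    rewrite -mul2n -expnS -(ler_nat R) natrX => hk.
    rewrite mulr_ge0 ?(ltW t0) ?divr_ge0 ?(ltW (p2 _))//=.
    apply: le_trans tT; rewrite ler_piMr ?(ltW t0)//.
    by rewrite ler_pdivrMr// mul1r.
  apply: (le_trans (hb _ _ (rng _ _) (rng _ _))) => //.
    exact: ltnW.
  rewrite (_ : t * (j.*2.+2%:R / 2 ^+ n.+1) - t * (j.*2.+1%:R / 2 ^+ n.+1) = h).
    by rewrite gtr0_norm.
  by rewrite /h -[j.*2.+2%:R]natr1 exprVn; ring.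
rewrite -mulr_suml mulrC -mulrA ler_wpM2l//.
apply: (@le_trans _ _ (h `^ g * h `^ (al - 1))).
  by rewrite ler_wpM2l ?powR_ge0// -last.
by rewrite -powRD ?addrA// gt_eqF// implybT.
Qed.

End pathwise_noise.

Section pathwise_noise_limit.
Context {R : realType}.
Variables (al g : R) (b : R -> R).
Hypotheses (al01 : 0 < al < 1) (g0 : 0 < g) (del0 : 0 < g + al - 1).
Hypothesis cb : continuous (fun t : R => b (Num.max 0 t)).
Hypothesis hb : forall T, 0 < T -> exists2 C, 0 <= C & forall s t,
  0 <= s <= T -> 0 <= t <= T -> `|b t - b s| <= C * `|t - s| `^ g.
Implicit Types t T : R.

Let del := g + al - 1.
Let rho := 2^-1 `^ del : R.

Let rho01 : 0 <= rho < 1.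
Proof.
rewrite powR_ge0 -[ltRHS](powRr0 2^-1) /rho /powR gt_eqF ?invr_gt0// ltr_expR.
by rewrite ltr_nM2r ?ln_lt0//; lra.
Qed.

Lemma noise_approx T : 0 < T -> exists2 C, 0 <= C &
  forall n t, 0 <= t <= T ->
    [/\ noise_sum al b ^~ t @ \oo --> noise al b t,
      `|noise al b t - noise_sum al b n t| <= C * t `^ del * rho ^+ n &
      `|noise al b t| <= C * t `^ del].
Proof.
move=> T0; have [C C0 hC] := hb T0; have /andP[r0 r1] := rho01.
have r1' : 0 < 1 - rho by rewrite subr_gt0.
(* The geometric tail, plus the level-0 sum t^(al - 1) (b t - b 0), itself at most C t^del. *)
exists (C * rho / (1 - rho) + C).
  by rewrite addr_ge0// divr_ge0 ?mulr_ge0// ltW.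
move=> n t t0T; have /andP[t0 tT] := t0T.
have step k := noise_increment_le k al01 g0 C0 hC t0T del0.
have K0 : 0 <= C * t `^ del * rho by rewrite !mulr_ge0// powR_ge0.
have cv : noise_sum al b ^~ t @ \oo --> noise al b t.
  have /cvg_ex[l hl] := geometric_increments_cvg rho01 K0 step.
  by rewrite /noise (fine_limsupE hl).
have lim k := geometric_increments_lim_le k rho01 K0 step cv.
have td0 : 0 <= t `^ del by exact: powR_ge0.
split => //.
- apply: le_trans (lim n) _.
  have -> : C * t `^ del * rho * rho ^+ n / (1 - rho) =
     C * rho / (1 - rho) * t `^ del * rho ^+ n by field; rewrite gt_eqF.
  by rewrite ler_wpM2r ?exprn_ge0// ler_wpM2r// lerDl.
- have S0 : `|noise_sum al b 0 t| <= C * t `^ del.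
    rewrite /noise_sum expn0 big_ord1/= expr0 !divr1 mulr0n mulr0 subr0 mulr1.
    move: t0; rewrite le_eqVlt => /predU1P[<-|t0].
      by rewrite subrr mulr0 normr0 mulr_ge0// powR_ge0.
    rewrite normrM (ger0_norm (powR_ge0 _ _)).
    apply: (@le_trans _ _ (t `^ (al - 1) * (C * t `^ g))).
      rewrite ler_wpM2l ?powR_ge0//.
      have := hC 0 t; rewrite subr0 (gtr0_norm t0); apply; first by rewrite lexx ltW.
      by rewrite (ltW t0).
    rewrite mulrCA -powRD; last by apply/implyP => _; rewrite gt_eqF.
    by rewrite /del (_ : al - 1 + g = g + al - 1)//; ring.
  rewrite -[noise al b t](subrK (noise_sum al b 0 t)).
  apply: (le_trans (ler_normD _ _)); rewrite mulrDl; apply: lerD => //.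
  apply: le_trans (lim 0%N) _; rewrite expr0 mulr1.
  by rewrite le_eqVlt; apply/orP; left; apply/eqP; field; rewrite gt_eqF.
Qed.

Lemma continuous_powR_gt0 (p x : R) : 0 < x -> {for x, continuous (fun y => y `^ p)}.
Proof.
move=> x0; have [D _] := is_derive1_powR p x0.
by apply/differentiable_continuous/derivable1_diffP.
Qed.

Let cmax : continuous (fun t : R => Num.max 0 t).
Proof. by move=> t; apply: (@continuous_max _ _ (cst (0 : R)) (fun t : R => t) t (cvg_cst _) cvg_id). Qed.

Lemma continuous_noise_sum n t : 0 < t ->
  {for t, continuous (fun t => noise_sum al b n (Num.max 0 t))}.
Proof.
move=> t0; rewrite /noise_sum.
have p2 k : 0 < (2 ^+ k : R) by rewrite exprn_gt0.
have m0 : Num.max 0 t = t by rewrite max_r// ltW.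
have cbc c : 0 <= c -> continuous (fun t : R => b (Num.max 0 t * c)).
  move=> c0 u.
  rewrite (_ : (fun t : R => _) = (fun t : R => b (Num.max 0 t)) \o (fun t => Num.max 0 t * c)).
    by apply: continuous_comp; [apply: cvgM; [exact: cmax|exact: cvg_cst]|exact: cb].
  by apply/funext => v /=; rewrite [in RHS]max_r// mulr_ge0// le_max lexx.
apply: cvg_big => [|j _]; first exact: add_continuous.
apply: cvgM.
  have jn : (j%:R / 2 ^+ n : R) < 1.
    by rewrite ltr_pdivrMr// mul1r -natrX ltr_nat.
  apply: (@continuous_comp _ _ _ (fun t : R => Num.max 0 t - Num.max 0 t * (j%:R / 2 ^+ n))
    (fun y => y `^ (al - 1))).
    by apply: cvgB; [exact: cmax|apply: cvgM; [exact: cmax|exact: cvg_cst]].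
  by apply: continuous_powR_gt0; rewrite m0 subr_gt0 gtr_pMr.
by apply: cvgB; apply: cbc; rewrite divr_ge0// ltW.
Qed.

(** At t > 0 it is a locally uniform limit of continuous sums. At 0 the kernel of the sums is not
    continuous, and the bound C t^del takes over. *)
Lemma continuous_noise : continuous (fun t : R => noise al b (Num.max 0 t)).
Proof.
move=> t; have [t0|t0] := ltP 0 t.
  have T0 : 0 < t + 1 by lra.
  have [C C0 hC] := noise_approx T0.
  pose K := C * (t + 1) `^ del.
  apply: (@uniform_limit_continuous_at _ _ (fun n t => noise_sum al b n (Num.max 0 t))).
  - move=> e e0; have /andP[r0 r1] := rho01.
    have : K * rho ^+ n @[n --> \oo] --> (0 : R) by apply: cvg_geometric; rewrite ger0_norm.
    move=> /cvgrPdist_lt/(_ _ e0)[n _ /(_ n (leqnn n))].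
    rewrite sub0r normrN => /(le_lt_trans (ler_norm _))/ltW hn; exists n.
    near=> u; have u1 : u < t + 1 by near: u; apply: lt_nbhsl; lra.
    have uT : 0 <= Num.max 0 u <= t + 1.
      by rewrite le_max lexx/= ge_max (ltW T0) ltW.
    have [_ /le_trans h _] := hC n _ uT; apply: h; apply: (le_trans _ hn).
    have /andP[u0 uT'] := uT.
    rewrite ler_wpM2r ?exprn_ge0// ler_wpM2l// ge0_ler_powR ?nnegrE ?(ltW del0)//.
    exact: ltW.
  - by move=> n; exact: continuous_noise_sum.
have [C C0 hC] := noise_approx (@ltr01 R).
have m0 : Num.max 0 t = 0 by rewrite max_l.
have n0 : noise al b 0 = 0.
  have /(_ 0%N 0)[] := hC; first by rewrite lexx ler01.
  have d0 : del != 0 by rewrite gt_eqF.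
  by rewrite (powR0 d0) mulr0 => _ _; rewrite normr_le0 => /eqP.
rewrite /prop_for /continuous_at m0 n0.
apply/norm_cvg0P; apply: (@squeeze_cvgr _ _ _ _ (cst 0) (fun u => C * `|Num.max 0 u| `^ del)).
- near=> u; rewrite normr_ge0/=.
  have u1 : u < 1 by near: u; apply: lt_nbhsl; lra.
  have uT : 0 <= Num.max 0 u <= 1 by rewrite le_max lexx/= ge_max ler01 ltW.
  have [_ _] := hC 0%N _ uT.
  by rewrite (@ger0_norm _ (Num.max 0 u))//; have /andP[] := uT.
- exact: cvg_cst.
- rewrite -[X in _ --> X](mulr0 C); apply: cvgM; first exact: cvg_cst.
  have h : {for t, continuous (fun u : R => `|Num.max 0 u| `^ del)}.
    apply: (@continuous_comp _ _ _ (fun u : R => Num.max 0 u) (fun z => `|z| `^ del)).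
      exact: cmax.
    exact: continuous_norm_powR.
  move: h; rewrite /prop_for /continuous_at m0 normr0 powR0//.
  by rewrite gt_eqF.
Unshelve. all: by end_near. Qed.

End pathwise_noise_limit.

(** * Uniqueness of the stochastic integral *)

Section integral_theory.
Context {R : realType} {d : measure_display} {Omega : measurableType d}.
Context (P : probability Omega R) (H : R) (B : R -> Omega -> R).
Hypothesis H12 : 2^-1 < H < 1.
Hypothesis hB : fractional_brownian_motion P H B.
Notation mu := (@lebesgue_measure R).
Implicit Types (t : R) (p : seq R) (a : nat -> R) (phi : R -> R).

Lemma itv_partition_nth t p i : 0 <= t -> itv_partition 0 t p -> (i < size p)%N ->
  0 <= nth 0 (0 :: p) i <= nth 0 p i /\ nth 0 p i <= t.
Proof.
move=> t0 pt ip; split.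
  apply/andP; split.
    have := @itv_partition_nth_ge _ _ 0 t p i (ltn_trans ip (ltnSn _)) pt.
    by rewrite (set_nth_default 0)//= ltnS ltnW.
  by case: pt => /(pathP 0)/(_ i ip) h _; exact: ltW.
have := @itv_partition_nth_le _ _ 0 t p i.+1 ip pt.
by rewrite (set_nth_default 0).
Qed.

Lemma measurable_step_integral t p a : 0 <= t -> itv_partition 0 t p ->
  measurable_fun setT (step_integral B p a).
Proof.
move=> t0 pt; apply: measurable_sum => i; apply: measurable_funM => //.
have [/andP[h1 h2] _] := itv_partition_nth t0 pt (ltn_ord i).
by apply: (measurable_fbmB hB) => //; exact: le_trans h2.
Qed.

Lemma measurable_step_fun p a D : measurable_fun D (step_fun p a).
Proof.
apply: measurable_funTS; apply: measurable_sum => i.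
by apply: measurable_funM => //; exact: measurable_indic.
Qed.

(** The two families of intervals are concatenated, with the second coefficients negated; as
    overlaps are allowed, no common refinement is formed. *)
Lemma step_integral_dist_le t p p' a a' (N : R) : 0 <= t ->
  itv_partition 0 t p -> itv_partition 0 t p' -> 0 <= N ->
  (\int[mu]_(s in `[0%R, t]) (`|step_fun p a s - step_fun p' a' s| `^ H^-1)%:E <= N%:E)%E ->
  (\int[P]_w ((step_integral B p a w - step_integral B p' a' w) ^+ 2)%:E <=
   (ito_bound H N)%:E)%E.
Proof.
move=> t0 pt pt' N0 hN; have /andP[H1 H2] := H12.
pose aa (i : 'I_(size p + size p')) : R :=
  match fintype.split i with inl j => a j | inr k => - a' k end.
pose xx (i : 'I_(size p + size p')) : R :=
  match fintype.split i with inl j => nth 0 (0 :: p) j | inr k => nth 0 (0 :: p') k end.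
pose yy (i : 'I_(size p + size p')) : R :=
  match fintype.split i with inl j => nth 0 p j | inr k => nth 0 p' k end.
have E1 w : step_integral B p a w - step_integral B p' a' w =
    \sum_(i < size p + size p') aa i * (B (yy i) w - B (xx i) w).
  rewrite big_split_ord/= /step_integral -sumrN; congr (_ + _).
    by apply: eq_bigr => j _; rewrite /aa /xx /yy (unsplitK (inl j)).
  by apply: eq_bigr => j _; rewrite /aa /xx /yy (unsplitK (inr j)) mulNr.
have E2 s : step_fun p a s - step_fun p' a' s =
    \sum_(i < size p + size p') aa i * \1_`]xx i, yy i] s.
  rewrite big_split_ord/= /step_fun -sumrN; congr (_ + _).
    by apply: eq_bigr => j _; rewrite /aa /xx /yy (unsplitK (inl j)).
  by apply: eq_bigr => j _; rewrite /aa /xx /yy (unsplitK (inr j)) mulNr.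
have xy i : 0 <= xx i <= yy i.
  rewrite /xx /yy; case: (fintype.split i) => j.
    by have [] := itv_partition_nth t0 pt (ltn_ord j).
  by have [] := itv_partition_nth t0 pt' (ltn_ord j).
have yt i : yy i <= t.
  rewrite /yy; case: (fintype.split i) => j.
    by have [] := itv_partition_nth t0 pt (ltn_ord j).
  by have [] := itv_partition_nth t0 pt' (ltn_ord j).
under eq_integral do rewrite E1.
apply: (@integral_step_sqr_le _ _ _ P H B H12 hB _ aa xx yy N xy N0).
apply: le_trans hN; rewrite [leRHS]integral_mkcond.
rewrite le_eqVlt; apply/orP; left; apply/eqP; apply: eq_integral => s _.
rewrite patchE -E2; case: ifPn => // /negP st.
rewrite E2 big1 ?normr0 ?powR0 ?invr_eq0 ?gt_eqF//; first by lra.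
move=> i _; rewrite indicE memNset ?mulr0// /= in_itv/= => /andP[s1 s2].
apply: st; rewrite inE/= in_itv/=; have /andP[x0 _] := xy i.
by rewrite (le_trans x0 (ltW s1)) (le_trans s2).
Qed.

Lemma powR_dist_le (q x y : R) : 0 < q ->
  `|x - y| `^ q <= 2 `^ q * (`|x| `^ q + `|y| `^ q).
Proof.
move=> q0; wlog xy : x y / `|x| <= `|y|.
  move=> hw; have [|/ltW] := leP `|x| `|y|; first exact: hw.
  by rewrite distrC (addrC (`|x| `^ q)); exact: hw.
apply: (@le_trans _ _ ((2 * `|y|) `^ q)).
  rewrite ge0_ler_powR ?nnegrE ?(ltW q0) ?mulr_ge0//.
  by apply: (le_trans (ler_normB _ _)); lra.
by rewrite powRM// ler_wpM2l ?powR_ge0// lerDr powR_ge0.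
Qed.

Lemma integral_powR_dist_le t (f g h : R -> R) (M N : R) :
  measurable_fun `[0, t] f -> measurable_fun `[0, t] g -> measurable_fun `[0, t] h ->
  (\int[mu]_(s in `[0%R, t]) (`|f s - h s| `^ H^-1)%:E <= M%:E)%E ->
  (\int[mu]_(s in `[0%R, t]) (`|g s - h s| `^ H^-1)%:E <= N%:E)%E ->
  (\int[mu]_(s in `[0%R, t]) (`|f s - g s| `^ H^-1)%:E <=
    (2 `^ H^-1 * (M + N))%:E)%E.
Proof.
move=> mf mg mh hM hN; have /andP[H1 H2] := H12.
have q0 : 0 < H^-1 by rewrite invr_gt0; lra.
have mp (u v : R -> R) : measurable_fun `[0, t] u -> measurable_fun `[0, t] v ->
    measurable_fun `[0, t] (fun s => `|u s - v s| `^ H^-1).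
  move=> mu' mv; apply: (measurableT_comp (measurable_powR _)).
  by apply: measurableT_comp => //; exact: measurable_funB.
apply: (@le_trans _ _ (\int[mu]_(s in `[0%R, t])
    (2 `^ H^-1 * (`|f s - h s| `^ H^-1 + `|g s - h s| `^ H^-1))%:E)%E).
  apply: ge0_le_integral_fin => //.
  - exact: mp.
  - by apply: measurable_funM => //; apply: measurable_funD; exact: mp.
  - move=> s _; rewrite (_ : f s - g s = (f s - h s) - (g s - h s)); last by ring.
    exact: powR_dist_le.
have mfh := mp f h mf mh; have mgh := mp g h mg mh.
have S0 s : 0 <= `|f s - h s| `^ H^-1 + `|g s - h s| `^ H^-1.
  by rewrite addr_ge0 ?powR_ge0.
have -> := ge0_integralZl_fin mu (measurable_itv _) (measurable_funD mfh mgh)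
  (fun s _ => S0 s) (powR_ge0 2 H^-1).
have -> := ge0_integralD_fin mu (measurable_itv _) mfh mgh
  (fun s _ => powR_ge0 _ _) (fun s _ => powR_ge0 _ _).
by rewrite [leRHS]EFinM lee_wpmul2l ?lee_fin ?powR_ge0// EFinD leeD.
Qed.

Lemma ito_bound_cvg (e : R) : 0 < e ->
  exists2 del : R, 0 < del & forall N, 0 <= N <= del -> ito_bound H N <= e.
Proof.
move=> e0; have /andP[H1 H2] := H12.
have hc : 0 < hls_const H by rewrite /hls_const addr_gt0 ?divr_gt0 ?mulr_gt0//; lra.
pose K := H * (2 * H - 1) * (2 * hls_const H + H).
have K0 : 0 < K.
  by apply: mulr_gt0; [apply: mulr_gt0; lra|apply: addr_gt0; lra].
(* For N <= 1 the quadratic term is absorbed by the linear one. *)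
exists (Num.min 1 (e / K)); first by rewrite lt_min ltr01 divr_gt0.
move=> N /andP[N0]; rewrite le_min => /andP[N1 Ne].
apply: (@le_trans _ _ (K * N)); last by rewrite mulrC -ler_pdivlMr.
rewrite /ito_bound /K -[leRHS]mulrA ler_wpM2l//; first by rewrite mulr_ge0; lra.
have h : H * N ^+ 2 <= H * N by rewrite ler_wpM2l ?expr2 ?ler_piMr//; lra.
by rewrite [leRHS]mulrDl; lra.
Qed.

End integral_theory.

Lemma cvge0_le (R : realType) (u : nat -> \bar R) (e : R) : 0 < e ->
  u @ \oo --> 0%E -> exists N, forall n, (N <= n)%N -> (u n <= e%:E)%E.
Proof.
move=> e0 /fine_cvgP[[N1 _ h1] /cvgrPdist_lt/(_ e e0)[N2 _ h2]].
exists (maxn N1 N2) => n; rewrite geq_max => /andP[n1 n2].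
have := h2 n n2; rewrite sub0r normrN /= => h.
by rewrite -(fineK (h1 n n1)) lee_fin (le_trans (ler_norm _))// ltW.
Qed.

Lemma measurable_fun_limn_einf d (T : measurableType d) (R : realType) (D : set T)
    (f : (T -> \bar R)^nat) : (forall n, measurable_fun D (f n)) ->
  measurable_fun D (fun x => limn_einf (f^~ x)).
Proof.
move=> mf; apply: (measurableT_comp (f := -%E)) => //.
by apply: measurable_fun_limn_esup => n; apply: measurableT_comp.
Qed.

Lemma limn_einf_ge0 (R : realType) (u : (\bar R)^nat) :
  (forall n, 0 <= u n)%E -> (0 <= limn_einf u)%E.
Proof.
move=> u0; rewrite limn_einf_lim; apply: lime_ge; first exact: is_cvg_einfs.
by apply: nearW => n; apply: le_ereal_inf_tmp => _ [m _ <-].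
Qed.

Section integral_uniqueness.
Context {R : realType} {d : measure_display} {Omega : measurableType d}.
Context (P : probability Omega R) (H : R) (B : R -> Omega -> R).
Hypothesis H12 : 2^-1 < H < 1.
Hypothesis hB : fractional_brownian_motion P H B.
Notation mu := (@lebesgue_measure R).
Implicit Types (t : R) (phi : R -> R) (Y : Omega -> R).

(** With two different sequences this gives uniqueness of the integral, with the same one twice the
    Cauchy property in L^2. *)
Lemma step_integrals_close t phi (p p' : nat -> seq R) (a a' : nat -> nat -> R) (e : R) :
  0 <= t -> measurable_fun `[0, t] phi -> 0 < e ->
  (forall n, itv_partition 0 t (p n)) -> (forall n, itv_partition 0 t (p' n)) ->
  (fun n => \int[mu]_(s in `[0%R, t]) (`|step_fun (p n) (a n) s - phi s| `^ H^-1)%:E)%E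
    @ \oo --> 0%E ->
  (fun n => \int[mu]_(s in `[0%R, t]) (`|step_fun (p' n) (a' n) s - phi s| `^ H^-1)%:E)%E
    @ \oo --> 0%E ->
  exists N, forall n m, (N <= n)%N -> (N <= m)%N ->
    (\int[P]_w ((step_integral B (p n) (a n) w - step_integral B (p' m) (a' m) w) ^+ 2)%:E
      <= e%:E)%E.
Proof.
move=> t0 mphi e0 pt pt' cp cp'.
have [del del0 hdel] := ito_bound_cvg H12 e0.
have q0 : 0 < 2 `^ H^-1 :> R by exact: powR_gt0.
pose eta := del / (2 `^ H^-1 * 2).
have eta0 : 0 < eta by rewrite divr_gt0// mulr_gt0.
have [N1 h1] := cvge0_le eta0 cp; have [N2 h2] := cvge0_le eta0 cp'.
exists (maxn N1 N2) => n m; rewrite !geq_max => /andP[n1 _] /andP[_ m2].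
have ms1 : measurable_fun `[0, t] (step_fun (p n) (a n)) by exact: measurable_step_fun.
have ms2 : measurable_fun `[0, t] (step_fun (p' m) (a' m)) by exact: measurable_step_fun.
have := integral_powR_dist_le H12 ms1 ms2 mphi (h1 n n1) (h2 m m2).
have -> : 2 `^ H^-1 * (eta + eta) = del by rewrite /eta; field; rewrite gt_eqF.
move=> /(step_integral_dist_le H12 hB t0 (pt n) (pt' m) (ltW del0)) /le_trans; apply.
by rewrite lee_fin hdel// (ltW del0) lexx.
Qed.

Lemma measurable_sqrB (X Y : Omega -> R) : measurable_fun setT X -> measurable_fun setT Y ->
  measurable_fun setT (fun w => (X w - Y w) ^+ 2).
Proof. by move=> mX mY; apply: measurable_funX; exact: measurable_funB. Qed.

Lemma sqrB3_le (x y z u : R) :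
  (x - u) ^+ 2 <= 3 * ((y - x) ^+ 2 + (y - z) ^+ 2 + (z - u) ^+ 2).
Proof.
set b := y - x; set c := y - z; set e := z - u.
have -> : x - u = - b + c + e by rewrite /b /c /e; ring.
have h1 := sqr_ge0 (b + c); have h2 := sqr_ge0 (b + e); have h3 := sqr_ge0 (c - e).
by move: h1 h2 h3; rewrite !expr2; nra.
Qed.

Lemma is_integral_unique t phi Y Y' : 0 <= t ->
  is_integral P H B t phi Y -> is_integral P H B t phi Y' ->
  {ae P, forall w, Y w = Y' w}.
Proof.
move=> t0 [mphi _ mY [p [a [pt cp cY]]]] [_ _ mY' [p' [a' [pt' cp' cY']]]].
have mS n := measurable_step_integral hB (a n) t0 (pt n).
have mS' n := measurable_step_integral hB (a' n) t0 (pt' n).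
have D0 : (\int[P]_w ((Y w - Y' w) ^+ 2)%:E <= 0)%E.
  apply/lee_addgt0Pr => e e0; rewrite add0e.
  (* Three terms, times the factor 3 of [sqrB3_le]. *)
  have e9 : 0 < e / 9 by rewrite divr_gt0.
  have [N1 h1] := step_integrals_close t0 mphi e9 pt pt' cp cp'.
  have [N2 h2] := cvge0_le e9 cY; have [N3 h3] := cvge0_le e9 cY'.
  pose n := maxn N1 (maxn N2 N3).
  have n1 : (N1 <= n)%N by exact: leq_maxl.
  have n2 : (N2 <= n)%N by rewrite /n !leq_max leqnn orbT.
  have n3 : (N3 <= n)%N by rewrite /n !leq_max leqnn !orbT.
  have {}h1 := h1 n n n1 n1; have {}h2 := h2 n n2; have {}h3 := h3 n n3.
  rewrite unlock in h2 h3.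
  set S := step_integral B (p n) (a n) in h1 h2.
  set S' := step_integral B (p' n) (a' n) in h1 h3.
  have m1 := measurable_sqrB (mS n) mY; have m2 := measurable_sqrB (mS n) (mS' n).
  have m3 := measurable_sqrB (mS' n) mY'.
  apply: (@le_trans _ _ (\int[P]_w (3 * ((S w - Y w) ^+ 2 + (S w - S' w) ^+ 2 + (S' w - Y' w) ^+ 2))%:E)%E).
    apply: ge0_le_integral_fin => //.
    - exact: measurable_sqrB.
    - by apply: measurable_funM => //; apply: measurable_funD => //; exact: measurable_funD.
    - by move=> w _; exact: sqr_ge0.
    - by move=> w _; exact: sqrB3_le.
  have p12 w : 0 <= (S w - Y w) ^+ 2 + (S w - S' w) ^+ 2 by rewrite addr_ge0 ?sqr_ge0.
  have p123 w : 0 <= (S w - Y w) ^+ 2 + (S w - S' w) ^+ 2 + (S' w - Y' w) ^+ 2.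
    by rewrite !addr_ge0 ?sqr_ge0.
  have -> := ge0_integralZl_fin P measurableT (measurable_funD (measurable_funD m1 m2) m3)
    (fun w _ => p123 w) (ler0n R 3).
  have -> := ge0_integralD_fin P measurableT (measurable_funD m1 m2) m3
    (fun w _ => p12 w) (fun w _ => sqr_ge0 _).
  have -> := ge0_integralD_fin P measurableT m1 m2
    (fun w _ => sqr_ge0 _) (fun w _ => sqr_ge0 _).
  apply: (@le_trans _ _ (3%:E * ((e / 9)%:E + (e / 9)%:E + (e / 9)%:E))%E).
    by rewrite lee_wpmul2l ?lee_fin// !leeD.
  by rewrite -!EFinD -EFinM lee_fin; lra.
have mD : measurable_fun setT (fun w => ((Y w - Y' w) ^+ 2)%:E).
  by apply/measurable_EFinP; exact: measurable_sqrB.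
have D00 : (\int[P]_w ((Y w - Y' w) ^+ 2)%:E = 0)%E.
  by apply/eqP; rewrite eq_le D0 integral_ge0// => w _; rewrite lee_fin sqr_ge0.
have := (ae_eq_integral_abs P measurableT mD).1 _.
rewrite /ae_eq => h; have {}h := h _.
have : (\int[P]_w `|((Y w - Y' w) ^+ 2)%:E| = 0)%E.
  by under eq_integral do rewrite /= ger0_norm ?sqr_ge0//.
move=> /h; apply: filterS => w /(_ I)/= [] /eqP.
by rewrite sqrf_eq0 subr_eq0 => /eqP.
Qed.

(** The step integrals are Cauchy in L^2; Fatou's lemma in the second index passes the Cauchy bound
    to the almost sure limit [Y]. *)
Lemma is_integral_of_ae_cvg t phi (p : nat -> seq R) (a : nat -> nat -> R) Y :
  0 <= t -> measurable_fun `[0, t] phi ->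
  (\int[mu]_(s in `[0%R, t]) (`|phi s| `^ H^-1)%:E < +oo)%E ->
  measurable_fun setT Y -> (forall n, itv_partition 0 t (p n)) ->
  (fun n => \int[mu]_(s in `[0%R, t]) (`|step_fun (p n) (a n) s - phi s| `^ H^-1)%:E)%E
    @ \oo --> 0%E ->
  {ae P, forall w, (fun n => step_integral B (p n) (a n) w) @ \oo --> Y w} ->
  is_integral P H B t phi Y.
Proof.
move=> t0 mphi iphi mY pt cp cY; split => //; exists p, a; split => //.
have mS n := measurable_step_integral hB (a n) t0 (pt n).
pose S n := step_integral B (p n) (a n).
have key e : 0 < e -> exists N, forall n, (N <= n)%N ->
    (\int[P]_w ((S n w - Y w) ^+ 2)%:E <= e%:E)%E.
  move=> e0; have [N hN] := step_integrals_close t0 mphi e0 pt pt cp cp.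
  exists N => n Nn.
  pose f m w := ((S n w - S (N + m)%N w) ^+ 2)%:E.
  have mf m : measurable_fun setT (f m).
    by apply/measurable_EFinP; apply: measurable_sqrB; exact: mS.
  have f0 m w : (0 <= f m w)%E by rewrite lee_fin sqr_ge0.
  have -> : (\int[P]_w ((S n w - Y w) ^+ 2)%:E = \int[P]_w limn_einf (f^~ w))%E.
    apply: ge0_ae_eq_integral => //.
    - by apply/measurable_EFinP; apply: measurable_sqrB => //; exact: mS.
    - exact: measurable_fun_limn_einf.
    - by move=> w _; rewrite lee_fin sqr_ge0.
    - by move=> w _; exact: limn_einf_ge0.
    apply: filterS cY => w cw _.
    have cf : f^~ w @ \oo --> ((S n w - Y w) ^+ 2)%:E.
      apply: cvg_EFin; first exact: nearW.
      rewrite /f /comp /= expr2; under eq_fun do rewrite expr2.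
      have cB' : (fun m => S n w - S (N + m)%N w) @ \oo --> S n w - Y w.
        apply: cvgB; first exact: cvg_cst.
        exact: (cvg_comp (addn N) (fun n => S n w) (cvg_addnl N) cw).
      by apply: cvgM.
    by rewrite is_cvg_limn_einfE; [rewrite (cvg_lim _ cf)|apply/cvg_ex; eexists; exact: cf].
  apply: (le_trans (fatou P measurableT mf (fun m w _ => f0 m w))).
  rewrite limn_einf_lim; apply: lime_le; first exact: is_cvg_einfs.
  apply: nearW => m; apply: (@le_trans _ _ (\int[P]_w f m w)%E).
    by apply: ereal_inf_lbound; exists m => /=.
  by apply: hN => //; exact: leq_addr.
rewrite unlock; apply/fine_cvgP.
have [N0 h0] := key 1 ltr01.
have fin n : (N0 <= n)%N -> (\int[P]_w ((S n w - Y w) ^+ 2)%:E)%E \is a fin_num.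
  move=> /h0 h; rewrite ge0_fin_numE; first by rewrite (le_lt_trans h)// ltry.
  by apply: integral_ge0 => w _; rewrite lee_fin sqr_ge0.
split; first by exists N0 => // n /=; exact: fin.
apply/cvgrPdist_lt => e e0; have e2 : 0 < e / 2 by rewrite divr_gt0.
have [N hN] := key _ e2; exists (maxn N0 N) => // n /=; rewrite geq_max => /andP[n1 n2].
rewrite sub0r normrN ger0_norm; last first.
  by rewrite fine_ge0// integral_ge0// => w _; rewrite lee_fin sqr_ge0.
rewrite -lte_fin fineK ?fin//; apply: (le_lt_trans (hN n n2)).
by rewrite lte_fin; lra.
Qed.

End integral_uniqueness.

(** * The noise as a stochastic integral *)

Lemma within_time_domain_continuous (R : realType) (T : \bar R) (f : R -> R) :
  continuous (fun t : R => f (Num.max 0 t)) -> {within time_domain T, continuous f}.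
Proof.
move=> cf; apply/subspace_continuousP => x [x0 xT].
have mx : Num.max 0 x = x by rewrite max_r.
have cx : f (Num.max 0 y) @[y --> within (time_domain T) (nbhs x)] --> f x.
  apply: cvg_within_filter; have := cf x; rewrite /continuous_at mx; exact.
apply: cvg_trans cx; apply: near_eq_cvg; near=> y.
have [y0 _] : time_domain T y by near: y; exact: withinT.
by rewrite max_r.
Unshelve. all: by end_near. Qed.

Lemma measurable_fine_limsup d (T : measurableType d) (R : realType)
    (f : nat -> T -> R) : (forall n, measurable_fun setT (f n)) ->
  measurable_fun setT (fun w => fine_limsup (f^~ w)).
Proof.
move=> mf; apply: (measurableT_comp (f := fine)); first exact: fine_measurable.
by apply: measurable_fun_limn_esup => n; apply/measurable_EFinP.
Qed.

(** * Dyadic step functions approximating the kernel *)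

Section dyadic_step_functions.
Context {R : realType}.
Notation mu := (@lebesgue_measure R).
Implicit Types (al t s H : R).

Definition dyadic_partition t n : seq R :=
  [seq t * (j.+1%:R / 2 ^+ n) | j <- iota 0 (2 ^ n)].

Definition noise_coef al t n j : R := (t - t * (j%:R / 2 ^+ n)) `^ (al - 1).

Lemma size_dyadic_partition t n : size (dyadic_partition t n) = (2 ^ n)%N.
Proof. by rewrite size_map size_iota. Qed.

Lemma nth_dyadic_partition t n j : (j < 2 ^ n)%N ->
  nth 0 (dyadic_partition t n) j = t * (j.+1%:R / 2 ^+ n).
Proof. by move=> jn; rewrite (nth_map 0%N) ?size_iota// nth_iota. Qed.

Lemma nth_dyadic_partition0 t n j : (j <= 2 ^ n)%N ->
  nth 0 (0 :: dyadic_partition t n) j = t * (j%:R / 2 ^+ n).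
Proof.
case: j => [|j] jn /=; first by rewrite mulr0n mul0r mulr0.
exact: nth_dyadic_partition.
Qed.

Lemma itv_partition_dyadic t n : 0 < t -> itv_partition 0 t (dyadic_partition t n).
Proof.
move=> t0; have p2 : 0 < (2 ^+ n : R) by rewrite exprn_gt0.
split.
  apply/(pathP 0) => j; rewrite size_dyadic_partition => jn.
  rewrite nth_dyadic_partition0 ?(ltnW jn)// nth_dyadic_partition//.
  by rewrite ltr_pM2l// ltr_pM2r ?invr_gt0// ltr_nat.
rewrite -nth_last size_dyadic_partition (set_nth_default 0) ?size_dyadic_partition; last first.
  by rewrite prednK// expn_gt0.
rewrite nth_dyadic_partition; last by rewrite prednK// expn_gt0.
by rewrite prednK ?expn_gt0// natrX divff ?mulr1// gt_eqF.
Qed.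

Lemma step_integral_dyadic d (Omega : measurableType d) (B : R -> Omega -> R) al t n w :
  step_integral B (dyadic_partition t n) (noise_coef al t n) w =
  noise_sum al (B^~ w) n t.
Proof.
rewrite /step_integral /noise_sum size_dyadic_partition; apply: eq_bigr => j _.
by rewrite nth_dyadic_partition// nth_dyadic_partition0// ltnW.
Qed.

Lemma step_fun_dyadic (a : nat -> R) t n s : 0 < t -> 0 < s <= t ->
  exists j : nat, [/\ t * (j%:R / 2 ^+ n) < s, s <= t * (j.+1%:R / 2 ^+ n) &
    step_fun (dyadic_partition t n) a s = a j].
Proof.
move=> t0 /andP[s0 st]; have p2 : 0 < (2 ^+ n : R) by rewrite exprn_gt0.
have ex : exists k, s <= t * (k%:R / 2 ^+ n).
  by exists (2 ^ n)%N; rewrite natrX divff ?mulr1// gt_eqF.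
case: (ex_minnP ex) => -[|k] sk kmin.
  by move: sk; rewrite mulr0n mul0r mulr0 leNgt s0.
have kn : (k < 2 ^ n)%N by apply: kmin; rewrite natrX divff ?mulr1// gt_eqF.
have ks : t * (k%:R / 2 ^+ n) < s by rewrite ltNge; apply/negP => /kmin; rewrite ltnn.
exists k; split => //.
rewrite /step_fun size_dyadic_partition (bigD1 (Ordinal kn))//= big1 => [|i ik].
  rewrite addr0 nth_dyadic_partition// nth_dyadic_partition0 ?(ltnW kn)//.
  by rewrite indicE mem_set ?mulr1//= in_itv/= ks sk.
rewrite nth_dyadic_partition// nth_dyadic_partition0 ?(ltnW (ltn_ord i))//.
rewrite indicE memNset ?mulr0//= in_itv/= => /andP[h1 h2].
have mono (k1 k2 : nat) : (k1 <= k2)%N -> t * (k1%:R / 2 ^+ n) <= t * (k2%:R / 2 ^+ n).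
  by move=> k12; rewrite ler_pM2l// ler_pM2r ?invr_gt0// ler_nat.
case: (ltngtP i k) => [lik|lki|E].
- by have := mono _ _ lik; lra.
- by have := mono _ _ lki; lra.
- by move/negP: ik; apply; apply/eqP/val_inj.
Qed.

Lemma integral_cc_oo t (f : R -> R) : 0 < t -> measurable_fun `[0, t] f ->
  (\int[mu]_(s in `[0%R, t]) (f s)%:E = \int[mu]_(s in `]0%R, t[) (f s)%:E)%E.
Proof.
move=> t0 mf; apply: integral_itv_bndoo.
apply/measurable_EFinP; apply: measurable_funS mf => //.
by move=> s /=; rewrite !in_itv/= => /andP[/ltW -> /ltW ->].
Qed.

Lemma measurable_kernel al t D : measurable_fun D (fun s : R => (t - s) `^ (al - 1)).
Proof.
apply: measurable_funTS; apply: (measurableT_comp (measurable_powR _)).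
exact: measurable_funB.
Qed.

Lemma integral_kernel (b t : R) : 0 < b -> 0 <= t ->
  (\int[mu]_(s in `]0%R, t[) ((t - s) `^ (b - 1))%:E = (t `^ b / b)%:E)%E.
Proof.
move=> b0 t0.
transitivity (\int[mu]_(s in `]0%R, t[) (`|s - t| `^ (b - 1))%:E)%E.
  apply: eq_integral => s; rewrite inE/= in_itv/= => /andP[_ st].
  by rewrite distrC gtr0_norm// subr_gt0.
rewrite integral_norm_powR// subrr sub0r spowRN opprK !spowR_ge0//.
by rewrite powR0 ?add0r// gt_eqF.
Qed.

Section Lp.
Variables (H al t : R).
Hypotheses (H01 : 0 < H < 1) (halpha : 1 - H < al < 1) (t0 : 0 < t).

Let q0 : 0 < H^-1. Proof. by rewrite invr_gt0; have /andP[] := H01. Qed.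
Let phi s : R := (t - s) `^ (al - 1).

(** The exponent (al - 1)/H exceeds -1 exactly because al > 1 - H. *)
Let phiq_lty : (\int[mu]_(s in `]0%R, t[) (`|phi s| `^ H^-1)%:E < +oo)%E.
Proof.
have /andP[H0 H1] := H01; have /andP[a0 a1] := halpha.
have b0 : 0 < 1 + (al - 1) / H.
  have : - 1 < (al - 1) / H by rewrite ltr_pdivlMr//; lra.
  by lra.
have := integral_kernel b0 (ltW t0).
rewrite (_ : 1 + (al - 1) / H - 1 = (al - 1) / H); last by ring.
rewrite (_ : \int[mu]_(s in `]0%R, t[) (`|phi s| `^ H^-1)%:E =
  \int[mu]_(s in `]0%R, t[) ((t - s) `^ ((al - 1) / H))%:E)%E.
  by move=> ->; rewrite ltry.
by apply: eq_integral => s _; rewrite ger0_norm ?powR_ge0// /phi powRrM.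
Qed.

Let mphiq : measurable_fun `[0, t] (fun s => `|phi s| `^ H^-1).
Proof.
apply: (measurableT_comp (measurable_powR _)); apply: measurableT_comp => //.
exact: measurable_kernel.
Qed.

Lemma kernel_Lp : (\int[mu]_(s in `[0%R, t]) (`|phi s| `^ H^-1)%:E < +oo)%E.
Proof. by rewrite integral_cc_oo. Qed.

(** Dominated convergence on ]0, t[: the kernel increases in s, so its left-point values lie below
    it and the error is at most [phi]. *)
Lemma step_fun_kernel_cvg : (fun n => \int[mu]_(s in `[0%R, t])
  (`|step_fun (dyadic_partition t n) (noise_coef al t n) s - phi s| `^ H^-1)%:E)%E
    @ \oo --> 0%E.
Proof.
pose st n s := step_fun (dyadic_partition t n) (noise_coef al t n) s.
have mst n : measurable_fun `[0, t] (fun s => `|st n s - phi s| `^ H^-1).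
  apply: (measurableT_comp (measurable_powR _)); apply: measurableT_comp => //.
  by apply: measurable_funB; [exact: measurable_step_fun|exact: measurable_kernel].
under eq_fun => n do rewrite (integral_cc_oo t0 (mst n)).
have sub : `]0, t[ `<=` `[0, t].
  by move=> s /=; rewrite !in_itv/= => /andP[/ltW -> /ltW ->].
suff h : (fun n => \int[mu]_(s in `]0%R, t[) (`|st n s - phi s| `^ H^-1)%:E)%E
    @ \oo --> (\int[mu]_(s in `]0%R, t[) (cst 0%E s))%E.
  by move: h; rewrite integral0.
apply: (@dominated_cvg _ _ _ mu `]0, t[ _ (fun n s => (`|st n s - phi s| `^ H^-1)%:E)
  (cst 0%E) (fun s => (`|phi s| `^ H^-1)%:E)) => //.
- by move=> n; apply/measurable_EFinP; exact: measurable_funS (mst n).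
- move=> s; rewrite /= in_itv/= => /andP[s0 s1].
  have sst : 0 < s <= t by rewrite s0 ltW.
  have /choice[j hj] := fun n => step_fun_dyadic (noise_coef al t n) n t0 sst.
  pose tau n : R := t * ((j n)%:R / 2 ^+ n).
  have ctau : tau @ \oo --> s.
    apply: (@squeeze_cvgr _ _ _ _ (fun n => s - t * (1 / 2) ^+ n) (cst s)).
    + apply: nearW => n; have [h1 h2 _] := hj n; rewrite /tau (ltW h1) andbT.
      move: h2; rewrite -natr1 mulrDl mulrDr expr_div_n expr1n; lra.
    + rewrite -[X in _ --> X]subr0; apply: cvgB; first exact: cvg_cst.
      by apply: cvg_geometric; rewrite ger0_norm; lra.
    + exact: cvg_cst.
  apply: cvg_EFin; first exact: nearW.
  have cst' : (fun n => st n s) @ \oo --> phi s.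
    have -> : (fun n => st n s) = (fun n => (t - tau n) `^ (al - 1)).
      by apply/funext => n; rewrite /st; have [_ _ ->] := hj n.
    apply: (cvg_comp (fun n => t - tau n) (fun y => y `^ (al - 1)) (G := nbhs (t - s))).
      by apply: cvgB => //; exact: cvg_cst.
    by apply: continuous_powR_gt0; rewrite subr_gt0.
  have c0 : (fun n => `|st n s - phi s|) @ \oo --> (0 : R).
    apply/norm_cvg0P.
    have h : (fun n => st n s - phi s) @ \oo --> phi s - phi s.
      by apply: cvgB => //; exact: cvg_cst.
    by rewrite subrr in h; exact: h.
  have := continuous_norm_powR q0 (x := 0).
  rewrite /continuous_at normr0 powR0 ?gt_eqF// => cp.
  have := cvg_comp _ _ c0 cp.
  apply: cvg_trans; apply: near_eq_cvg; apply: nearW => n.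
  by rewrite /= normr_id.
- apply/integrableP; split.
    by apply/measurable_EFinP; exact: measurable_funS mphiq.
  by under eq_integral do rewrite /= (ger0_norm (powR_ge0 _ _)).
- move=> n s; rewrite /= in_itv/= => /andP[s0 s1].
  rewrite lee_fin ger0_norm ?powR_ge0//.
  have sst : 0 < s <= t by rewrite s0 ltW.
  have [j [h1 h2 E]] := step_fun_dyadic (noise_coef al t n) n t0 sst.
  rewrite ge0_ler_powR ?nnegrE ?(ltW q0)// /st E /phi /noise_coef.
  rewrite (ger0_norm (powR_ge0 _ _)) ler0_norm.
    by rewrite opprB lerBlDr lerDl powR_ge0.
  rewrite subr_le0 /powR !gt_eqF ?subr_gt0//; last exact: lt_trans s1.
  rewrite ler_expR ler_nM2l; last by have /andP[] := halpha; lra.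
  by rewrite ler_ln ?posrE ?subr_gt0//; [lra|exact: lt_trans s1].
Qed.

End Lp.
End dyadic_step_functions.

Section fractional_noise_theory.
Context {R : realType} {d : measure_display} {Omega : measurableType d}.
Context (P : probability Omega R) (H al : R) (B : R -> Omega -> R).
Hypothesis H12 : 2^-1 < H < 1.
Hypothesis halpha : 1 - H < al < 1.
Hypothesis hB : fractional_brownian_motion P H B.

(** Stated over an arbitrary measurable space, so that it applies to Omega with its own
    sigma-algebra and with the history up to a given time. *)
Lemma measurable_noise d' (T : measurableType d') (X : R -> T -> R) (t : R) : 0 <= t ->
  (forall s, 0 <= s <= t -> measurable_fun setT (X s)) ->
  measurable_fun setT (fun w => noise al (X^~ w) t).
Proof.
move=> t0 mX; apply: measurable_fine_limsup => n.
have p2 : 0 < (2 ^+ n : R) by rewrite exprn_gt0.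
apply: measurable_sum => j; apply: measurable_funM => //.
have rng k : (k <= 2 ^ n)%N -> 0 <= t * (k%:R / 2 ^+ n) <= t.
  move=> kn; rewrite mulr_ge0 ?divr_ge0 ?(ltW p2)//= ler_piMr//.
  by rewrite ler_pdivrMr// mul1r -natrX ler_nat.
by apply: measurable_funB; apply: mX; apply: rng => //; exact: ltnW.
Qed.

Lemma ae_noise : {ae P, forall w,
  continuous (fun t : R => noise al (B^~ w) (Num.max 0 t)) /\
  forall t, 0 <= t -> noise_sum al (B^~ w) ^~ t @ \oo --> noise al (B^~ w) t}.
Proof.
have /andP[H1 H2] := H12; have /andP[a1 a2] := halpha.
(* The midpoint of 1 - al and H: below H for Hoelder paths, above 1 - al for convergence of the
   noise sums. *)
pose g := (H + (1 - al)) / 2.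
have g0 : 0 < g by rewrite /g; lra.
have gH : 0 < g < H by rewrite g0 /g; lra.
have al01 : 0 < al < 1 by apply/andP; split; lra.
have del0 : 0 < g + al - 1 by rewrite /g; lra.
apply: filterS2 (fbm_holder H12 hB gH) (fbm_continuous hB) => w hw cw.
have cb := continuous_max0 cw.
split; first exact: continuous_noise al01 g0 del0 cb hw.
move=> t t0; have T0 : 0 < t + 1 by lra.
have [C _ hC] := noise_approx al01 g0 del0 hw T0.
have t1 : 0 <= t <= t + 1 by apply/andP; split; lra.
by have [] := hC 0%N t t1.
Qed.

Lemma fractional_noise_noise T :
  fractional_noise P H al B T (fun t w => noise al (B^~ w) t).
Proof.
have /andP[H1 H2] := H12; have /andP[a1 a2] := halpha.
have H01 : 0 < H < 1 by apply/andP; split; lra.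
split.
  apply: filterS ae_noise => w [cw _].
  exact: (within_time_domain_continuous (f := fun t => noise al (B^~ w) t)).
move=> t [t0 _].
have mZ : measurable_fun setT (fun w => noise al (B^~ w) t).
  by apply: measurable_noise => // s /andP[s0 _]; exact: (fbm_measurable hB).
move: t0; rewrite le_eqVlt => /predU1P[t0|t0]; last first.
  apply: (is_integral_of_ae_cvg H12 hB (ltW t0) _ _ mZ
    (fun n => itv_partition_dyadic n t0) (step_fun_kernel_cvg H01 halpha t0)).
  - exact: measurable_kernel.
  - exact: kernel_Lp.
  - apply: filterS ae_noise => w [_ cw].
    apply: cvg_trans (cw t (ltW t0)); apply: near_eq_cvg; apply: nearW => n.
    by rewrite step_integral_dyadic.
(* At time 0 the dyadic points are not strictly increasing; the empty partition is used instead. *)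
have pt0 : itv_partition (0 : R) t [::] by split => //=; rewrite t0.
have z0 (f : R -> \bar R) : (\int[lebesgue_measure]_(s in `[0%R, t]) f s = 0)%E.
  by rewrite -t0 set_itv1 integral_set1.
apply: (is_integral_of_ae_cvg (p := fun=> [::]) (a := fun _ _ => 0) H12 hB _ _ _ mZ) => //.
- by rewrite t0.
- exact: measurable_kernel.
- by rewrite z0.
- by under eq_fun do rewrite z0; exact: cvg_cst.
- apply: nearW => w; rewrite (_ : noise al (B^~ w) t = 0).
    by rewrite /step_integral; under eq_fun do rewrite big_ord0; exact: cvg_cst.
  apply: fine_limsupE.
  rewrite (_ : noise_sum _ _ ^~ t = cst 0); first exact: cvg_cst.
  by apply/funext => n; rewrite /noise_sum big1// => j _; rewrite -t0 !mul0r !subrr mulr0.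
Qed.

Lemma eq_continuous_dyadic (f h : R -> R) :
  continuous (fun t : R => f (Num.max 0 t)) -> continuous (fun t : R => h (Num.max 0 t)) ->
  (forall n k : nat, f (k%:R / 2 ^+ n) = h (k%:R / 2 ^+ n)) ->
  forall t, 0 <= t -> f t = h t.
Proof.
move=> cf ch fh t t0.
have ap0 n : 0 <= dyadic_approx n t by rewrite divr_ge0// exprn_ge0.
have cv (u : R -> R) : continuous (fun t : R => u (Num.max 0 t)) ->
    (fun n => u (dyadic_approx n t)) @ \oo --> u t.
  move=> cu; have := cvg_comp _ _ (cvg_dyadic_approx t0) (cu t).
  rewrite /= max_r//; apply: cvg_trans; apply: near_eq_cvg; apply: nearW => n.
  by rewrite /= max_r.
have c1 := cv _ cf; have c2 := cv _ ch.
have E : (fun n => f (dyadic_approx n t)) = (fun n => h (dyadic_approx n t)).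
  by apply/funext => n; exact: fh.
by rewrite E in c1; exact: (cvg_unique _ c1 c2).
Qed.

(** The integral is unique almost surely at each fixed time; countably many dyadic times share one
    null set, and continuity does the rest. *)
Lemma fractional_noise_unique Z Z' :
  fractional_noise P H al B +oo%E Z -> fractional_noise P H al B +oo%E Z' ->
  {ae P, forall w, forall t, 0 <= t -> Z t w = Z' t w}.
Proof.
move=> [cZ iZ] [cZ' iZ'].
have E (n k : nat) : {ae P, forall w, Z (k%:R / 2 ^+ n) w = Z' (k%:R / 2 ^+ n) w}.
  have k0 : 0 <= (k%:R / 2 ^+ n : R) by rewrite divr_ge0// exprn_ge0.
  have tk : time_domain +oo%E (k%:R / 2 ^+ n : R) by split => //; rewrite ltry.
  exact: (is_integral_unique H12 hB k0 (iZ _ tk) (iZ' _ tk)).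
have {}E := ae_foralln (fun n => ae_foralln (E n)).
apply: filterS3 cZ cZ' E => w cw cw' Ew t t0.
exact: (eq_continuous_dyadic (continuous_max0 cw) (continuous_max0 cw') Ew).
Qed.

End fractional_noise_theory.

(** * The Volterra operator *)

Section volterra_operator.
Context {R : realType}.
Notation mu := (@lebesgue_measure R).
Variable al : R.
Hypothesis al0 : 0 < al.
Implicit Types (f h : R -> R) (t T : R).

(* Continuity on [0, +oo[, without constraint on the values at negative times. *)
Definition ray_continuous f := continuous (fun t : R => f (Num.max 0 t)).

Lemma ray_continuous_bounded f T : ray_continuous f -> 0 <= T ->
  exists2 M, 0 <= M & forall s, 0 <= s <= T -> `|f s| <= M.
Proof.
move=> cf T0.
have cn : {within `[0, T], continuous (fun t : R => `|f (Num.max 0 t)|)}.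
  by apply: continuous_subspaceT => x; apply: cvg_norm; exact: cf.
have [c _ hc] := EVT_max T0 cn.
exists `|f (Num.max 0 c)| => // s /andP[s0 sT].
by have := hc s; rewrite in_itv/= s0 sT max_r//; exact.
Qed.

Lemma ray_continuous_modulus f T e : ray_continuous f -> 0 < e ->
  exists2 del : R, 0 < del & forall s s', 0 <= s <= T -> 0 <= s' ->
    `|s - s'| < del -> `|f s - f s'| < e.
Proof.
move=> cf e0; pose ft (t : R) := f (Num.max 0 t).
have cK : compact `[(0 : R), T] by exact: segment_compact.
have key : forall x : R, `[(0 : R), T]%classic x -> \forall s \near x & del \near (0 : R)^'+,
    forall s', `|s - s'| < del -> `|ft s - ft s'| < e.
  move=> x _; have e2 : 0 < e / 2 by rewrite divr_gt0.
  have /cvgrPdist_lt/(_ _ e2)[eta /= eta0 heta] := cf x.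
  have eta2 : 0 < eta / 2 by rewrite divr_gt0.
  exists ([set s | `|x - s| < eta / 2], [set del | del < eta / 2]) => /=.
    split; first by exists (eta / 2).
    by near=> z; near: z; exact: nbhs_right_lt.
  move=> [s del]/= [xs dl] s' ss'.
  have h1 : `|ft x - ft s| < e / 2 by apply: heta => /=; lra.
  have h2 : `|ft x - ft s'| < e / 2.
    by apply: heta => /=; have := ler_distD s x s'; lra.
  rewrite (le_lt_trans (ler_distD (ft x) _ _))// (distrC (ft s)); lra.
have := (compact_near_coveringP _).1 cK R (0 : R)^'+ _ _ key.
move=> hn; near (0 : R)^'+ => del.
have del0 : 0 < del by near: del; exact: nbhs_right_gt.
exists del => // s s' s0T s'0 ss'.
have hd : `[(0 : R), T] `<=` [set s | forall s', `|s - s'| < del -> `|ft s - ft s'| < e].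
  by near: del; exact: hn.
have /andP[s0 sT] := s0T.
by have := hd s _ s' ss'; rewrite /ft !max_r//; apply; rewrite /= in_itv/= s0.
Unshelve. all: by end_near. Qed.

Definition volterra f t : R :=
  \int[mu]_(s in `[0, t]) ((t - s) `^ (al - 1) * f s).

Lemma measurable_ray_continuous f t : ray_continuous f -> measurable_fun `[0, t] f.
Proof.
move=> cf; apply: (eq_measurable_fun (fun t : R => f (Num.max 0 t))).
  by move=> s; rewrite inE/= in_itv/= => /andP[s0 _]; rewrite max_r.
by apply: measurable_funTS; exact: continuous_measurable_fun.
Qed.

Lemma integral_kernel_cc t : 0 <= t ->
  (\int[mu]_(s in `[0%R, t]) ((t - s) `^ (al - 1))%:E = (t `^ al / al)%:E)%E.
Proof.
move=> t0; rewrite -integral_kernel//; apply: integral_itv_bndoo.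
by apply/measurable_EFinP; exact: measurable_kernel.
Qed.

Lemma integrable_kernelM f t M : 0 <= t -> measurable_fun `[0, t] f ->
  (forall s, 0 <= s <= t -> `|f s| <= M) ->
  mu.-integrable `[0, t] (EFin \o (fun s => (t - s) `^ (al - 1) * f s)).
Proof.
move=> t0 mf fM.
have M0 : 0 <= M by apply: le_trans (fM 0 _); rewrite ?normr_ge0 ?lexx.
apply/integrableP; split.
  by apply/measurable_EFinP; apply: measurable_funM => //; exact: measurable_kernel.
apply: (@le_lt_trans _ _ (\int[mu]_(s in `[0%R, t]) (M * (t - s) `^ (al - 1))%:E)%E).
  apply: ge0_le_integral_fin => //.
  - apply: measurableT_comp => //; apply: measurable_funM => //; exact: measurable_kernel.
  - apply: measurable_funM => //; exact: measurable_kernel.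
  - move=> s; rewrite /= in_itv/= => s0t.
    rewrite normrM (ger0_norm (powR_ge0 _ _)) mulrC ler_wpM2r ?powR_ge0//.
    exact: fM.
have mk : measurable_fun `[0, t] (fun s => (t - s) `^ (al - 1)) by exact: measurable_kernel.
have -> := ge0_integralZl_fin mu (measurable_itv _) mk (fun s _ => powR_ge0 _ _) M0.
by rewrite integral_kernel_cc// -EFinM ltry.
Qed.

(** The bound [M] only certifies integrability of the integrand; the estimate itself comes from
    [w]. *)
Lemma volterra_le f w t K : 0 <= t -> measurable_fun `[0, t] f ->
  measurable_fun `[0, t] w -> (forall s, 0 <= s <= t -> `|f s| <= w s) ->
  (exists M, forall s, 0 <= s <= t -> `|f s| <= M) ->
  (\int[mu]_(s in `[0%R, t]) ((t - s) `^ (al - 1) * w s)%:E <= K%:E)%E ->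
  `|volterra f t| <= K.
Proof.
move=> t0 mf mw fw [M fM] hK.
have ifk := integrable_kernelM t0 mf fM.
apply: (le_trans (le_normr_Rintegral _ ifk)) => //.
have mk : measurable_fun `[0, t] (fun s => (t - s) `^ (al - 1)) by exact: measurable_kernel.
have H : (\int[mu]_(s in `[0%R, t]) `|(t - s) `^ (al - 1) * f s|%:E <= K%:E)%E.
  apply: le_trans hK; apply: ge0_le_integral_fin => //.
  - by apply: measurableT_comp => //; apply: measurable_funM.
  - exact: measurable_funM.
  - move=> s; rewrite /= in_itv/= => s0t.
    by rewrite normrM (ger0_norm (powR_ge0 _ _)) ler_wpM2l ?powR_ge0// fw.
have H0 : (0 <= \int[mu]_(s in `[0%R, t]) `|(t - s) `^ (al - 1) * f s|%:E)%E.
  by apply: integral_ge0 => s _; rewrite lee_fin.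
rewrite /Rintegral -lee_fin fineK// ge0_fin_numE//.
by apply: (le_lt_trans H); rewrite ltry.
Qed.

Lemma volterra_le_bounded f t M : 0 <= t -> measurable_fun `[0, t] f ->
  (forall s, 0 <= s <= t -> `|f s| <= M) -> `|volterra f t| <= M * (t `^ al / al).
Proof.
move=> t0 mf fM; have M0 : 0 <= M by apply: le_trans (fM 0 _); rewrite ?normr_ge0 ?lexx.
apply: (@volterra_le f (cst M)) => //; first by exists M.
have mk : measurable_fun `[0, t] (fun s => (t - s) `^ (al - 1)) by exact: measurable_kernel.
under eq_integral do rewrite /= mulrC.
have -> := ge0_integralZl_fin mu (measurable_itv _) mk (fun s _ => powR_ge0 _ _) M0.
by rewrite integral_kernel_cc// -EFinM.
Qed.

Lemma volterraB f h t M N : 0 <= t ->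
  measurable_fun `[0, t] f -> measurable_fun `[0, t] h ->
  (forall s, 0 <= s <= t -> `|f s| <= M) -> (forall s, 0 <= s <= t -> `|h s| <= N) ->
  volterra f t - volterra h t = volterra (fun s => f s - h s) t.
Proof.
move=> t0 mf mh fM hN; rewrite /volterra.
rewrite -(RintegralB _ (integrable_kernelM t0 mf fM) (integrable_kernelM t0 mh hN))//.
by apply: eq_Rintegral => s _; rewrite mulrBr.
Qed.

End volterra_operator.

(** * Estimates in the exponentially weighted norm *)

Section bielecki.
Context {R : realType}.
Notation mu := (@lebesgue_measure R).
Variable al : R.
Hypothesis al01 : 0 < al < 1.
Implicit Types (f : R -> R) (t lam del : R).

Let al0 : 0 < al. Proof. by have /andP[] := al01. Qed.

Lemma measurable_expRM lam D : measurable_fun D (fun s : R => expR (lam * s)).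
Proof.
by apply: measurable_funTS; apply: measurableT_comp => //; exact: measurable_funM.
Qed.

Lemma integral_expRM_le lam t : 0 < lam -> 0 <= t ->
  (\int[mu]_(s in `[0%R, t]) (expR (lam * s)%R)%:E <= (expR (lam * t) / lam)%:E)%E.
Proof.
move=> l0 t0; rewrite integral_itv_bndoo; last first.
  by apply/measurable_EFinP; exact: measurable_expRM.
have cl : continuous (fun s : R => expR (lam * s)).
  move=> s; apply: (@continuous_comp _ _ _ (fun s : R => lam * s) expR).
    by apply: cvgM; [exact: cvg_cst|exact: cvg_id].
  exact: continuous_expR.
rewrite (@ge0_integral_oo_FTC _ _ (fun s => lam^-1 * expR (lam * s)) _ _ [::])//.
- by rewrite lee_fin mulr0 expR0 mulr1 mulrC lerBlDr lerDl invr_ge0 ltW.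
- by move=> s; apply: cvgM; [exact: cvg_cst|exact: cl].
- exact: measurable_expRM.
- by move=> s _ _; exact: cl.
- move=> s _ _.
  have E : is_derive s (1 : R) (expR \o (fun s => lam *: s)) (expR (lam *: s) * (lam *: 1)).
    by apply: is_derive1_comp; apply: is_deriveZ.
  have -> : (fun s => lam^-1 * expR (lam * s)) =
      (fun s => lam^-1 *: (expR \o (fun s => lam *: s)) s) by [].
  apply: (is_derive_eq (is_deriveZ lam^-1 E)).
  by rewrite /GRing.scale/= mulr1 mulrC mulfK// gt_eqF.
Qed.

(* The kernel is integrated exactly within distance [del] of [t] and bounded by
   [del `^ (al - 1)] elsewhere. *)
Lemma volterra_le_exp f t M lam del : 0 < lam -> 0 < del -> 0 <= t -> 0 <= M ->
  measurable_fun `[0, t] f ->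
  (forall s, 0 <= s <= t -> `|f s| <= M * expR (lam * s)) ->
  `|volterra al f t| <= M * (del `^ al / al + del `^ (al - 1) / lam) * expR (lam * t).
Proof.
move=> l0 d0 t0 M0 mf fM.
apply: (volterra_le al0 (w := fun s => M * expR (lam * s))) => //.
- by apply: measurable_funM => //; exact: measurable_expRM.
- exists (M * expR (lam * t)) => s s0t; apply: le_trans (fM s s0t) _.
  by have /andP[s0 st] := s0t; rewrite ler_wpM2l// ler_expR ler_pM2l.
pose D := `](t - del), t[%classic : set R.
have mDs : measurable D by exact: measurable_itv.
pose A s := expR (lam * t) * (\1_D s * `|s - t| `^ (al - 1)).
pose C s := del `^ (al - 1) * expR (lam * s).
have mD : measurable_fun `[0, t] (fun s => \1_D s * `|s - t| `^ (al - 1) : R).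
  apply: measurable_funM; last exact: measurable_norm_shift_powR.
  by apply: measurable_indic; exact: measurable_itv.
have mA : measurable_fun `[0, t] A by exact: measurable_funM.
have mC : measurable_fun `[0, t] C by apply: measurable_funM => //; exact: measurable_expRM.
have D0 s : 0 <= \1_D s * `|s - t| `^ (al - 1) by rewrite indicE mulr_ge0 ?powR_ge0.
have A0 s : 0 <= A s by rewrite mulr_ge0 ?expR_ge0.
have C0 s : 0 <= C s by rewrite mulr_ge0 ?expR_ge0 ?powR_ge0.
have IA : (\int[mu]_(s in `[0%R, t]) (A s)%:E <= (expR (lam * t) * (del `^ al / al))%:E)%E.
  have -> := ge0_integralZl_fin mu (measurable_itv _) mD (fun s _ => D0 s) (expR_ge0 (lam * t)).
  rewrite EFinM; apply: lee_wpmul2l; first by rewrite lee_fin expR_ge0.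
  have -> : (del `^ al / al)%:E = (\int[mu]_(s in D) (`|s - t| `^ (al - 1))%:E)%E.
    rewrite /D integral_norm_powR//; last by lra.
    rewrite subrr (_ : t - del - t = - del); last by ring.
    rewrite spowRN !spowR_ge0 ?(ltW d0)// powR0 ?gt_eqF//.
    by congr EFin; ring.
  apply: (@le_trans _ _ (\int[mu]_(s in `[0%R, t] `&` D) (`|s - t| `^ (al - 1))%:E)%E).
    rewrite [leRHS]integral_mkcondr le_eqVlt; apply/orP; left; apply/eqP.
    apply: eq_integral => s _; rewrite patchE indicE.
    by case: ifP; rewrite ?mul1r ?mul0r.
  apply: ge0_subset_integral => //.
  - exact: measurableI.
  - by apply/measurable_EFinP; exact: measurable_norm_shift_powR.
have IC : (\int[mu]_(s in `[0%R, t]) (C s)%:E <= (del `^ (al - 1) * (expR (lam * t) / lam))%:E)%E.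
  have mE : measurable_fun `[0, t] (fun s => expR (lam * s)) by exact: measurable_expRM.
  have -> := ge0_integralZl_fin mu (measurable_itv _) mE (fun s _ => expR_ge0 _)
    (powR_ge0 del (al - 1)).
  rewrite [leRHS]EFinM; apply: lee_wpmul2l; first by rewrite lee_fin powR_ge0.
  exact: integral_expRM_le.
have mAC : measurable_fun `[0, t] (fun s => A s + C s) by exact: measurable_funD.
have AC0 s : 0 <= A s + C s by rewrite addr_ge0.
apply: (@le_trans _ _ (\int[mu]_(s in `[0%R, t]) (M * (A s + C s))%:E)%E).
  apply: ge0_le_integral_fin => //.
  - apply: measurable_funM; first exact: measurable_kernel.
    by apply: measurable_funM => //; exact: measurable_expRM.
  - exact: measurable_funM.
  - by move=> s _; rewrite !mulr_ge0 ?powR_ge0 ?expR_ge0.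
  move=> s; rewrite /= in_itv/= => /andP[s0 st].
  rewrite mulrCA ler_wpM2l// /A /C.
  have [sd|sd] := ltP (t - del) s.
    rewrite -[leLHS]addr0; apply: lerD; last by rewrite mulr_ge0 ?powR_ge0 ?expR_ge0.
    move: st; rewrite le_eqVlt => /predU1P[->|st].
      rewrite subrr powR0 ?mul0r; last by rewrite subr_eq0 lt_eqF//; have /andP[] := al01.
      by rewrite mulr_ge0 ?expR_ge0.
    rewrite indicE mem_set/=; last by rewrite /D/= in_itv/= sd.
    rewrite mul1r distrC gtr0_norm ?subr_gt0// mulrC ler_wpM2r ?powR_ge0//.
    by rewrite ler_expR ler_pM2l// ltW.
  rewrite -[leLHS]add0r; apply: lerD; first exact: A0.
  rewrite ler_wpM2r ?expR_ge0// /powR !gt_eqF; [|lra..].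
  rewrite ler_expR ler_nM2l; last by have /andP[] := al01; lra.
  by rewrite ler_ln ?posrE; lra.
have -> := ge0_integralZl_fin mu (measurable_itv _) mAC (fun s _ => AC0 s) M0.
rewrite -!mulrA [leRHS]EFinM; apply: lee_wpmul2l; first by rewrite lee_fin.
have -> := ge0_integralD_fin mu (measurable_itv _) mA mC (fun s _ => A0 s) (fun s _ => C0 s).
apply: (le_trans (leeD IA IC)); rewrite -EFinD lee_fin le_eqVlt; apply/orP; left; apply/eqP.
by ring.
Qed.

(** First [del] makes the singular part equal to e/2, then [lam] does the same for the remainder. *)
Lemma bielecki_small (e : R) : 0 < e -> exists lam del : R,
  [/\ 0 < lam, 0 < del & del `^ al / al + del `^ (al - 1) / lam <= e].
Proof.
move=> e0; pose del := (e * al / 2) `^ al^-1.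
have x0 : 0 < e * al / 2 by rewrite divr_gt0// mulr_gt0.
have d0 : 0 < del by exact: powR_gt0.
have dp : 0 < del `^ (al - 1) by exact: powR_gt0.
exists (2 * del `^ (al - 1) / e), del; split => //.
  by rewrite divr_gt0// mulr_gt0.
have -> : del `^ al = e * al / 2 by rewrite /del -powRrM mulVf ?gt_eqF// powRr1// ltW.
rewrite le_eqVlt; apply/orP; left; apply/eqP; field.
by rewrite !gt_eqF.
Qed.

End bielecki.

(** * Riemann sums for the Volterra operator *)

Section volterra_sums.
Context {R : realType}.
Notation mu := (@lebesgue_measure R).
Variable al : R.
Hypothesis al01 : 0 < al < 1.
Implicit Types (f : R -> R) (t T : R).

Let al0 : 0 < al. Proof. by have /andP[] := al01. Qed.

(* Dyadic Riemann sums stand in for the Volterra integral in the Picard iteration: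
   measurability in [w] is then immediate, with no joint measurability in [(s, w)]. *)
Definition volterra_weight n j t : R :=
  (`|t - t * (j%:R / 2 ^+ n)| `^ al - `|t - t * (j.+1%:R / 2 ^+ n)| `^ al) / al.

Definition volterra_sum f n t : R :=
  \sum_(j < 2 ^ n) f (t * (j%:R / 2 ^+ n)) * volterra_weight n j t.

Definition volterra_lim f t : R := fine_limsup (volterra_sum f ^~ t).

Lemma integral_kernel_indic t x y : 0 <= x <= y -> y <= t ->
  (\int[mu]_(s in `[0%R, t]) ((t - s) `^ (al - 1) * \1_`]x, y] s)%:E =
   ((`|t - x| `^ al - `|t - y| `^ al) / al)%:E)%E.
Proof.
move=> /andP[x0 xy] yt.
transitivity (\int[mu]_(s in `]x, y]) (`|s - t| `^ (al - 1))%:E)%E.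
  rewrite integral_mkcond [RHS]integral_mkcond; apply: eq_integral => s _.
  rewrite !patchE indicE; case: (boolP (s \in `]x, y]%classic)) => [|sxy]; last first.
    by rewrite mulr0; case: ifP.
  rewrite inE/= in_itv/= => /andP[xs sy].
  rewrite mem_set; last by rewrite /= in_itv/= (le_trans x0 (ltW xs)) (le_trans sy).
  by rewrite mulr1 distrC ger0_norm// subr_ge0 (le_trans sy).
rewrite -integral_itv_bndo_bndc; last first.
  by apply/measurable_EFinP; exact: measurable_norm_shift_powR.
rewrite integral_norm_powR// -(opprB t y) -(opprB t x) !spowRN.
rewrite !spowR_ge0 ?subr_ge0 ?(le_trans xy)// !ger0_norm ?subr_ge0 ?(le_trans xy)//.
by congr EFin; ring.
Qed.

(** The weights integrate the singular kernel exactly over each interval, so the only error of the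
    sum is that of replacing [f] by a step function. *)
Lemma volterra_sumE f n t : 0 < t -> volterra_sum f n t =
  volterra al (step_fun (dyadic_partition t n) (fun j => f (t * (j%:R / 2 ^+ n)))) t.
Proof.
move=> t0; have p2 : 0 < (2 ^+ n : R) by rewrite exprn_gt0.
pose I (j : 'I_(2 ^ n)) := `](t * (j%:R / 2 ^+ n)), (t * (j.+1%:R / 2 ^+ n))]%classic.
have E s : step_fun (dyadic_partition t n) (fun j => f (t * (j%:R / 2 ^+ n))) s =
    \sum_(j < 2 ^ n) f (t * (j%:R / 2 ^+ n)) * \1_(I j) s.
  rewrite /step_fun size_dyadic_partition; apply: eq_bigr => j _.
  by rewrite nth_dyadic_partition// nth_dyadic_partition0// ltnW.
have ik (j : 'I_(2 ^ n)) : mu.-integrable `[0, t]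
    (EFin \o (fun s => (t - s) `^ (al - 1) * \1_(I j) s)).
  apply: (integrable_kernelM al0 (M := 1) (ltW t0)).
    by apply: measurable_indic; exact: measurable_itv.
  by move=> s _; rewrite indicE; case: (_ \in _); rewrite ?normr1 ?normr0.
rewrite /volterra /Rintegral.
have -> : (\int[mu]_(s in `[0%R, t]) ((t - s) `^ (al - 1) *
    step_fun (dyadic_partition t n) (fun j => f (t * (j%:R / 2 ^+ n)))%R s)%:E =
  \int[mu]_(s in `[0%R, t]) \sum_(j < 2 ^ n)
    ((f (t * (j%:R / 2 ^+ n)))%:E * ((t - s) `^ (al - 1) * \1_(I j) s)%:E))%E.
  apply: eq_integral => s _; rewrite E mulr_sumr -sumEFin; apply: eq_bigr => j _.
  by rewrite -EFinM mulrCA.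
rewrite integral_sum//; last by move=> j; apply: integrableZl => //; exact: ik.
rewrite (eq_bigr (fun j : 'I_(2 ^ n) => (f (t * (j%:R / 2 ^+ n)) * volterra_weight n j t)%:E)).
  by rewrite sumEFin.
move=> j _; rewrite integralZl//; last exact: ik.
rewrite integral_kernel_indic ?EFinM//.
  rewrite mulr_ge0 ?divr_ge0 ?(ltW t0) ?(ltW p2)//= ler_pM2l// ler_pM2r ?invr_gt0//.
  by rewrite ler_nat.
by rewrite ler_piMr ?(ltW t0)// ler_pdivrMr// mul1r -natrX ler_nat.
Qed.

Lemma volterra0 f : volterra al f 0 = 0.
Proof. by rewrite /volterra set_itv1 Rintegral_set1. Qed.

Lemma volterra_eq f h t : measurable_fun `[0, t] f -> measurable_fun `[0, t] h ->
  (forall s, 0 < s <= t -> f s = h s) -> volterra al f t = volterra al h t.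
Proof.
move=> mf mh fh.
have sub : `]0, t] `<=` `[0, t] by move=> s /=; rewrite !in_itv/= => /andP[/ltW -> ->].
have mk (u : R -> R) : measurable_fun `[0, t] u ->
    measurable_fun `]0, t] (EFin \o (fun s => (t - s) `^ (al - 1) * u s)).
  move=> mu'; apply/measurable_EFinP; apply: measurable_funM; first exact: measurable_kernel.
  exact: measurable_funS mu'.
rewrite /volterra /Rintegral -(integral_itv_obnd_cbnd (mk _ mf)) -(integral_itv_obnd_cbnd (mk _ mh)).
by congr fine; apply: eq_integral => s; rewrite inE/= in_itv/= => s0t; rewrite fh.
Qed.

Lemma volterra_sum0 f n : volterra_sum f n 0 = 0.
Proof.
rewrite /volterra_sum big1// => j _.
by rewrite /volterra_weight !mul0r subrr mul0r mulr0.
Qed.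

(** The kernel has mass at most T^al / al, so it suffices that [f] varies by at most e / (T^al / al)
    over one mesh, and the mesh is at most T / 2^n for all t <= T. *)
Lemma volterra_sum_uniform f T e : ray_continuous f -> 0 < T -> 0 < e ->
  exists N, forall n t, (N <= n)%N -> 0 <= t <= T ->
    `|volterra al f t - volterra_sum f n t| <= e.
Proof.
move=> cf T0 e0; have Tp : 0 < T `^ al / al by rewrite divr_gt0// powR_gt0.
have e1 : 0 < e / (T `^ al / al) by rewrite divr_gt0.
have [del del0 hdel] := ray_continuous_modulus T cf e1.
have [M M0 hM] := ray_continuous_bounded cf (ltW T0).
have : T * (1 / 2) ^+ n @[n --> \oo] --> (0 : R).
  by apply: cvg_geometric; rewrite ger0_norm; lra.
move=> /cvgrPdist_lt/(_ _ del0)[N _ hN]; exists N => n t Nn /andP[t0 tT].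
have := hN n Nn; rewrite sub0r normrN ger0_norm => [Tn|]; last first.
  by rewrite mulr_ge0 ?(ltW T0)// exprn_ge0.
move: t0; rewrite le_eqVlt => /predU1P[<-|t0].
  by rewrite volterra0 volterra_sum0 subrr normr0 ltW.
have p2 : 0 < (2 ^+ n : R) by rewrite exprn_gt0.
set g := fun j : nat => f (t * (j%:R / 2 ^+ n)).
have close s : 0 <= s <= t -> s != 0 -> exists2 j : nat,
    `|f s - g j| <= e / (T `^ al / al) & step_fun (dyadic_partition t n) g s = g j.
  move=> /andP[s0 st] sn0.
  have sp : 0 < s <= t by rewrite lt_def sn0 s0.
  have ps0 : 0 < s by have /andP[] := sp.
  have [j [h1 h2 h3]] := step_fun_dyadic g n t0 sp.
  exists j => //; apply/ltW/hdel.
  - by rewrite s0 (le_trans st).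
  - by rewrite mulr_ge0 ?divr_ge0 ?(ltW t0)// ltW.
  - rewrite ger0_norm; last by rewrite subr_ge0 ltW.
    move: h2; rewrite -natr1 mulrDl mulrDr => h2.
    apply: le_lt_trans Tn; apply: (@le_trans _ _ (t * (1 / 2 ^+ n))); first by lra.
    by rewrite expr_div_n expr1n ler_wpM2r// divr_ge0// ltW.
have M1 s : 0 <= s <= t -> `|f s| <= M.
  by move=> /andP[s0 st]; apply: hM; rewrite s0 (le_trans st).
have step0 : step_fun (dyadic_partition t n) g 0 = 0.
  rewrite /step_fun size_dyadic_partition big1// => j _.
  rewrite nth_dyadic_partition// nth_dyadic_partition0 ?(ltnW (ltn_ord j))//.
  rewrite indicE memNset ?mulr0//= in_itv/= => /andP[h _].
  by move: h; rewrite ltNge mulr_ge0 ?divr_ge0 ?(ltW t0) ?(ltW p2).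
have M2 s : 0 <= s <= t -> `|step_fun (dyadic_partition t n) g s| <= M + e / (T `^ al / al).
  move=> s0t; have [->|sn0] := eqVneq s 0.
    by rewrite step0 normr0 addr_ge0// ltW.
  have [j h ->] := close s s0t sn0.
  have := M1 s s0t; have := ler_distD 0 (g j) (f s).
  have := ler_normD (f s) (g j - f s); rewrite subrKC (distrC (g j)); lra.
have mS : measurable_fun `[0, t] (step_fun (dyadic_partition t n) g).
  exact: measurable_step_fun.
have mf : measurable_fun `[0, t] f by exact: measurable_ray_continuous.
rewrite volterra_sumE// (volterraB al0 (ltW t0) mf mS M1 M2).
(* The step function vanishes at 0, its intervals being open on the left; the indicator discards
   this one point, where the error need not be small. *)
pose h s := \1_`]0, t] s * (f s - step_fun (dyadic_partition t n) g s).
have mh : measurable_fun `[0, t] h.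
  apply: measurable_funM; last exact: measurable_funB.
  by apply: measurable_indic; exact: measurable_itv.
rewrite (@volterra_eq _ h)//; last 2 first.
- exact: measurable_funB.
- by move=> s s0t; rewrite /h indicE mem_set ?mul1r//= in_itv.
apply: (@le_trans _ _ (e / (T `^ al / al) * (t `^ al / al))).
  apply: (volterra_le_bounded al0 (ltW t0) mh) => s s0t.
  rewrite /h indicE; have [/set_mem|_] := boolP (s \in _); last first.
    by rewrite mul0r normr0 ltW.
  rewrite /= in_itv/= mul1r => /andP[s0 _].
  by have [|j hj ->] := close s s0t; rewrite ?gt_eqF.
rewrite mulrAC ler_pdivrMr// ler_wpM2l ?(ltW e0)// ler_wpM2r ?invr_ge0 ?(ltW al0)//.
by rewrite ge0_ler_powR ?nnegrE ?(ltW al0) ?(ltW t0) ?(ltW T0).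
Qed.

Lemma volterra_sum_cvg f t : ray_continuous f -> 0 <= t ->
  volterra_sum f ^~ t @ \oo --> volterra al f t.
Proof.
move=> cf t0; apply/cvgrPdist_le => e e0.
have T0 : 0 < t + 1 by lra.
have [N hN] := volterra_sum_uniform cf T0 e0.
exists N => // n /= Nn; apply: hN => //; rewrite t0; lra.
Qed.

Lemma volterra_limE f t : ray_continuous f -> 0 <= t -> volterra_lim f t = volterra al f t.
Proof. by move=> cf t0; apply: fine_limsupE; exact: volterra_sum_cvg. Qed.

Lemma ray_continuous_volterra f : ray_continuous f -> ray_continuous (volterra al f).
Proof.
move=> cf t; have T0 : 0 < `|t| + 1 by rewrite ltr_wpDl.
apply: (@uniform_limit_continuous_at _ _ (fun n t => volterra_sum f n (Num.max 0 t))).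
  move=> e e0; have [N hN] := volterra_sum_uniform cf T0 e0.
  exists N; near=> u; apply: hN => //; rewrite le_max lexx/= ge_max (ltW T0)/= ltW//.
  near: u; apply: lt_nbhsl; rewrite (le_lt_trans (ler_norm _))//; lra.
move=> n; have cm : continuous (fun t : R => Num.max 0 t).
  by move=> u; apply: (@continuous_max _ _ (cst (0 : R)) (fun t : R => t) u (cvg_cst _) cvg_id).
have cw c : continuous (fun t : R => `|Num.max 0 t - Num.max 0 t * c| `^ al).
  move=> u; apply: (@continuous_comp _ _ _ (fun t : R => Num.max 0 t - Num.max 0 t * c)
    (fun z => `|z| `^ al)); last exact: continuous_norm_powR.
  by apply: cvgB; [exact: cm|apply: cvgM; [exact: cm|exact: cvg_cst]].
have cfc c : 0 <= c -> continuous (fun t : R => f (Num.max 0 t * c)).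
  move=> c0 u.
  rewrite (_ : (fun t : R => _) = (fun t : R => f (Num.max 0 t)) \o (fun t => Num.max 0 t * c)).
    by apply: continuous_comp; [apply: cvgM; [exact: cm|exact: cvg_cst]|exact: cf].
  by apply/funext => v /=; rewrite [in RHS]max_r// mulr_ge0// le_max lexx.
rewrite /volterra_sum; apply: cvg_big => [|j _]; first exact: add_continuous.
apply: cvgM; first by apply: cfc; rewrite divr_ge0// exprn_ge0.
by apply: cvgM; [apply: cvgB; exact: cw|exact: cvg_cst].
Unshelve. all: by end_near. Qed.

End volterra_sums.

(** * Picard iteration *)

Lemma lipschitz_continuous (R : realType) (F : R -> R) (L : R) : 0 <= L ->
  (forall x y, `|F x - F y| <= L * `|x - y|) -> continuous F.
Proof.
move=> L0 lipF x; apply/cvgrPdist_lt => e e0.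
have L1 : 0 < L + 1 by rewrite ltr_wpDl.
exists (e / (L + 1)) => /= [|y /= xy]; first by rewrite divr_gt0.
rewrite (le_lt_trans (lipF x y))//.
apply: (@le_lt_trans _ _ ((L + 1) * `|x - y|)); first by rewrite ler_wpM2r// lerDl.
by rewrite mulrC -ltr_pdivlMr.
Qed.

Section picard_iteration.
Context {R : realType}.
Variables (al c : R) (F : R -> R) (L : R).
Hypothesis al01 : 0 < al < 1.
Hypothesis L0 : 0 <= L.
Hypothesis lipF : forall x y, `|F x - F y| <= L * `|x - y|.
Implicit Types (f h g x y : R -> R) (t T lam M : R).

Let al0 : 0 < al. Proof. by have /andP[] := al01. Qed.

Lemma ray_continuous_compl f : ray_continuous f -> ray_continuous (F \o f).
Proof.
move=> cf t; apply: (@continuous_comp _ _ _ (fun t : R => f (Num.max 0 t)) F).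
  exact: cf.
exact: (lipschitz_continuous L0 lipF).
Qed.

(** One weight [lam] makes the operator a contraction with factor 1/2, whatever the horizon and the
    functions compared. *)
Lemma bielecki_weight : exists2 lam : R, 0 < lam &
  forall f h M t, ray_continuous f -> ray_continuous h -> 0 <= M -> 0 <= t ->
  (forall s : R, 0 <= s <= t -> `|f s - h s| <= M * expR (lam * s)) ->
  `|c * volterra al (F \o f) t - c * volterra al (F \o h) t| <= M / 2 * expR (lam * t).
Proof.
(* The factor obtained is |c| L / (2 (|c| L + 1)) <= 1/2; the added 1 keeps the denominator
   positive. *)
have cL : 0 < 2 * (`|c| * L + 1) by rewrite mulr_gt0// ltr_wpDl// mulr_ge0.
have [|lam [del [l0 d0 small]]] := bielecki_small al01 (e := (2 * (`|c| * L + 1))^-1).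
  by rewrite invr_gt0.
exists lam => // f h M t cf ch M0 t0 fh.
have cFf := ray_continuous_compl cf; have cFh := ray_continuous_compl ch.
have mFf : measurable_fun `[0, t] (F \o f) by exact: measurable_ray_continuous.
have mFh : measurable_fun `[0, t] (F \o h) by exact: measurable_ray_continuous.
have [N1 _ h1] := ray_continuous_bounded cFf t0.
have [N2 _ h2] := ray_continuous_bounded cFh t0.
rewrite -mulrBr (volterraB al0 t0 mFf mFh h1 h2) normrM.
have := @volterra_le_exp _ _ al01 (fun s => (F \o f) s - (F \o h) s) t (L * M) lam del
  l0 d0 t0 (mulr_ge0 L0 M0) (measurable_funB mFf mFh).
move=> /(_ _)/le_trans.
move=> le1; apply: (@le_trans _ _ (`|c| * (L * M * (2 * (`|c| * L + 1))^-1 * expR (lam * t)))).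
  rewrite ler_wpM2l//; apply: le1.
    move=> s s0t; apply: le_trans (lipF _ _) _; rewrite -mulrA ler_wpM2l//; exact: fh.
  by rewrite ler_wpM2r ?expR_ge0// ler_wpM2l// mulr_ge0.
rewrite !mulrA ler_wpM2r ?expR_ge0// ler_pdivrMr//.
have -> : M / 2 * (2 * (`|c| * L + 1)) = M * (`|c| * L + 1) by field.
lra.
Qed.

(** Both are bounded on [0, T], and each use of the two equations halves the weighted bound on their
    difference. *)
Lemma volterra_equation_unique g x y : ray_continuous x -> ray_continuous y ->
  (forall t, 0 <= t -> x t = g t - c * volterra al (F \o x) t) ->
  (forall t, 0 <= t -> y t = g t - c * volterra al (F \o y) t) ->
  forall t, 0 <= t -> x t = y t.
Proof.
move=> cx cy ex ey T T0; have [lam l0 contract] := bielecki_weight.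
have [M1 M10 h1] := ray_continuous_bounded cx T0.
have [M2 M20 h2] := ray_continuous_bounded cy T0.
have M0 : 0 <= M1 + M2 by rewrite addr_ge0.
have bound k t : 0 <= t <= T -> `|x t - y t| <= (M1 + M2) * (1 / 2) ^+ k * expR (lam * t).
  elim: k t => [|k IH] t t0T; have /andP[t0 tT] := t0T.
    rewrite expr0 mulr1; apply: (@le_trans _ _ (M1 + M2)).
      by rewrite (le_trans (ler_normB _ _))// lerD ?h1 ?h2.
    by rewrite ler_peMr// -expR0 ler_expR mulr_ge0 ?(ltW l0).
  rewrite ex// ey// (_ : _ - _ = - (c * volterra al (F \o x) t - c * volterra al (F \o y) t));
    last by ring.
  rewrite normrN.
  rewrite exprSr mulrA [X in X * expR _](_ : _ = (M1 + M2) * (1 / 2) ^+ k / 2); last by field.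
  apply: contract => //; first by rewrite mulr_ge0// exprn_ge0// divr_ge0.
  by move=> s /andP[s0 st]; apply: IH; rewrite s0 (le_trans st).
apply/eqP; rewrite -subr_eq0 -normr_eq0 eq_le normr_ge0 andbT.
have cv : (M1 + M2) * (1 / 2) ^+ k * expR (lam * T) @[k --> \oo] --> (0 : R).
  rewrite [X in _ --> X](_ : _ = 0 * expR (lam * T)); last by rewrite mul0r.
  apply: cvgM; last exact: cvg_cst.
  by apply: cvg_geometric; rewrite ger0_norm; lra.
rewrite -(cvg_lim _ cv)//; apply: limr_ge; first by apply/cvg_ex; exists 0.
by apply: nearW => k; apply: bound; rewrite T0 lexx.
Qed.

Fixpoint picard g k t : R :=
  if k is k'.+1 then g t - c * volterra_lim al (F \o picard g k') t else g t.

Definition picard_limit g t : R := fine_limsup (picard g ^~ t).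

Section solution.
Variable g : R -> R.
Hypothesis cg : ray_continuous g.

Lemma ray_continuous_picard k : ray_continuous (picard g k).
Proof.
elim: k => [|k IH]; first exact: cg.
have cp := ray_continuous_compl IH.
move=> t /=; rewrite (_ : (fun t : R => _) = (fun t : R =>
    g (Num.max 0 t) - c * volterra al (F \o picard g k) (Num.max 0 t))); last first.
  by apply/funext => s; rewrite volterra_limE// le_max lexx.
apply: cvgB; first exact: cg.
by apply: cvgM; [exact: cvg_cst|exact: (ray_continuous_volterra al01 cp)].
Qed.

Lemma picardS k t : 0 <= t ->
  picard g k.+1 t = g t - c * volterra al (F \o picard g k) t.
Proof.
by move=> t0 /=; rewrite volterra_limE//; apply: ray_continuous_compl; exact: ray_continuous_picard.
Qed.

Lemma picard_increment : exists2 lam : R, 0 < lam &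
  forall T, 0 <= T -> exists2 M, 0 <= M & forall k t, 0 <= t <= T ->
    `|picard g k.+1 t - picard g k t| <= M * (1 / 2) ^+ k * expR (lam * t).
Proof.
have [lam l0 contract] := bielecki_weight; exists lam => // T T0.
have [M1 M10 h1] := ray_continuous_bounded (@ray_continuous_picard 0) T0.
have [M2 M20 h2] := ray_continuous_bounded (@ray_continuous_picard 1) T0.
exists (M2 + M1); first by rewrite addr_ge0.
elim=> [|k IH] t t0T; have /andP[t0 tT] := t0T.
  rewrite expr0 mulr1; apply: (@le_trans _ _ (M2 + M1)).
    by rewrite (le_trans (ler_normB _ _))// lerD ?h1 ?h2.
  by rewrite ler_peMr ?addr_ge0// -expR0 ler_expR mulr_ge0 ?(ltW l0).
rewrite !picardS//.
rewrite (_ : _ - _ = - (c * volterra al (F \o picard g k.+1) t - c * volterra al (F \o picard g k) t));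
  last by ring.
rewrite normrN.
rewrite exprSr mulrA [X in X * expR _](_ : _ = (M2 + M1) * (1 / 2) ^+ k / 2); last by field.
apply: contract => //; try exact: ray_continuous_picard.
  by rewrite mulr_ge0 ?addr_ge0// exprn_ge0// divr_ge0.
by move=> s /andP[s0 st]; apply: IH; rewrite s0 (le_trans st).
Qed.

Lemma picard_close T : 0 <= T -> exists2 K, 0 <= K & forall k t, 0 <= t <= T ->
  `|picard_limit g t - picard g k t| <= K * (1 / 2) ^+ k.
Proof.
move=> T0; have [lam l0 hl] := picard_increment.
have [M M0 hM] := hl T T0.
have K0 : 0 <= M * expR (lam * T) by rewrite mulr_ge0 ?expR_ge0.
exists (M * expR (lam * T) * 2) => [|k t t0T]; first by rewrite mulr_ge0.
have half : 0 <= (1 / 2 : R) < 1 by lra.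
have inc n : `|picard g n.+1 t - picard g n t| <= M * expR (lam * T) * (1 / 2) ^+ n.
  apply: le_trans (hM n t t0T) _; rewrite mulrAC ler_wpM2r ?exprn_ge0 ?divr_ge0//.
  by have /andP[_ tT] := t0T; rewrite ler_wpM2l// ler_expR ler_pM2l.
have cv := geometric_increments_cvg half K0 inc.
have cl : picard g n t @[n --> \oo] --> picard_limit g t.
  by rewrite /picard_limit (fine_limsupE cv).
have := geometric_increments_lim_le k half K0 inc cl.
move=> /le_trans; apply; rewrite le_eqVlt; apply/orP; left; apply/eqP.
by field.
Qed.

Lemma ray_continuous_picard_limit : ray_continuous (picard_limit g).
Proof.
move=> t; have T0 : 0 <= `|t| + 1 by rewrite addr_ge0.
have [K K0 hK] := picard_close T0.
apply: (@uniform_limit_continuous_at _ _ (fun n t => picard g n (Num.max 0 t))); last first.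
  by move=> n; exact: ray_continuous_picard.
move=> e e0.
have : K * (1 / 2) ^+ k @[k --> \oo] --> (0 : R).
  by apply: cvg_geometric; rewrite ger0_norm; lra.
move/cvgrPdist_lt => /(_ _ e0)[N _ /(_ N (leqnn N))]; rewrite /= sub0r normrN => hN.
exists N; near=> u.
have u1 : 0 <= Num.max 0 u <= `|t| + 1.
  rewrite le_max lexx/= ge_max T0/= ltW//; near: u; apply: lt_nbhsl.
  by rewrite (le_lt_trans (ler_norm _))//; lra.
by apply: le_trans (hK N _ u1) _; apply: (le_trans _ (ltW hN)); exact: ler_norm.
Unshelve. all: by end_near. Qed.

(** The residual of the limit is compared with the k-th Picard step: both errors are of order
    2^-k. *)
Lemma picard_limitE t : 0 <= t ->
  picard_limit g t = g t - c * volterra al (F \o picard_limit g) t.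
Proof.
move=> t0; have [lam l0 contract] := bielecki_weight.
have [K K0 hK] := picard_close t0.
have cX := ray_continuous_picard_limit.
have tt : 0 <= t <= t by rewrite t0 lexx.
have pK k : 0 <= K * (1 / 2) ^+ k by rewrite mulr_ge0// exprn_ge0// divr_ge0.
have bound k : `|picard_limit g t - (g t - c * volterra al (F \o picard_limit g) t)| <=
    (K + K * expR (lam * t)) * (1 / 2) ^+ k.
  have h1 := hK k.+1 t tt; rewrite picardS// in h1.
  have h2 : `|c * volterra al (F \o picard_limit g) t - c * volterra al (F \o picard g k) t| <=
      K * (1 / 2) ^+ k / 2 * expR (lam * t).
    apply: contract => //; first exact: ray_continuous_picard.
    move=> s s0t; apply: le_trans (hK k s s0t) _.
    have /andP[s0 _] := s0t.
    by rewrite ler_peMr// -expR0 ler_expR mulr_ge0 ?(ltW l0).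
  have e0 := expR_gt0 (lam * t).
  have h3 := mulr_ge0 (pK k) (ltW e0).
  apply: (@le_trans _ _ (K * (1 / 2) ^+ k.+1 + K * (1 / 2) ^+ k / 2 * expR (lam * t))).
    apply: le_trans (lerD h1 h2); apply: le_trans (ler_normD _ _).
    by rewrite le_eqVlt; apply/orP; left; apply/eqP; congr `|_|; ring.
  rewrite exprS; have := pK k; lra.
have cv : (K + K * expR (lam * t)) * (1 / 2) ^+ k @[k --> \oo] --> (0 : R).
  by apply: cvg_geometric; rewrite ger0_norm; lra.
apply/eqP; rewrite -subr_eq0 -normr_eq0 eq_le normr_ge0 andbT.
rewrite -(cvg_lim _ cv)//; apply: limr_ge; first by apply/cvg_ex; exists 0.
exact: nearW.
Qed.

End solution.
End picard_iteration.

(** * Well-posedness *)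

(** All nodes of the sums at time s lie in [0, s], so the iterates never look ahead of s. *)
Lemma measurable_picard d (T : measurableType d) (R : realType) (al c : R) (F : R -> R)
    (g : R -> T -> R) (t : R) : measurable_fun setT F ->
  (forall s, 0 <= s <= t -> measurable_fun setT (g s)) ->
  forall k s, 0 <= s <= t -> measurable_fun setT (fun w => picard al c F (g^~ w) k s).
Proof.
move=> mF mg; elim=> [|k IH] s s0t /=; first exact: mg.
apply: measurable_funB; first exact: mg.
apply: measurable_funM => //; apply: measurable_fine_limsup => n.
apply: measurable_sum => j; apply: measurable_funM => //.
apply: measurableT_comp => //; apply: IH.
have /andP[s0 st] := s0t; have p2 : 0 < (2 ^+ n : R) by rewrite exprn_gt0.
rewrite mulr_ge0 ?divr_ge0 ?(ltW p2)//=; apply: le_trans st.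
by rewrite ler_piMr// ler_pdivrMr// mul1r -natrX ler_nat ltnW.
Qed.

(** Valid for every [g], continuous or not; together with [noise0] the initial condition then holds
    at every w. *)
Lemma picard_limit0 (R : realType) (al c : R) (F : R -> R) (g : R -> R) :
  picard_limit al c F g 0 = g 0.
Proof.
apply: fine_limsupE; rewrite (_ : picard _ _ _ _ ^~ 0 = cst (g 0)); first exact: cvg_cst.
apply/funext => -[|k] //=; rewrite /volterra_lim (_ : fine_limsup _ = 0) ?mulr0 ?subr0//.
apply: fine_limsupE; rewrite (_ : volterra_sum _ _ ^~ 0 = cst 0); first exact: cvg_cst.
by apply/funext => n; exact: volterra_sum0.
Qed.

Lemma noise0 (R : realType) (al : R) (b : R -> R) : noise al b 0 = 0.
Proof.
apply: fine_limsupE; rewrite (_ : noise_sum _ _ ^~ 0 = cst 0); first exact: cvg_cst.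
by apply/funext => n; rewrite /noise_sum big1// => j _; rewrite !mul0r !subrr mulr0.
Qed.

Section history.
Context d (Omega : measurableType d) (R : realType).
Variables (B : R -> Omega -> R) (x0 : Omega -> R).

Lemma history_sub_measurable s : (forall t, 0 <= t -> measurable_fun setT (B t)) ->
  measurable_fun setT x0 -> history B x0 s `<=` measurable.
Proof.
move=> mB mx0; apply: smallest_sub; first exact: sigma_algebra_measurable.
move=> A [|]; last by move=> [C mC <-]; exact: mx0.
apply: smallest_sub; first exact: sigma_algebra_measurable.
by move=> {}A [t /= + [C mC <-]]; rewrite in_itv/= => /andP[t0 _]; exact: mB.
Qed.

(* The assumption on [f] is instantiated at Omega equipped with the sigma-algebra
   [history B x0 s]. *)
Lemma history_measurable_preimage (f : (R -> R) -> R -> R) s t : 0 <= t <= s ->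
  (forall d' (T : measurableType d') (X : R -> T -> R) (y : T -> R),
    (forall u, 0 <= u <= t -> measurable_fun setT (X u)) -> measurable_fun setT y ->
    measurable_fun setT (fun w => f (X^~ w) (y w))) ->
  forall A, measurable A -> history B x0 s ((fun w => f (B^~ w) (x0 w)) @^-1` A).
Proof.
move=> /andP[t0 ts] mf A mA.
pose G := <<s \bigcup_(tau in `[0, s]) g_sigma_algebra_preimage (B tau) >>
  `|` g_sigma_algebra_preimage x0.
have := mf _ (g_sigma_algebraType G) B x0; rewrite -[_ @^-1` A]setTI.
apply => //.
  move=> u /andP[u0 ut] _ C mC; apply: sub_sigma_algebra; left; apply: sub_sigma_algebra.
  by exists u; [rewrite /= in_itv/= u0 (le_trans ut)|exists C].
by move=> _ C mC; apply: sub_sigma_algebra; right; exists C.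
Qed.

End history.

Section well_posedness.
Context (R : realType) d (Omega : measurableType d) (P : probability Omega R).
Variables (H al : R) (V : R -> R) (B : R -> Omega -> R) (x0 : Omega -> R) (L : R).
Hypothesis H12 : 2^-1 < H < 1.
Hypothesis halpha : 1 - H < al < 1.
Hypothesis L0 : 0 <= L.
Hypothesis lipV : forall x y, `|derive1 V x - derive1 V y| <= L * `|x - y|.
Hypothesis hB : fractional_brownian_motion P H B.
Hypothesis mx0 : measurable_fun setT x0.

Let al01 : 0 < al < 1.
Proof.
have /andP[H1 H2] := H12; have /andP[a1 a2] := halpha.
by apply/andP; split; lra.
Qed.

Let forcing (b : R -> R) (y t : R) : R := y + C_ H al / Gamma al * noise al b t.

Definition solution t w : R :=
  picard_limit al (Gamma al)^-1 (derive1 V) (forcing (B^~ w) (x0 w)) t.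

Let mV : measurable_fun setT (derive1 V).
Proof.
by apply: continuous_measurable_fun; exact: (lipschitz_continuous L0 lipV).
Qed.

(** For each s > t the solution at t is a measurable function of [x0] and the past up to t, hence
    lies in the history at s. No exceptional set is removed. *)
Lemma solution_adapted : adapted +oo%E (filtration B x0) solution.
Proof.
move=> t [t0 _] A mA s /=; rewrite in_itv/= andbT => ts.
apply: (@history_measurable_preimage _ _ _ _ _
  (fun b y => picard_limit al (Gamma al)^-1 (derive1 V) (forcing b y) t) s t) => //; first by rewrite t0 ltW.
move=> d' T X y mX my; apply: measurable_fine_limsup => k.
apply: (@measurable_picard _ T _ al _ _ (fun s w => forcing (X^~ w) (y w) s) t) => //; last first.
  by rewrite t0 lexx.
move=> u /andP[u0 ut]; apply: measurable_funD => //; apply: measurable_funM => //.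
by apply: measurable_noise => // v /andP[v0 vu]; apply: mX; rewrite v0 (le_trans vu).
Qed.

Lemma ae_solution : {ae P, forall w,
  ray_continuous (solution ^~ w) /\ forall t, 0 <= t ->
    solution t w = forcing (B^~ w) (x0 w) t -
      (Gamma al)^-1 * volterra al (derive1 V \o solution^~ w) t}.
Proof.
apply: filterS (ae_noise H12 halpha hB) => w [cw _].
have cg : ray_continuous (forcing (B^~ w) (x0 w)).
  move=> t; apply: cvgD; first exact: cvg_cst.
  by apply: cvgM; [exact: cvg_cst|exact: cw].
split; first exact: (ray_continuous_picard_limit al01 L0 lipV cg).
by move=> t t0; exact: (@picard_limitE _ al (Gamma al)^-1 (derive1 V) L al01 L0 lipV _ cg t t0).
Qed.

Lemma solution_strong : strong_solution P H al V B x0 +oo%E solution.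
Proof.
have s0 w : solution 0 w = x0 w.
  by rewrite /solution picard_limit0 /forcing noise0 mulr0 addr0.
split.
- apply: filterS ae_solution => w [cw _].
  exact: (within_time_domain_continuous (f := solution^~ w)).
- exact: solution_adapted.
- rewrite (_ : [set _ | _] = setT) ?probability_setT//.
  by apply/seteqP; split => // w _; exact: s0.
exists (fun t w => noise al (B^~ w) t); first exact: fractional_noise_noise.
apply: filterS ae_solution => w [_ hw] t [t0 _].
by rewrite s0 hw// /forcing /volterra addrAC.
Qed.

(** Turning probability one into an almost sure statement requires the event to be measurable.
    Adaptedness provides this: the filtration at 0 is contained in the history at time 1, which
    consists of measurable sets. *)
Lemma strong_solution_initial X : strong_solution P H al V B x0 +oo%E X ->
  {ae P, forall w, X 0 w = x0 w}.
Proof.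
move=> [_ aX X0 _].
have mX0 : measurable_fun setT (X 0).
  move=> _ A mA; rewrite setTI.
  have h0 : time_domain +oo%E (0 : R) by split => //; rewrite ltry.
  apply: (history_sub_measurable (B := B) (x0 := x0) (s := 1)) => //.
    exact: (fbm_measurable hB).
  by apply: (aX 0 h0 A mA) => /=; rewrite in_itv/= ltr01.
have mE : measurable [set w | X 0 w = x0 w].
  rewrite (_ : [set _ | _] = (X 0 \- x0) @^-1` [set 0]).
    by rewrite -[_ @^-1` _]setTI; apply: measurable_funB.
  apply/seteqP; split => w /=; first by move=> ->; rewrite subrr.
  by move/eqP; rewrite subr_eq0 => /eqP.
exists (~` [set w | X 0 w = x0 w]); split => //.
  exact: measurableC.
by rewrite probability_setC// X0 subee.
Qed.

(** Off a null set both paths solve one and the same deterministic equation: the initial values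
    agree, and so do the noises [Z] and [Z']. *)
Lemma strong_solution_unique X Y : strong_solution P H al V B x0 +oo%E X ->
  strong_solution P H al V B x0 +oo%E Y -> indistinguishable P +oo%E X Y.
Proof.
move=> sX sY; have X0 := strong_solution_initial sX; have Y0 := strong_solution_initial sY.
have [cX _ _ [Z nZ eX]] := sX; have [cY _ _ [Z' nZ' eY]] := sY.
have ZZ' := fractional_noise_unique H12 hB nZ nZ'.
have cXY : {ae P, forall w, {within time_domain +oo%E, continuous (X^~ w)} /\
  {within time_domain +oo%E, continuous (Y^~ w)}} by apply: filterS2 cX cY.
have eXY : {ae P, forall w, (forall t, time_domain +oo%E t -> X t w = X 0 w
    - (Gamma al)^-1 * volterra al (derive1 V \o X^~ w) t + C_ H al / Gamma al * Z t w) /\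
  (forall t, time_domain +oo%E t -> Y t w = Y 0 w
    - (Gamma al)^-1 * volterra al (derive1 V \o Y^~ w) t + C_ H al / Gamma al * Z' t w)}.
  by apply: filterS2 eX eY.
have XY0 : {ae P, forall w, X 0 w = x0 w /\ Y 0 w = x0 w} by apply: filterS2 X0 Y0.
apply: filterS2 (filterI ZZ' cXY) (filterI eXY XY0) => w [zw [cx cy]] [[ex ey] [x0w y0w]].
move=> t [t0 _].
have td (s : R) : 0 <= s -> time_domain +oo%E s by move=> s0; split => //; rewrite ltry.
apply: (@volterra_equation_unique _ al (Gamma al)^-1 (derive1 V) L al01 L0 lipV
  (fun s => x0 w + C_ H al / Gamma al * Z s w) (X^~ w) (Y^~ w)) => //.
- exact: continuous_max0.
- exact: continuous_max0.
- by move=> s s0; rewrite (ex s (td s s0)) x0w addrAC.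
- by move=> s s0; rewrite (ey s (td s s0)) y0w zw// addrAC.
Qed.

End well_posedness.

Theorem theorem1 (R : realType) (d : measure_display)
    (Omega : measurableType d) (P : probability Omega R)
    (H alpha : R) (V : R -> R) (B : R -> Omega -> R) (x0 : Omega -> R)
    (hH : 2^-1 < H < 1) (halpha : 1 - H < alpha < 1)
    (hV : forall y, derivable V y 1)
    (hV' : exists L : R, L.-lipschitz (derive1 V))
    (hB : fractional_brownian_motion P H B)
    (hx0 : measurable_fun setT x0) :
  (exists x : R -> Omega -> R, strong_solution P H alpha V B x0 +oo%E x) /\
  (forall x y : R -> Omega -> R,
     strong_solution P H alpha V B x0 +oo%E x ->
     strong_solution P H alpha V B x0 +oo%E y ->
     indistinguishable P +oo%E x y).
Proof.
have [L lipL] := hV'.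
(* The given Lipschitz constant carries no sign, hence its absolute value. *)
have lipV x y : `|derive1 V x - derive1 V y| <= `|L| * `|x - y|.
  by apply: le_trans (lipL (x, y) _) _ => //=; rewrite ler_wpM2r// ler_norm.
split; first by exists (solution H alpha V B x0); exact: (solution_strong x0 hH halpha (normr_ge0 L) lipV hB).
by move=> x y; exact: (strong_solution_unique hH halpha (normr_ge0 L) lipV hB hx0).
Qed.
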